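(* Let $f$ be a transcendental entire function of order $\rho<1/2$ and suppose that there exist $n\in\mathbb N$ and $0<q<1$ such that \[ M(r)\ge \exp^{n+1}\bigl((\log^n r)^q\bigr),\quad\text{for large } r. \] Let $p$ be a real number with $pq>1$ and put $\psi(r)=\exp^n\bigl((\log r)^p\bigr)$. Then, for each $m>1$, there exists $r_0>0$ such that, for all $r>r_0$, we have $\psi(r)\ge r$, $M(r)>r_0$ and \[ M(\psi(r))\ge\bigl(\psi(M(r))\bigr)^m . \] Hence $F(f)$ has no unbounded components.
   Context: For a transcendental entire function $f$ and $r>0$, $M(r)=\max_{|z|=r}|f(z)|$. The order of $f$ is $\rho=\limsup_{r\to\infty}\frac{\log\log M(r)}{\log r}$. $\exp^n$ and $\log^n$ denote the $n$th iterates of the exponential and logarithm functions (not powers). ''For large $r$'' means for all sufficiently large $r$. $f^n$ denotes the $n$th iterate of $f$. The Fatou set $F(f)$ is the set of points $z\in\mathbb C$ such that $(f^n)_{n\in\mathbb N}$ forms a normal family in some neighbourhood of $z$. ''Components'' of $F(f)$ are its connected components. $\mathbb N=\{1,2,\dots\}$. *)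

(* Defs.v *)
From HB Require Import structures.
From mathcomp Require Export all_boot all_order all_algebra.
From mathcomp Require Export complex.
From mathcomp Require Export all_classical all_reals all_analysis.
Export Order.TTheory GRing.Theory Num.Theory.
Export numFieldNormedType.Exports.

Set Implicit Arguments.
Unset Strict Implicit.
Unset Printing Implicit Defensive.

Local Open Scope classical_set_scope.
Local Open Scope ring_scope.

(* The complex plane is [R[i]^o], i.e. [R[i]] with its topology as a normed
   space over itself, for an arbitrary [R : realType].  Its norm [`|z|] takes
   values in [R[i]]; [modulus z] is the same number as an element of [R] (see
   [normc_def]). *)
Notation modulus := ComplexField.Normc.normc.

Section EntireFunctions.
Variable R : realType.
Implicit Type f : R[i]^o -> R[i]^o.

(* The base field being [R[i]], derivability in direction [1] is complex
   differentiability. *)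
Definition entire f := forall z, derivable f z 1.

Definition transcendental_entire f :=
  entire f /\ ~ exists p : {poly R[i]}, forall z, f z = p.[z].

(* For continuous [f] and [0 <= r] the set is compact and nonempty, so that
   the supremum is a maximum. *)
Definition max_modulus f (r : R) : R :=
  sup [set modulus (f z) | z in [set z | modulus z = r]].

Definition order_of_growth f : \bar R :=
  limf_esup (fun r : R => (ln (ln (max_modulus f r)) / ln r)%:E) +oo.

Definition psi (n : nat) (p r : R) : R := iter n expR ((ln r) `^ p).

End EntireFunctions.

Section FatouSet.
Variable R : realType.
Implicit Types (f g : R[i]^o -> R[i]^o) (u : nat -> R[i]^o -> R[i]^o).
Implicit Types A U K : set R[i]^o.

Definition loc_unif_cvg u U g :=
  forall K, compact K -> K `<=` U -> {uniform K, u @ \oo --> g}.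

Definition loc_unif_cvg_infty u U :=
  forall K, compact K -> K `<=` U ->
    forall M : R, \forall j \near \oo, forall z, K z -> M < modulus (u j z).

(* Normality in the sense of Montel, for a family of holomorphic functions on
   a domain [U]: the constant infinity is allowed as a limit function. *)
Definition normal_family (F : set (R[i]^o -> R[i]^o)) U :=
  forall u, (forall j, F (u j)) ->
    exists s : nat -> nat, {homo s : i j / (i < j)%N} /\
      ((exists g, loc_unif_cvg (u \o s) U g) \/ loc_unif_cvg_infty (u \o s) U).

(* The neighbourhood [U] is taken to be a domain, as the dichotomy in
   [normal_family] presupposes; this loses no generality, since normality
   passes to smaller neighbourhoods. *)
Definition fatou_set f : set R[i]^o :=
  [set z | exists U, [/\ open U, connected U, U z &
     normal_family [set iter n f | n in [set n | (1 <= n)%N]] U]].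

Definition no_unbounded_component A :=
  forall z, A z -> bounded_set (connected_component A z).

End FatouSet.

(* Main.v *)
Require Import Defs.
From mathcomp Require Import ring lra zify.

(** Write M for the maximum modulus of f and exp^n for the n-th iterate of exp.

    The inequality for psi is a comparison of iterated exponentials.  Put
    y = ln r.  The lower bound for M, taken at psi(r) = exp^n(y^p), reads
    M(psi(r)) >= exp^n(exp(y^(pq))).  The order being less than 1/2 gives
    ln M(r) <= r^sigma with sigma < 1/2, hence
    psi(M(r))^m <= exp^n(m exp(sigma p y)).  As pq > 1, y^(pq) eventually exceeds
    ln m + sigma p y ([psi_max_modulus]).

    For the components, let C be an unbounded component of the Fatou set.  Three
    facts are contradictory.
    - Minimum modulus ([min_modulus]): there is m such that, for every large rho,
      some circle |z| = s with rho <= s <= rho^m satisfies |f|^2 >= M(rho).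
    - Stretching ([stretch]): let R_(k+1) = M(R_k), with R_0 large, and let K be a
      connected subset of C that meets both |z| <= R_0 and |z| >= psi(R_0)^m.  The
      connected set f^k(K) crosses the circle of the first fact between psi(R_k)
      and psi(R_k)^m, and the inequality for psi, with exponent 2m, shows that
      f^(k+1)(K) meets both |z| <= R_(k+1) and |z| >= psi(R_(k+1))^m.
    - Comparability ([component_linked]): any two points of C lie in a connected
      set K on which |f^k(y)| <= |f^k(x)|^c for x, y in K as soon as |f^k(y)| is
      large, with c independent of k.  Locally this is Harnack's inequality for
      the positive harmonic function ln|f^k|: normality makes |f^k| large on a
      whole disc once it is large at one of its points.
    Thus psi(R_k) <= R_k^c for all large k, whereas psi(r) outgrows every power of r.

    The minimum modulus theorem rests on a Phragmen-Lindelof argument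
    ([slit_comparison]).  On a given disc f is close to a Taylor polynomial
    P(z) = c prod (z - z_j).  With b_j = |z_j|, the modulus of P on |z| = s is at
    least |c| prod |s - b_j| and at most |c| prod (s + b_j); so it suffices to
    treat p(z) = c prod (z - b_j), to bound it from above on the slit [rho, oo) and
    to conclude at -rho.  If |p| <= A on [rho, rho^m], then beyond rho^m the growth
    of order sigma < 1/2 is dominated by a majorant without zeros in the plane slit
    along [rho, oo), a polynomial in zeta = sqrt(rho - z) with negative zeros, whose
    value at -rho is bounded; hence |p(-rho)| is at most a constant times A.

    The required complex analysis starts from Goursat's theorem on rectangles
    ([goursat]), which yields Cauchy's formula ([cauchy_formula]), from which come
    the approximation of entire functions by polynomials ([taylor_remainder]) and
    a Lipschitz bound for bounded holomorphic functions ([cauchy_lipschitz]). *)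

Set Implicit Arguments.
Unset Strict Implicit.
Unset Printing Implicit Defensive.

Local Open Scope classical_set_scope.
Local Open Scope ring_scope.

(** * Moduli and the topology of the complex plane *)

Section Modulus.
Variable R : realType.
Implicit Types (x y z : R[i]) (a b : R).

Lemma normE z : `|z| = (modulus z)%:C%C.
Proof. by case: z. Qed.

Lemma modulus_ge0 z : 0 <= modulus z.
Proof. by case: z => a b; exact: sqrtr_ge0. Qed.

Lemma modulusD x y : modulus (x + y) <= modulus x + modulus y.
Proof. by rewrite -lecR rmorphD/= -!normE; exact: ler_normD. Qed.

Lemma modulusN x : modulus (- x) = modulus x.
Proof. by case: x => a b /=; rewrite !sqrrN. Qed.

Lemma modulusB x y : modulus (x - y) = modulus (y - x).
Proof. by rewrite -modulusN opprB. Qed.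

Lemma modulus_triangle x y z : modulus (x - z) <= modulus (x - y) + modulus (y - z).
Proof. by rewrite (le_trans _ (modulusD _ _))// addrA subrK. Qed.

Lemma modulusM x y : modulus (x * y) = modulus x * modulus y.
Proof. exact: ComplexField.Normc.normcM. Qed.

Lemma modulusV x : modulus x^-1 = (modulus x)^-1.
Proof. exact: ComplexField.Normc.normcV. Qed.

Lemma modulus0 : modulus (0 : R[i]) = 0.
Proof. exact: ComplexField.Normc.normc0. Qed.

Lemma modulus1 : modulus (1 : R[i]) = 1.
Proof. exact: ComplexField.Normc.normc1. Qed.

Lemma modulusX x n : modulus (x ^+ n) = modulus x ^+ n.
Proof. by elim: n => [|n IH]; rewrite ?expr0 ?modulus1// !exprS modulusM IH. Qed.

Lemma modulus_eq0 x : (modulus x == 0) = (x == 0).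
Proof.
apply/eqP/eqP => [/ComplexField.Normc.eq0_normc//|->]; exact: modulus0.
Qed.

Lemma modulus_gt0 x : (0 < modulus x) = (x != 0).
Proof. by rewrite lt_def modulus_ge0 andbT modulus_eq0. Qed.

Lemma modulus_real a : modulus a%:C%C = `|a|.
Proof. by rewrite /= expr0n addr0 sqrtr_sqr. Qed.

Lemma modulus_i : modulus ('i%C : R[i]) = 1.
Proof. by rewrite /= expr0n add0r expr1n sqrtr1. Qed.

Lemma Re_le_modulus z : `|complex.Re z| <= modulus z.
Proof.
by case: z => a b /=; rewrite -sqrtr_sqr ler_wsqrtr// lerDl sqr_ge0.
Qed.

Lemma Im_le_modulus z : `|complex.Im z| <= modulus z.
Proof.
by case: z => a b /=; rewrite -sqrtr_sqr ler_wsqrtr// lerDr sqr_ge0.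
Qed.

Lemma modulus_le_ReIm z : modulus z <= `|complex.Re z| + `|complex.Im z|.
Proof.
rewrite {1}(complexE z) (le_trans (modulusD _ _))// modulusM modulus_i mul1r.
by rewrite !modulus_real.
Qed.

Lemma modulus_sum (I : Type) (r : seq I) (P : pred I) (F : I -> R[i]) :
  modulus (\sum_(i <- r | P i) F i) <= \sum_(i <- r | P i) modulus (F i).
Proof.
elim/big_ind2: _ => //; first by rewrite modulus0.
by move=> x a y b xa yb; rewrite (le_trans (modulusD _ _))// lerD.
Qed.

Lemma modulus_prod (I : Type) (r : seq I) (P : pred I) (F : I -> R[i]) :
  modulus (\prod_(i <- r | P i) F i) = \prod_(i <- r | P i) modulus (F i).
Proof. exact: (big_morph _ modulusM modulus1). Qed.

Lemma modulus_sub_le x y : modulus x - modulus y <= modulus (x - y).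
Proof. by rewrite lerBlDr (le_trans _ (modulusD _ _))// subrK. Qed.

Lemma dist_modulus_le x y : `|modulus x - modulus y| <= modulus (x - y).
Proof.
rewrite ler_norml modulus_sub_le andbT lerNl opprB.
by rewrite (modulusB x) modulus_sub_le.
Qed.

Lemma nbhs_modulusP (z : R[i]^o) (A : set R[i]^o) :
  nbhs z A <-> exists2 d : R, 0 < d & forall y, modulus (y - z) < d -> A y.
Proof.
split.
  move=> /nbhs_ballP[e /= e0 sub].
  have eE : e = (complex.Re e)%:C%C by rewrite RRe_real// gtr0_real.
  exists (complex.Re e); first by move: e0; rewrite eE ltcR.
  move=> y yz; apply: sub; rewrite -ball_normE/=.
  by rewrite eE normE ltcR modulusB.
move=> [d d0 sub]; apply/nbhs_ballP; exists d%:C%C; first by rewrite /= ltcR.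
by move=> y; rewrite -ball_normE/= normE ltcR modulusB => /sub.
Qed.

Lemma open_modulusP (A : set R[i]^o) : open A <->
  forall z, A z -> exists2 d : R, 0 < d & forall y, modulus (y - z) < d -> A y.
Proof.
rewrite openE; split => [oA z /oA/nbhs_modulusP//|h z Az].
by apply/nbhs_modulusP; apply: h.
Qed.

Lemma continuous_modulusP (f : R[i]^o -> R[i]^o) z : {for z, continuous f} <->
  forall e : R, 0 < e -> exists2 d : R, 0 < d &
    forall y, modulus (y - z) < d -> modulus (f y - f z) < e.
Proof.
split.
  move=> fz e e0; apply/nbhs_modulusP.
  have /fz : nbhs (f z) [set y : R[i]^o | modulus (y - f z) < e].
    by apply/nbhs_modulusP; exists e.
  by [].
move=> h A /nbhs_modulusP[e e0 sub].
have [d d0 dP] := h e e0; apply/nbhs_modulusP; exists d => // y /dP.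
exact: sub.
Qed.

Lemma continuous_modulus : continuous (@modulus R : R[i]^o -> R).
Proof.
move=> z A [e /= e0 sub]; apply/nbhs_modulusP; exists e => // y yz.
apply: sub => /=; rewrite (le_lt_trans _ yz)//.
by rewrite (modulusB y) dist_modulus_le.
Qed.

Lemma derivable_modulusP (f : R[i]^o -> R[i]^o) z : derivable f z 1 <->
  exists d, forall e : R, 0 < e -> exists2 r : R, 0 < r &
    forall h, modulus h < r -> modulus (f (z + h) - f z - d * h) <= e * modulus h.
Proof.
split.
  move=> /cvg_ex[d /= dP]; exists d => e e0.
  have : nbhs (d : R[i]^o) [set y | modulus (y - d) < e].
    by apply/nbhs_modulusP; exists e.
  move=> /dP[r' /= r0 H].
  have rE : r' = (complex.Re r')%:C%C by rewrite RRe_real// gtr0_real.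
  exists (complex.Re r'); first by move: r0; rewrite rE ltcR.
  move=> h hr; have [->|h0] := eqVneq h 0.
    by rewrite addr0 subrr mulr0 subr0 modulus0 mulr0.
  have := H h; rewrite /= sub0r normrN normE rE ltcR => /(_ hr h0).
  rewrite /GRing.scale/= mulr1 (addrC h) => /ltW K.
  rewrite -[in leLHS](mulfVK h0 (f (z + h) - f z)) -mulrBl modulusM.
  by rewrite ler_wpM2r ?modulus_ge0// mulrC.
move=> [d dP]; apply/cvg_ex; exists d => /= A /nbhs_modulusP[e e0 sub].
have [r r0 rP] := dP (e / 2) (divr_gt0 e0 (ltr0Sn _ _)).
exists r%:C%C; first by rewrite /= ltcR.
move=> h /=; rewrite sub0r normrN normE ltcR => hr h0; apply: sub.
rewrite /GRing.scale/= mulr1 (addrC h).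
have hp : 0 < modulus h by rewrite modulus_gt0.
rewrite -(ltr_pM2r hp) -modulusM mulrBl [h^-1 * _ * h]mulrAC mulVf// mul1r.
by rewrite (le_lt_trans (rP _ hr))// ltr_pM2r// ltr_pdivrMr// mulr_natr mulr2n ltrDl.
Qed.

End Modulus.

(** * Rules of complex differentiation *)

Section DerivableRules.
Variable K : numFieldType.
Implicit Types (f g : K^o -> K^o) (w z : K^o).

Lemma derivable_subVK w z : z != w -> derivable (fun z : K^o => (z - w)^-1 : K^o) z 1.
Proof.
move=> zw; have nz : (id - cst w : K^o -> K^o) z != 0 by rewrite /= subr_eq0.
have d : derivable (id - cst w : K^o -> K^o) z 1.
  by apply: derivableB; [exact: derivable_id|exact: derivable_cst].
exact: (derivableV nz d).
Qed.

Lemma derivable_cauchyK f w z : z != w -> derivable f z 1 ->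
  derivable (fun z => f z * (z - w)^-1) z 1.
Proof. by move=> zw fz; exact: (derivableM fz (derivable_subVK zw)). Qed.

Lemma derivable_divXK f k z : z != 0 -> derivable f z 1 ->
  derivable (fun z => f z * z^-1 ^+ k) z 1.
Proof.
move=> z0 fz.
have dV : derivable (fun y : K^o => y^-1 : K^o) z 1.
  exact: (@derivableV K K^o id z 1 z0 (@derivable_id _ _ _ _)).
have dX := @derivableX K K^o (fun y => y^-1) k z 1 dV.
have -> : (fun z => f z * z^-1 ^+ k) = f * ((fun y : K^o => y^-1 : K^o) ^+ k).
  by apply/funext => y; rewrite mulrfctE exprfctE.
exact: derivableM fz dX.
Qed.

Lemma derivable_exprK f n z :
  derivable f z 1 -> derivable (fun z => f z ^+ n) z 1.
Proof.
move=> fz; rewrite (_ : (fun z => _) = f ^+ n); first exact: derivableX fz.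
by apply/funext => y; rewrite exprfctE.
Qed.

Lemma derivable_compK f g z : derivable f z 1 -> derivable g (f z) 1 ->
  derivable (fun z => g (f z)) z 1.
Proof.
move=> /derivable1_diffP df /derivable1_diffP dg.
by apply/derivable1_diffP; exact: differentiable_comp df dg.
Qed.

Lemma derivable_divK f g z : g z != 0 -> derivable f z 1 -> derivable g z 1 ->
  derivable (fun z => f z / g z) z 1.
Proof.
by move=> gz df dg; exact: (derivableM df (derivableV gz dg)).
Qed.

Lemma derivable_affineK w v z : derivable (fun z : K^o => w + v * (z - w) : K^o) z 1.
Proof.
apply: (@derivableD _ _ _ (cst w) (fun z => v * (z - w))); first exact: derivable_cst.
apply: (@derivableM _ _ (cst v) (id - cst w)); first exact: derivable_cst.
by apply: derivableB; [exact: derivable_id|exact: derivable_cst].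
Qed.

Lemma derivable_prodK (I : Type) (r : seq I) (F : I -> K^o -> K^o) z :
  (forall i, derivable (F i) z 1) -> derivable (fun z => \prod_(i <- r) F i z) z 1.
Proof.
move=> H; elim: r => [|i r IH].
  rewrite (_ : (fun z => _) = cst 1); first exact: derivable_cst.
  by apply/funext => y; rewrite big_nil.
rewrite (_ : (fun z => _) = F i * (fun z => \prod_(i <- r) F i z)).
  exact: derivableM.
by apply/funext => y; rewrite big_cons mulrfctE.
Qed.

Lemma derivable_cstMK f w z : derivable f z 1 -> derivable (fun z => w * f z) z 1.
Proof. by move=> df; exact: (derivableM (derivable_cst w z 1) df). Qed.

Lemma derivable_VK f z : f z != 0 -> derivable f z 1 -> derivable (fun z => (f z)^-1) z 1.
Proof. by move=> fz df; exact: (derivableV fz df). Qed.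

End DerivableRules.

(** * Integrals along horizontal and vertical segments *)

Section ContourIntegral.
Variable R : realType.
Implicit Types (a b c d e t : R) (h k : R -> R[i]^o) (f : R[i]^o -> R[i]^o).
Local Notation mu := (@lebesgue_measure R).
Local Notation Re := (@complex.Re R).
Local Notation Im := (@complex.Im R).

Definition cint a b h : R[i] :=
  Complex (\int[mu]_(t in `[a, b]) Re (h t)) (\int[mu]_(t in `[a, b]) Im (h t)).

Lemma continuous_Re : continuous (Re : R[i]^o -> R).
Proof.
move=> z A [e /= e0 sub]; apply/nbhs_modulusP; exists e => // y yz.
apply: sub => /=; rewrite (le_lt_trans _ yz)// (modulusB y).
by rewrite (le_trans _ (Re_le_modulus _))//; case: z {yz} => ? ?; case: y.
Qed.

Lemma continuous_Im : continuous (Im : R[i]^o -> R).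
Proof.
move=> z A [e /= e0 sub]; apply/nbhs_modulusP; exists e => // y yz.
apply: sub => /=; rewrite (le_lt_trans _ yz)// (modulusB y).
by rewrite (le_trans _ (Im_le_modulus _))//; case: z {yz} => ? ?; case: y.
Qed.

Section Integrable.
Variables (a b : R) (h : R -> R[i]^o).
Hypothesis ch : {in `[a, b], continuous h}.

Lemma integrable_Re : mu.-integrable `[a, b] (EFin \o (Re \o h)).
Proof.
apply: continuous_compact_integrable; first exact: segment_compact.
apply: continuous_in_subspaceT => x; rewrite inE => xab.
apply: continuous_comp; first exact: ch.
exact: continuous_Re.
Qed.

Lemma integrable_Im : mu.-integrable `[a, b] (EFin \o (Im \o h)).
Proof.
apply: continuous_compact_integrable; first exact: segment_compact.
apply: continuous_in_subspaceT => x; rewrite inE => xab.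
apply: continuous_comp; first exact: ch.
exact: continuous_Im.
Qed.

End Integrable.

Lemma eq_cint a b h k : {in `[a, b], h =1 k} -> cint a b h = cint a b k.
Proof.
move=> hk; congr Complex; apply: eq_Rintegral => x;
  by rewrite inE /= => xab; rewrite hk.
Qed.

Lemma cintD a b h k : {in `[a, b], continuous h} -> {in `[a, b], continuous k} ->
  cint a b (fun t => h t + k t) = cint a b h + cint a b k.
Proof.
move=> ch ck; rewrite /cint.
rewrite -[RHS]/(Complex (_ + _) (_ + _)) -!RintegralD//;
  try exact: integrable_Re; try exact: integrable_Im.
by congr Complex; apply: eq_Rintegral => x _; case: (h x) (k x) => ? ? [].
Qed.

Lemma cintZ a b (w : R[i]) h : {in `[a, b], continuous h} ->
  cint a b (fun t => w * h t) = w * cint a b h.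
Proof.
move=> ch; rewrite /cint; case: w => u v.
have iR := integrable_Re ch; have iI := integrable_Im ch.
rewrite -[RHS]/(Complex (_ - _) (_ + _)) -!RintegralZl//.
rewrite -RintegralB//; last 2 first.
- exact: (@integrableZl _ _ _ mu _ _ _ _ iR).
- exact: (@integrableZl _ _ _ mu _ _ _ _ iI).
rewrite -RintegralD//; last 2 first.
- exact: (@integrableZl _ _ _ mu _ _ _ _ iI).
- exact: (@integrableZl _ _ _ mu _ _ _ _ iR).
by congr Complex; apply: eq_Rintegral => x _; case: (h x).
Qed.

Lemma cintN a b h : {in `[a, b], continuous h} ->
  cint a b (fun t => - h t) = - cint a b h.
Proof.
by move=> ch; rewrite -mulN1r -cintZ//; apply: eq_cint => t _; rewrite mulN1r.
Qed.

Lemma cintB a b h k : {in `[a, b], continuous h} -> {in `[a, b], continuous k} ->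
  cint a b (fun t => h t - k t) = cint a b h - cint a b k.
Proof.
move=> ch ck; have cN : {in `[a, b], continuous (fun t => - k t)}.
  by move=> x xab; apply: (@continuousN _ _ _ k x); exact: ck.
by rewrite (cintD ch cN) (cintN ck).
Qed.

Lemma cint_cst a b (w : R[i]) : a <= b -> cint a b (fun=> w) = (b - a)%:C%C * w.
Proof.
move=> ab; rewrite /cint !Rintegral_cst//= lebesgue_measure_itv/= lte_fin.
have [_|ba] := ltP a b.
  by rewrite /=; case: w => u v; simpc; rewrite (mulrC u) (mulrC v).
have -> : a = b by apply/eqP; rewrite eq_le ab ba.
by rewrite subrr /= !mulr0 mul0r.
Qed.

Lemma Rintegral_cat a b c (p : R -> R) : a <= c -> c <= b ->
  mu.-integrable `[a, b] (EFin \o p) ->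
  \int[mu]_(t in `[a, b]) p t =
  \int[mu]_(t in `[a, c]) p t + \int[mu]_(t in `[c, b]) p t.
Proof.
move=> ac cb ip.
have B1 : (BLeft a <= BRight c)%O by rewrite bnd_simp.
have B2 : (BRight c <= BRight b)%O by rewrite bnd_simp.
have ip' : mu.-integrable `]c, b] (EFin \o p).
  by apply: integrableS ip => //; apply: subset_itvr; rewrite bnd_simp.
have := Rintegral_itvB ip B1 B2.
by rewrite (Rintegral_itv_obnd_cbnd ip') => <-; rewrite addrC subrK.
Qed.

Lemma cint_cat a b c h : a <= c -> c <= b -> {in `[a, b], continuous h} ->
  cint a b h = cint a c h + cint c b h.
Proof.
move=> ac cb ch; rewrite /cint -[RHS]/(Complex (_ + _) (_ + _)).
congr Complex; apply: Rintegral_cat => //.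
  exact: integrable_Re ch.
exact: integrable_Im ch.
Qed.

(** The factor 2, which comes from estimating the real and imaginary parts separately,
    is harmless: only orders of magnitude are used below. *)
Lemma modulus_cint a b h B : a <= b -> {in `[a, b], continuous h} ->
  (forall t, a <= t <= b -> modulus (h t) <= B) ->
  modulus (cint a b h) <= 2 * B * (b - a).
Proof.
move=> ab ch hB; rewrite (le_trans (modulus_le_ReIm _))//=.
have bnd (p : R[i]^o -> R) : (forall z, `|p z| <= modulus z) ->
    mu.-integrable `[a, b] (EFin \o (p \o h)) ->
    `|\int[mu]_(t in `[a, b]) p (h t)| <= B * (b - a).
  move=> pm ip; rewrite (le_trans (le_normr_Rintegral _ ip))//.
  apply: (@le_trans _ _ (\int[mu]_(t in `[a, b]) B)).
    apply: le_Rintegral => //.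
    - exact: integrable_norm ip.
    - by apply: continuous_compact_integrable;
        [exact: segment_compact | apply: continuous_subspaceT => x; exact: cvg_cst].
    - by move=> x /= xab; rewrite (le_trans (pm _))// hB//; move: xab; rewrite in_itv.
  rewrite Rintegral_cst//= lebesgue_measure_itv/= lte_fin.
  case: ltP => [//|ba] /=.
  by have -> : a = b by [apply/eqP; rewrite eq_le ab ba]; rewrite subrr.
rewrite -mulrA mulrDl mul1r lerD// bnd//.
- exact: Re_le_modulus.
- exact: integrable_Re.
- exact: Im_le_modulus.
- exact: integrable_Im.
Qed.

End ContourIntegral.

(** * Goursat's theorem on rectangles *)

Section Goursat.
Variable R : realType.
Implicit Types (a b c d e t x y : R) (f g : R[i]^o -> R[i]^o).
Local Notation Re := (@complex.Re R).
Local Notation Im := (@complex.Im R).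

(** The integral of [f] along the boundary of [a, b] x [c, d], counterclockwise. *)
Definition rect a b c d f : R[i] :=
  cint a b (fun t => f (Complex t c)) - cint a b (fun t => f (Complex t d)) +
  'i%C * (cint c d (fun t => f (Complex b t)) - cint c d (fun t => f (Complex a t))).

(** Continuity is asked at the points of the boundary only, so that singularities
    inside the rectangle are allowed. *)
Definition rect_continuous a b c d f :=
  [/\ forall t, a <= t <= b -> {for Complex t c, continuous f},
      forall t, a <= t <= b -> {for Complex t d, continuous f},
      forall t, c <= t <= d -> {for Complex a t, continuous f} &
      forall t, c <= t <= d -> {for Complex b t, continuous f}].

Lemma continuous_hor c : continuous (fun t : R => Complex t c : R[i]^o).
Proof.
move=> t A /nbhs_modulusP[e e0 sub]; exists e => //= u tu; apply: sub.
rewrite -[_ - _]/(Complex (u - t) (c - c)) subrr modulus_real.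
by rewrite distrC.
Qed.

Lemma continuous_ver a : continuous (fun t : R => Complex a t : R[i]^o).
Proof.
move=> t A /nbhs_modulusP[e e0 sub]; exists e => //= u tu; apply: sub.
rewrite -[_ - _]/(Complex (a - a) (u - t)) subrr /= expr0n add0r sqrtr_sqr.
by rewrite distrC.
Qed.

Lemma hor_continuous a b c f :
  (forall t, a <= t <= b -> {for Complex t c, continuous f}) ->
  {in `[a, b], continuous (fun t => f (Complex t c))}.
Proof.
move=> cf t; rewrite in_itv /= => tab.
by apply: (@continuous_comp R R[i]^o); [exact: continuous_hor | exact: cf].
Qed.

Lemma ver_continuous a b c f :
  (forall t, a <= t <= b -> {for Complex c t, continuous f}) ->
  {in `[a, b], continuous (fun t => f (Complex c t))}.
Proof.
move=> cf t; rewrite in_itv /= => tab.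
by apply: (@continuous_comp R R[i]^o); [exact: continuous_ver | exact: cf].
Qed.

Lemma rectD a b c d f g : rect_continuous a b c d f -> rect_continuous a b c d g ->
  rect a b c d (fun z => f z + g z) = rect a b c d f + rect a b c d g.
Proof.
move=> [f1 f2 f3 f4] [g1 g2 g3 g4].
rewrite /rect (cintD (hor_continuous f1) (hor_continuous g1)).
rewrite (cintD (hor_continuous f2) (hor_continuous g2)).
rewrite (cintD (ver_continuous f3) (ver_continuous g3)).
rewrite (cintD (ver_continuous f4) (ver_continuous g4)).
ring.
Qed.

Lemma rectZ a b c d w f : rect_continuous a b c d f ->
  rect a b c d (fun z => w * f z) = w * rect a b c d f.
Proof.
move=> [f1 f2 f3 f4].
rewrite /rect (cintZ w (hor_continuous f1)) (cintZ w (hor_continuous f2)).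
rewrite (cintZ w (ver_continuous f3)) (cintZ w (ver_continuous f4)).
ring.
Qed.

Lemma eq_rect_fun a b c d f g :
  (forall t, a <= t <= b -> f (Complex t c) = g (Complex t c)) ->
  (forall t, a <= t <= b -> f (Complex t d) = g (Complex t d)) ->
  (forall t, c <= t <= d -> f (Complex a t) = g (Complex a t)) ->
  (forall t, c <= t <= d -> f (Complex b t) = g (Complex b t)) ->
  rect a b c d f = rect a b c d g.
Proof.
move=> h1 h2 h3 h4; rewrite /rect; congr (_ - _ + 'i%C * (_ - _));
  by apply: eq_cint => t; rewrite in_itv/=; auto.
Qed.

Lemma modulus_rect a b c d f B : a <= b -> c <= d -> rect_continuous a b c d f ->
  (forall t, a <= t <= b -> modulus (f (Complex t c)) <= B) ->
  (forall t, a <= t <= b -> modulus (f (Complex t d)) <= B) ->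
  (forall t, c <= t <= d -> modulus (f (Complex a t)) <= B) ->
  (forall t, c <= t <= d -> modulus (f (Complex b t)) <= B) ->
  modulus (rect a b c d f) <= 4 * B * ((b - a) + (d - c)).
Proof.
move=> ab cd [f1 f2 f3 f4] h1 h2 h3 h4; rewrite /rect.
have H (u v : R[i]) : modulus (u - v) <= modulus u + modulus v.
  by rewrite (le_trans (modulusD _ _))// modulusN.
rewrite (le_trans (modulusD _ _))// modulusM modulus_i mul1r.
rewrite mulrDr lerD// (le_trans (H _ _))//.
  have -> : 4 * B * (b - a) = 2 * B * (b - a) + 2 * B * (b - a) by ring.
  exact: lerD (modulus_cint ab (hor_continuous f1) h1)
              (modulus_cint ab (hor_continuous f2) h2).
have -> : 4 * B * (d - c) = 2 * B * (d - c) + 2 * B * (d - c) by ring.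
exact: lerD (modulus_cint cd (ver_continuous f4) h4)
            (modulus_cint cd (ver_continuous f3) h3).
Qed.

Lemma rect_split_hor a b c d e f : a <= e -> e <= b -> rect_continuous a b c d f ->
  rect a b c d f = rect a e c d f + rect e b c d f.
Proof.
move=> ae eb [f1 f2 f3 f4].
rewrite /rect (cint_cat ae eb (hor_continuous f1)).
rewrite (cint_cat ae eb (hor_continuous f2)); ring.
Qed.

Lemma rect_split_ver a b c d e f : c <= e -> e <= d -> rect_continuous a b c d f ->
  rect a b c d f = rect a b c e f + rect a b e d f.
Proof.
move=> ce ed [f1 f2 f3 f4].
rewrite /rect (cint_cat ce ed (ver_continuous f3)).
rewrite (cint_cat ce ed (ver_continuous f4)); ring.
Qed.

(** The contributions of opposite sides differ by constants, so that no primitive is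
    involved. *)
Lemma rect_affine a b c d (u v : R[i]) : a <= b -> c <= d ->
  rect a b c d (fun z => u + v * z) = 0.
Proof.
move=> ab cd.
have cont : continuous (fun z : R[i]^o => u + v * z : R[i]^o).
  move=> z; apply/continuous_modulusP => e e0.
  have v0 : 0 < modulus v + 1 by rewrite ltr_wpDl ?modulus_ge0.
  exists (e / (modulus v + 1)); first by rewrite divr_gt0.
  move=> y yz; have -> : u + v * y - (u + v * z) = v * (y - z) by ring.
  rewrite modulusM (le_lt_trans (_ : _ <= (modulus v + 1) * modulus (y - z)))//.
    by rewrite ler_wpM2r ?modulus_ge0// lerDl.
  by rewrite mulrC -ltr_pdivlMr.
have ch t : {in `[a, b], continuous (fun x => u + v * Complex x t : R[i]^o)}.
  by apply: (@hor_continuous _ _ _ (fun z => u + v * z)) => x _; exact: cont.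
have cv t : {in `[c, d], continuous (fun x => u + v * Complex t x : R[i]^o)}.
  by apply: (@ver_continuous _ _ _ (fun z => u + v * z)) => x _; exact: cont.
rewrite /rect -(cintB (ch c) (ch d)) -(cintB (cv b) (cv a)).
rewrite (@eq_cint _ a b _ (fun=> v * Complex 0 (c - d))); last first.
  move=> t _; have -> : Complex 0 (c - d) = Complex t c - Complex t d.
    by rewrite -[RHS]/(Complex (t - t) (c - d)) subrr.
  ring.
rewrite (@eq_cint _ c d _ (fun=> v * Complex (b - a) 0)); last first.
  move=> t _; have -> : Complex (b - a) 0 = Complex b t - Complex a t.
    by rewrite -[RHS]/(Complex (b - a) (t - t)) subrr.
  ring.
rewrite !cint_cst//.
have -> : Complex 0 (c - d) = - ('i%C * (d - c)%:C%C).
  by rewrite -mulrN -rmorphN opprB; simpc.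
rewrite -[Complex (b - a) 0]/((b - a)%:C%C); ring.
Qed.

Definition holo_on a b c d f :=
  forall x y, a <= x <= b -> c <= y <= d -> derivable f (Complex x y) 1.

Lemma derivable_continuous f z : derivable f z 1 -> {for z, continuous f}.
Proof. by move=> /derivable1_diffP/differentiable_continuous. Qed.

Lemma holo_on_continuous a b c d f : a <= b -> c <= d ->
  holo_on a b c d f -> rect_continuous a b c d f.
Proof.
move=> ab cd h; split=> t tt; apply: derivable_continuous; apply: h => //;
  by rewrite ?lexx ?ab ?cd.
Qed.

(** One of the four quarters carries at least a quarter of the integral: the step of
    Goursat's bisection. *)
Lemma rect_quarter a b c d f : a <= b -> c <= d -> holo_on a b c d f ->
  exists q : R * R * R * R, let: (a', b', c', d') := q in
   [/\ a <= a' <= b', b' <= b, c <= c' <= d', d' <= d &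
    [/\ b' - a' = (b - a) / 2, d' - c' = (d - c) / 2 &
     modulus (rect a b c d f) <= 4 * modulus (rect a' b' c' d' f)]].
Proof.
move=> ab cd h; pose e := (a + b) / 2; pose k := (c + d) / 2.
have ae : a <= e by rewrite /e; lra.
have eb : e <= b by rewrite /e; lra.
have ck : c <= k by rewrite /k; lra.
have kd : k <= d by rewrite /k; lra.
have H1 : holo_on a e c d f.
  by move=> x y /andP[? ?] ?; apply: h => //; apply/andP; split; lra.
have H2 : holo_on e b c d f.
  by move=> x y /andP[? ?] ?; apply: h => //; apply/andP; split; lra.
have := rect_split_hor ae eb (holo_on_continuous ab cd h).
rewrite (rect_split_ver ck kd (holo_on_continuous ae cd H1)).
rewrite (rect_split_ver ck kd (holo_on_continuous eb cd H2)).
move=> E.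
have le4 : modulus (rect a b c d f) <=
    modulus (rect a e c k f) + modulus (rect a e k d f) +
    (modulus (rect e b c k f) + modulus (rect e b k d f)).
  by rewrite E (le_trans (modulusD _ _))// lerD// modulusD.
have ea : e - a = (b - a) / 2 by rewrite /e; field.
have be : b - e = (b - a) / 2 by rewrite /e; field.
have kc : k - c = (d - c) / 2 by rewrite /k; field.
have dk : d - k = (d - c) / 2 by rewrite /k; field.
clear H1 H2 E h; clearbody e k.
have [hA|hA] := lerP (modulus (rect a b c d f)) (4 * modulus (rect a e c k f)).
  by exists (a, e, c, k); rewrite !lexx ae ck; split=> //; split.
have [hB|hB] := lerP (modulus (rect a b c d f)) (4 * modulus (rect a e k d f)).
  by exists (a, e, k, d); rewrite !lexx ae ck kd; split=> //; split.
have [hC|hC] := lerP (modulus (rect a b c d f)) (4 * modulus (rect e b c k f)).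
  by exists (e, b, c, k); rewrite !lexx ae eb ck; split=> //; split.
have [hD|hD] := lerP (modulus (rect a b c d f)) (4 * modulus (rect e b k d f)).
  by exists (e, b, k, d); rewrite ae eb ck kd !lexx; split=> //; split.
have absurd (x x1 x2 x3 x4 : R) : x <= x1 + x2 + (x3 + x4) ->
    4 * x1 < x -> 4 * x2 < x -> 4 * x3 < x -> 4 * x4 < x -> False.
  move=> l4 h1 h2 h3 h4; have := ltrD (ltrD h1 h2) (ltrD h3 h4).
  rewrite -!mulrDr (_ : x + x + (x + x) = 4 * x); last by ring.
  by rewrite ltNge ler_wpM2l.
by case: (absurd _ _ _ _ _ le4 hA hB hC hD).
Qed.

Lemma nested_segments (u v : nat -> R) :
  (forall n, u n <= u n.+1) -> (forall n, v n.+1 <= v n) -> (forall n, u n <= v n) ->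
  exists x, forall n, u n <= x <= v n.
Proof.
move=> iu dv uv.
have hu m n : (m <= n)%N -> u m <= u n by move: m n; apply/nondecreasing_seqP.
have hv m n : (m <= n)%N -> v n <= v m by move: m n; apply/nonincreasing_seqP.
have ubv n : ubound (range u) (v n).
  move=> _ [m _ <-]; rewrite (le_trans (hu m (maxn m n) (leq_maxl _ _)))//.
  by rewrite (le_trans (uv _))// hv// leq_maxr.
have hs : has_sup (range u) by split; [exists (u 0%N), 0%N|exists (v 0%N)].
exists (sup (range u)) => n; apply/andP; split.
  by apply: ub_le_sup; [case: hs|exists n].
by apply: ge_sup => //; case: hs.
Qed.

(** The quarters chosen by bisection shrink to a point, where [f] is affine up to an
    error small compared with the distance.  The integral of the affine part vanishes,
    that of the error over the n-th rectangle is o(4 ^ - n), and the integral over the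
    initial rectangle is at most 4 ^ n times as large. *)
Lemma goursat a b c d f : a <= b -> c <= d -> holo_on a b c d f -> rect a b c d f = 0.
Proof.
move=> ab cd hol.
pose valid (q : R * R * R * R) := let: (a', b', c', d') := q in
  [/\ a <= a' <= b', b' <= b, c <= c' <= d' & d' <= d].
pose sub (q q' : R * R * R * R) := let: (a0, b0, c0, d0) := q in
  let: (a', b', c', d') := q' in
  [/\ a0 <= a' <= b', b' <= b0, c0 <= c' <= d', d' <= d0 &
    [/\ b' - a' = (b0 - a0) / 2, d' - c' = (d0 - c0) / 2 &
     modulus (rect a0 b0 c0 d0 f) <= 4 * modulus (rect a' b' c' d' f)]].
have ex q : exists q', valid q -> sub q q'.
  case: q => [[[a0 b0] c0] d0]; have [V|nV] := pselect (valid (a0, b0, c0, d0)); last first.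
    by exists (a, b, c, d).
  move: (V) => [/andP[aa0 ab0] bb0 /andP[cc0 cd0] dd0].
  have h0 : holo_on a0 b0 c0 d0 f.
    move=> x y /andP[x1 x2] /andP[y1 y2]; apply: hol.
      by rewrite (le_trans aa0 x1) (le_trans x2 bb0).
    by rewrite (le_trans cc0 y1) (le_trans y2 dd0).
  by have [q' hq'] := rect_quarter ab0 cd0 h0; exists q'.
have [F FP] := choice ex.
pose Q n := iter n F (a, b, c, d).
have vQ n : valid (Q n).
  elim: n => [|n IH]; first by rewrite /= !lexx ab cd.
  have := FP _ IH; rewrite -[F (Q n)]/(Q n.+1).
  case: (Q n) IH => [[[a0 b0] c0] d0] [/andP[A1 A2] A3 /andP[A4 A5] A6].
  case: (Q n.+1) => [[[a1 b1] c1] d1] [/andP[B1 B2] B3 /andP[B4 B5] B6 _].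
  split; [|exact: le_trans B3 A3| |exact: le_trans B6 A6].
    by rewrite (le_trans A1 B1).
  by rewrite (le_trans A4 B4).
have sQ n : sub (Q n) (Q n.+1) by exact: FP.
pose A n := (Q n).1.1.1; pose B n := (Q n).1.1.2.
pose C n := (Q n).1.2; pose D n := (Q n).2.
have QE n : Q n = (A n, B n, C n, D n).
  by rewrite /A /B /C /D; case: (Q n) => [[[? ?] ?] ?].
have sz n : B n - A n = (b - a) / 2 ^+ n /\ D n - C n = (d - c) / 2 ^+ n /\
    modulus (rect a b c d f) <= 4 ^+ n * modulus (rect (A n) (B n) (C n) (D n) f).
  elim: n => [|n [IH1 [IH2 IH3]]].
    by split; [|split]; rewrite /A /B /C /D /= expr0 ?divr1 ?mul1r ?lexx.
  have := sQ n; rewrite !QE => -[_ _ _ _ [-> -> H]].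
  rewrite IH1 IH2 !exprSr !invfM !mulrA; split=> //; split=> //.
  by rewrite (le_trans IH3)// -mulrA ler_wpM2l// exprn_ge0.
have ordx n : A n <= B n /\ C n <= D n.
  by have := vQ n; rewrite QE => -[/andP[_ ?] _ /andP[_ ?] _].
have [x0 hx0] : exists x, forall n, A n <= x <= B n.
  apply: nested_segments => n; last by case: (ordx n).
    by have := sQ n; rewrite !QE => -[/andP[]].
  by have := sQ n; rewrite !QE => -[].
have [y0 hy0] : exists y, forall n, C n <= y <= D n.
  apply: nested_segments => n; last by case: (ordx n).
    by have := sQ n; rewrite !QE => -[_ _ /andP[]].
  by have := sQ n; rewrite !QE => -[].
pose z0 : R[i]^o := Complex x0 y0.
have [der derP] : exists v, forall e : R, 0 < e -> exists2 r : R, 0 < r &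
    forall h, modulus h < r -> modulus (f (z0 + h) - f z0 - v * h) <= e * modulus h.
  by apply/derivable_modulusP; apply: hol; [exact: (hx0 0%N)|exact: (hy0 0%N)].
pose L := (b - a) + (d - c).
have L0 : 0 <= L by rewrite addr_ge0// subr_ge0.
have key e : 0 < e -> modulus (rect a b c d f) <= e * (4 * L ^+ 2).
  move=> e0; have [r r0 rP] := derP e e0.
  have [n nP] : exists n, L / 2 ^+ n < r.
    have [n hn] : exists n, L / r < n%:R.
      by exists (Num.truncn (L / r)).+1; exact: truncnS_gt.
    exists n; rewrite ltr_pdivrMr ?exprn_gt0// mulrC -ltr_pdivrMr//.
    by rewrite (lt_le_trans hn)// -natrX ler_nat ltnW// ltn_expl.
  have [szx [szy szr]] := sz n; have [oA oC] := ordx n.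
  pose g (z : R[i]^o) : R[i]^o := f z - (f z0 - der * z0 + der * z).
  have small x y : A n <= x <= B n -> C n <= y <= D n ->
      modulus (g (Complex x y)) <= e * (L / 2 ^+ n).
    move=> hx hy; pose h : R[i] := Complex (x - x0) (y - y0).
    have hE : Complex x y = z0 + h.
      by rewrite /z0 /h -[RHS]/(Complex (_ + _) (_ + _)); congr Complex; ring.
    have hL : modulus h <= L / 2 ^+ n.
      rewrite (le_trans (modulus_le_ReIm _))// /L mulrDl -szx -szy /= lerD//.
        by move: hx (hx0 n) => /andP[? ?] /andP[? ?]; rewrite ler_norml; apply/andP; split; lra.
      by move: hy (hy0 n) => /andP[? ?] /andP[? ?]; rewrite ler_norml; apply/andP; split; lra.
    have -> : g (Complex x y) = f (z0 + h) - f z0 - der * h by rewrite /g hE; ring.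
    by rewrite (le_trans (rP _ _))// ?(le_lt_trans hL)// ler_wpM2l// ltW.
  have An : a <= A n /\ B n <= b /\ c <= C n /\ D n <= d.
    by have := vQ n; rewrite QE => -[/andP[? ?] ? /andP[? ?] ?].
  have hn : holo_on (A n) (B n) (C n) (D n) f.
    case: An => [A1 [A2 [A3 A4]]] x y /andP[x1 x2] /andP[y1 y2]; apply: hol.
      by rewrite (le_trans A1 x1) (le_trans x2 A2).
    by rewrite (le_trans A3 y1) (le_trans y2 A4).
  have hl : holo_on (A n) (B n) (C n) (D n) (fun z => (f z0 - der * z0) + der * z).
    move=> x y _ _; apply/derivable_modulusP; exists der => e' e0'.
    exists 1 => // h _; have -> : forall X Y Z : R[i], X + Y * (Z + h) - (X + Y * Z) - Y * h = 0.
      by move=> X Y Z; ring.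
    by rewrite modulus0 mulr_ge0 ?modulus_ge0// ltW.
  have cl := holo_on_continuous oA oC hl.
  have cf := holo_on_continuous oA oC hn.
  have hg : holo_on (A n) (B n) (C n) (D n) g.
    by move=> x y hx hy; apply: derivableB; [exact: hn|exact: hl].
  have cg := holo_on_continuous oA oC hg.
  have rE : rect (A n) (B n) (C n) (D n) f = rect (A n) (B n) (C n) (D n) g.
    rewrite -[RHS]addr0 -(@rect_affine (A n) (B n) (C n) (D n) (f z0 - der * z0) der oA oC).
    rewrite -(rectD cg cl); apply: eq_rect_fun => t _; by rewrite /g subrK.
  have := modulus_rect oA oC cg.
  move=> /(_ (e * (L / 2 ^+ n))); rewrite -rE szx szy -mulrDl -/L => bnd.
  rewrite (le_trans szr)//.
  apply: (@le_trans _ _ (4 ^+ n * (4 * (e * (L / 2 ^+ n)) * (L / 2 ^+ n)))).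
    rewrite ler_wpM2l ?exprn_ge0//; apply: bnd => t tt; apply: small => //;
    by rewrite lexx ?oA ?oC.
  have -> : (4 : R) ^+ n = 2 ^+ n * 2 ^+ n by rewrite -exprMn -natrM.
  have p2 : (2 : R) ^+ n != 0 by rewrite expf_neq0.
  rewrite le_eqVlt; apply/orP; left; apply/eqP; field.
  by rewrite p2.
apply/eqP; rewrite -modulus_eq0 eq_le modulus_ge0 andbT.
apply/ler_addgt0Pr => e e0; rewrite add0r.
have p0 : 0 < 4 * L ^+ 2 + 1 by rewrite ltr_wpDl// mulr_ge0// exprn_ge0.
rewrite (le_trans (key (e / (4 * L ^+ 2 + 1)) _))//; first by rewrite divr_gt0.
rewrite mulrAC ler_pdivrMr//; apply: ler_wpM2l; first exact: ltW.
by rewrite lerDl.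
Qed.

End Goursat.

(** * Cauchy's formula on rectangles *)

Section Cauchy.
Variable R : realType.
Implicit Types (a b c d e t x y : R) (f g h : R[i]^o -> R[i]^o) (w z : R[i]^o).
Local Notation Re := (@complex.Re R).
Local Notation Im := (@complex.Im R).

(** The region between the two boundaries is cut into four rectangles on which Goursat's
    theorem applies. *)
Lemma rect_shrink a b c d a' b' c' d' h :
  a <= a' -> a' <= b' -> b' <= b -> c <= c' -> c' <= d' -> d' <= d ->
  (forall x y, a <= x <= b -> c <= y <= d -> ~ (a' < x < b' /\ c' < y < d') ->
     derivable h (Complex x y) 1) ->
  rect a b c d h = rect a' b' c' d' h.
Proof.
move=> aa ab bb cc cd dd H.
have ab' : a' <= b := le_trans ab bb.
have cd' : c' <= d := le_trans cd dd.
have A : a <= b := le_trans aa ab'.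
have C : c <= d := le_trans cc cd'.
have out x y : a <= x <= b -> c <= y <= d ->
    [|| x <= a', b' <= x, y <= c' | d' <= y] -> {for Complex x y, continuous h}.
  move=> hx hy hh; apply: derivable_continuous; apply: H => // -[/andP[h1 h2] /andP[h3 h4]].
  by move: hh; rewrite !leNgt h1 h2 h3 h4.
have c1 : rect_continuous a b c d h.
  split=> t tt; apply: out; rewrite ?lexx ?A ?C ?aa ?cc ?bb ?dd ?orbT//.
have c2 : rect_continuous a' b c d h.
  split=> t tt; apply: out; rewrite ?lexx ?A ?C ?aa ?ab' ?cc ?bb ?dd ?orbT//;
    by case/andP: tt => t1 t2; rewrite ?(le_trans aa t1).
have c3 : rect_continuous a' b' c d h.
  split=> t tt; apply: out; rewrite ?lexx ?A ?C ?aa ?ab' ?(le_trans aa ab) ?cc ?bb ?dd ?orbT//;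
    by case/andP: tt => t1 t2; rewrite ?(le_trans aa t1) ?(le_trans t2 bb).
have c4 : rect_continuous a' b' c' d h.
  split=> t /andP[t1 t2]; apply: out;
  rewrite ?lexx ?A ?C ?aa ?ab' ?(le_trans aa ab) ?cc ?cd' ?bb ?dd
    ?(le_trans aa t1) ?(le_trans t2 bb) ?(le_trans cc t1) ?(le_trans t2 dd) ?t1 ?t2 ?orbT//.
rewrite (rect_split_hor aa ab' c1) [rect a a' c d h]goursat//; last first.
  move=> x y /andP[x1 x2] hy; apply: H => //.
    by rewrite x1 (le_trans x2 ab').
  by move=> [/andP[]]; rewrite ltNge x2.
rewrite add0r (rect_split_hor ab bb c2) [rect b' b c d h]goursat//; last first.
  move=> x y /andP[x1 x2] hy; apply: H => //.
    by rewrite x2 (le_trans (le_trans aa ab) x1).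
  by move=> [/andP[_]]; rewrite ltNge x1.
rewrite addr0 (rect_split_ver cc cd' c3) [rect a' b' c c' h]goursat//; last first.
  move=> x y /andP[x1 x2] /andP[y1 y2]; apply: H.
  - by rewrite (le_trans aa x1) (le_trans x2 bb).
  - by rewrite y1 (le_trans y2 cd').
  - by move=> [_ /andP[]]; rewrite ltNge y2.
rewrite add0r (rect_split_ver cd dd c4) [rect a' b' d' d h]goursat// ?addr0//.
move=> x y /andP[x1 x2] /andP[y1 y2]; apply: H.
- by rewrite (le_trans aa x1) (le_trans x2 bb).
- by rewrite y2 (le_trans (le_trans cc cd) y1).
- by move=> [_ /andP[_]]; rewrite ltNge y1.
Qed.

Lemma derivable_subV w z : z != w -> derivable (fun z => (z - w)^-1 : R[i]^o) z 1.
Proof. exact: derivable_subVK. Qed.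

Lemma derivable_cauchy f w z : z != w -> derivable f z 1 ->
  derivable (fun z => f z * (z - w)^-1) z 1.
Proof. exact: derivable_cauchyK. Qed.

(** This is 2 pi i; only that it is a nonzero constant matters. *)
Definition winding_const : R[i] := rect (-1) 1 (-1) 1 (fun z : R[i]^o => z^-1 : R[i]^o).

Lemma Complex_neq a b c d : (a != c) || (b != d) -> Complex a b != Complex c d.
Proof. by rewrite eq_complex /= negb_and. Qed.

Lemma modulus_ge_Re x y w : `|x - Re w| <= modulus (Complex x y - w).
Proof. by case: w => u v; apply: le_trans (Re_le_modulus _). Qed.

Lemma modulus_ge_Im x y w : `|y - Im w| <= modulus (Complex x y - w).
Proof. by case: w => u v; apply: le_trans (Im_le_modulus _). Qed.

(** Enlarging the rectangle to a huge square does not change the integral, and on huge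
    squares the position of [w] is immaterial. *)
Lemma rect_index a b c d w : a < Re w < b -> c < Im w < d ->
  rect a b c d (fun z => (z - w)^-1) = winding_const.
Proof.
move=> /andP[aw wb] /andP[cw wd].
pose T0 := 2 + `|a| + `|b| + `|c| + `|d| + 2 * modulus w.
have T0b : [/\ 2 <= T0, -T0 <= a, b <= T0, -T0 <= c & (d <= T0) /\ (2 * modulus w <= T0)].
  rewrite /T0; have := modulus_ge0 w.
  have := ler_norm b; have := ler_norm d.
  have := ler_norm (- a); have := ler_norm (- c); rewrite !normrN.
  have := normr_ge0 a; have := normr_ge0 b; have := normr_ge0 c; have := normr_ge0 d.
  move: `|a| `|b| `|c| `|d| (modulus w) => x1 x2 x3 x4 x5 *.
  by split; [lra|lra|lra|lra|split; lra].
have {T0b} [T2 Ta Tb Tc [Td Tw]] := T0b; clearbody T0.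
have ab := ltW (lt_trans aw wb); have cd := ltW (lt_trans cw wd).
have E1 : rect (-T0) T0 (-T0) T0 (fun z => (z - w)^-1) =
          rect a b c d (fun z => (z - w)^-1).
  apply: rect_shrink => // x y _ _ nin; apply: derivable_subV.
  apply/eqP => E; apply: nin; rewrite -E /= in aw wb cw wd.
  by rewrite aw wb cw wd.
have E2 : rect (-T0) T0 (-T0) T0 (fun z => (z - 0)^-1) =
          rect (-1) 1 (-1) 1 (fun z => (z - 0)^-1).
  apply: rect_shrink; try lra.
  move=> x y _ _ nin; apply: derivable_subV.
  apply/eqP => -[E E']; apply: nin; rewrite E E'; split; lra.
rewrite -E1 /winding_const.
rewrite (@eq_rect_fun _ (-1) 1 (-1) 1 _ (fun z => (z - 0)^-1)); try by move=> t _; rewrite subr0.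
rewrite -E2; clear E1 E2.
apply/eqP; rewrite -subr_eq0 -modulus_eq0 eq_le modulus_ge0 andbT.
set D := rect _ _ _ _ _ - rect _ _ _ _ _.
pose q z : R[i]^o := (z - w)^-1 - (z - 0)^-1.
have hq z : z != w -> z != 0 -> derivable q z 1.
  by move=> zw z0; apply: derivableB; exact: derivable_subV.
have big T x y : T0 <= T -> (T <= `|x|) || (T <= `|y|) ->
    [/\ Complex x y != w, Complex x y != 0 &
     modulus (q (Complex x y)) <= 2 * modulus w / T ^+ 2].
  move=> TT xy; have TP : 0 < T by lra.
  have mz : T <= modulus (Complex x y).
    case/orP: xy => xy; rewrite (le_trans xy)//.
      exact: (Re_le_modulus (Complex x y)).
    exact: (Im_le_modulus (Complex x y)).
  move: (Complex x y) mz => z mz.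
  have mz0 : 0 < modulus z by rewrite (lt_le_trans TP).
  have z0 : z != 0 by rewrite -modulus_gt0.
  have mzw : T / 2 <= modulus (z - w).
    have := modulus_sub_le z w; move: mz Tw TT.
    move: (modulus z) (modulus w) (modulus (z - w)) => x1 x2 x3; lra.
  have mzw0 : 0 < modulus (z - w) by rewrite (lt_le_trans _ mzw)// divr_gt0.
  have zw : z - w != 0 by rewrite -modulus_gt0.
  split=> //; first by apply: contraNneq zw => ->; rewrite subrr.
  have -> : q z = w * ((z - w) * z)^-1.
    by rewrite /q subr0; field; rewrite zw z0.
  rewrite modulusM modulusV modulusM (mulrC 2) -mulrA ler_wpM2l ?modulus_ge0//.
  rewrite -[leRHS]invrK lef_pV2 ?posrE ?mulr_gt0// ?invr_gt0 ?divr_gt0 ?exprn_gt0//.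
  rewrite invf_div expr2 mulrAC; apply: ler_pM => //; apply: ltW => //; lra.
have onsq T t : T0 <= T -> [/\ (T <= `|t|) || (T <= `|T|), (T <= `|t|) || (T <= `|- T|),
    (T <= `|T|) || (T <= `|t|) & (T <= `|- T|) || (T <= `|t|)].
  move=> TT; have aT : `|T| = T by rewrite ger0_norm//; lra.
  by rewrite normrN aT lexx !orbT; split.
have sq_cont T h : T0 <= T -> (forall z, z != w -> z != 0 -> derivable h z 1) ->
    rect_continuous (-T) T (-T) T h.
  move=> TT hh; split=> t _; apply/derivable_continuous; have [h1 h2 h3 h4] := onsq T t TT.
  - by have [? ? _] := big T _ _ TT h2; exact: hh.
  - by have [? ? _] := big T _ _ TT h1; exact: hh.
  - by have [? ? _] := big T _ _ TT h4; exact: hh.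
  - by have [? ? _] := big T _ _ TT h3; exact: hh.
have DE T : T0 <= T -> D = rect (-T) T (-T) T q.
  move=> TT; have T0T : - T0 <= T0 by lra.
  have c0 : rect_continuous (- T0) T0 (- T0) T0 (fun z => (z - 0)^-1).
    by apply: (sq_cont T0 _ (lexx _)) => z _ z0; exact: derivable_subV.
  have cq := sq_cont T0 _ (lexx _) hq.
  have -> : D = rect (-T0) T0 (-T0) T0 q.
    apply/eqP; rewrite subr_eq -(rectD cq c0); apply/eqP.
    by apply: eq_rect_fun => t _; rewrite /q subrK.
  rewrite [RHS](@rect_shrink _ _ _ _ (-T0) T0 (-T0) T0)//; try lra.
  move=> x y _ _ nin.
  have : (T0 <= `|x|) || (T0 <= `|y|).
    case: (leP T0 `|x|) => //= h1; case: (leP T0 `|y|) => //= h2.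
    by case: nin; rewrite -!ltr_norml.
  by move=> /(big T0 x y (lexx _))[xw x0 _]; exact: hq.
have bnd T : T0 <= T -> modulus D <= 32 * modulus w / T.
  move=> TT; rewrite (DE _ TT); have TP : 0 < T by lra.
  have TT' : - T <= T by lra.
  have cq := sq_cont T _ TT hq.
  have := @modulus_rect _ _ _ _ _ q (2 * modulus w / T ^+ 2) TT' TT' cq.
  have -> : 4 * (2 * modulus w / T ^+ 2) * (T - - T + (T - - T)) = 32 * modulus w / T.
    by field; rewrite gt_eqF.
  apply => t _; have [h1 h2 h3 h4] := onsq T t TT.
  - by have [] := big T _ _ TT h2.
  - by have [] := big T _ _ TT h1.
  - by have [] := big T _ _ TT h4.
  - by have [] := big T _ _ TT h3.
apply/ler_addgt0Pr => e e0; rewrite add0r.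
pose T := Num.max T0 (32 * modulus w / e).
have TP : 0 < T by rewrite lt_max (_ : 0 < T0)//; lra.
rewrite (le_trans (bnd T _)) ?le_max ?lexx// ler_pdivrMr//.
by rewrite (mulrC e) -ler_pdivrMr// /T le_max lexx orbT.
Qed.

(** Opposite sides combine into 4 i times the integral over [-1, 1] of 1 / (1 + t ^ 2). *)
Lemma winding_const_neq0 : winding_const != 0.
Proof.
have u0 t : Complex t (-1) != 0 :> R[i] by apply: Complex_neq; rewrite oppr_eq0 oner_eq0 orbT.
have u1 t : Complex t 1 != 0 :> R[i] by apply: Complex_neq; rewrite oner_eq0 orbT.
have u2 t : Complex (-1) t != 0 :> R[i] by apply: Complex_neq; rewrite oppr_eq0 oner_eq0.
have u3 t : Complex 1 t != 0 :> R[i] by apply: Complex_neq; rewrite oner_eq0.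
have cinv (z : R[i]^o) : z != 0 -> {for z, continuous (fun z : R[i]^o => z^-1 : R[i]^o)}.
  move=> z0; rewrite (_ : (fun z => _) = (fun z => (z - 0)^-1)).
    exact: derivable_continuous (derivable_subV z0).
  by apply/funext => y; rewrite subr0.
have c1 : {in `[-1, 1], continuous (fun x => (Complex x (-1))^-1 : R[i]^o)}.
  exact: (@hor_continuous _ (-1) 1 (-1) (fun z => z^-1) (fun t _ => cinv _ (u0 t))).
have c2 : {in `[-1, 1], continuous (fun x => (Complex x 1)^-1 : R[i]^o)}.
  exact: (@hor_continuous _ (-1) 1 1 (fun z => z^-1) (fun t _ => cinv _ (u1 t))).
have c3 : {in `[-1, 1], continuous (fun x => (Complex (-1) x)^-1 : R[i]^o)}.
  exact: (@ver_continuous _ (-1) 1 (-1) (fun z => z^-1) (fun t _ => cinv _ (u2 t))).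
have c4 : {in `[-1, 1], continuous (fun x => (Complex 1 x)^-1 : R[i]^o)}.
  exact: (@ver_continuous _ (-1) 1 1 (fun z => z^-1) (fun t _ => cinv _ (u3 t))).
have cB (h k : R -> R[i]^o) : {in `[-1, 1], continuous h} -> {in `[-1, 1], continuous k} ->
    {in `[-1, 1], continuous (fun t => h t - k t)}.
  by move=> hh hk x xab; apply: (@continuousB _ _ _ h k x); [exact: hh|exact: hk].
have E1 (t : R) : (Complex t (-1))^-1 - (Complex t 1)^-1 = 'i%C * (Complex (2 / (t ^+ 2 + 1)) 0).
  rewrite -[(Complex t (-1))^-1]/(Complex (t / (t ^+ 2 + (-1) ^+ 2)) (- (-1 / (t ^+ 2 + (-1) ^+ 2)))).
  rewrite -[(Complex t 1)^-1]/(Complex (t / (t ^+ 2 + 1 ^+ 2)) (- (1 / (t ^+ 2 + 1 ^+ 2)))).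
  rewrite sqrrN expr1n -[LHS]/(Complex (_ - _) (_ - _)) -[RHS]/(Complex (_ - _) (_ + _)).
  by congr Complex; ring.
have E2 (t : R) : (Complex 1 t)^-1 - (Complex (-1) t)^-1 = Complex (2 / (t ^+ 2 + 1)) 0.
  rewrite -[(Complex 1 t)^-1]/(Complex (1 / (1 ^+ 2 + t ^+ 2)) (- (t / (1 ^+ 2 + t ^+ 2)))).
  rewrite -[(Complex (-1) t)^-1]/(Complex (-1 / ((-1) ^+ 2 + t ^+ 2)) (- (t / ((-1) ^+ 2 + t ^+ 2)))).
  rewrite sqrrN expr1n (addrC 1) -[LHS]/(Complex (_ - _) (_ - _)).
  by congr Complex; ring.
rewrite /winding_const /rect -(cintB c1 c2) -(cintB c4 c3).
rewrite (@eq_cint _ (-1) 1 _ (fun t => 'i%C * ((Complex 1 t)^-1 - (Complex (-1) t)^-1))); last first.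
  by move=> t _; rewrite E1 E2.
rewrite (cintZ 'i%C (cB _ _ c4 c3)) -mulrDr mulf_neq0//.
apply/eqP => /(congr1 Re) /=; apply/eqP; rewrite gt_eqF//.
suff : 1 * (1 - -1) <= \int[lebesgue_measure]_(t in `[-1, 1]) Re ((Complex 1 t)^-1 - (Complex (-1) t)^-1).
  by move=> H; rewrite addr_gt0// (lt_le_trans _ H)// mul1r; lra.
have <- : \int[lebesgue_measure]_(t in `[(-1), 1]) (1 : R) = 1 * (1 - -1).
  rewrite Rintegral_cst//= lebesgue_measure_itv/= lte_fin.
  by rewrite (_ : -1 < 1)//; lra.
apply: le_Rintegral => //.
- by apply: continuous_compact_integrable;
    [exact: segment_compact | apply: continuous_subspaceT => x; exact: cvg_cst].
- exact: integrable_Re (cB _ _ c4 c3).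
- move=> t tt; rewrite E2; move: tt; rewrite /= in_itv/= => /andP[t1 t2].
  have t21 : t ^+ 2 <= 1 by rewrite -ler_sqrt// sqrtr_sqr sqrtr1 ler_norml t1 t2.
  by rewrite ler_pdivlMr; nra.
Qed.

End Cauchy.

Section CauchyFormula.
Variable R : realType.
Implicit Types (a b c d e t x y : R) (f g h : R[i]^o -> R[i]^o) (w z : R[i]^o).
Local Notation Re := (@complex.Re R).
Local Notation Im := (@complex.Im R).

(** The rectangle may be shrunk to a small square around [w], on which [f z] can be
    replaced by [f w] up to a small error. *)
Theorem cauchy_formula a b c d w f : a < Re w < b -> c < Im w < d -> holo_on a b c d f ->
  rect a b c d (fun z => f z * (z - w)^-1) = winding_const R * f w.
Proof.
move=> hw1 hw2 hol; move: (hw1) (hw2) => /andP[aw wb] /andP[cw wd].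
have wE : w = Complex (Re w) (Im w) by case: (w).
have fw : derivable f w 1.
  by rewrite wE; apply: hol; rewrite !ltW.
apply/eqP; rewrite -subr_eq0 -modulus_eq0 eq_le modulus_ge0 andbT.
apply/ler_addgt0Pr => e e0; rewrite add0r.
have e64 : 0 < e / 64 by rewrite divr_gt0.
have [r r0 rP] := (iffLR (continuous_modulusP _ _) (derivable_continuous fw)) _ e64.
pose D := Num.min (r / 4) (Num.min (Num.min (Re w - a) (b - Re w)) (Num.min (Im w - c) (d - Im w))).
have D0 : 0 < D.
  by rewrite /D !lt_min !subr_gt0 aw wb cw wd divr_gt0.
have [Dr Da Db [Dc Dd]] : [/\ D <= r / 4, a <= Re w - D, Re w + D <= b &
    c <= Im w - D /\ Im w + D <= d].
  have : D <= D by []. rewrite {2}/D !le_min => /andP[-> /andP[/andP[? ?] /andP[? ?]]].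
  by split=> //; [lra|lra|split; lra].
clearbody D.
have ND (u : R) : u - D <= u + D by rewrite lerD2l; lra.
have jl (u : R) : u - D <= u - D <= u + D by rewrite lexx ND.
have jr (u : R) : u - D <= u + D <= u + D by rewrite lexx ND.
have oT (x : bool) : x || true by rewrite orbT.
have ff : rect a b c d (fun z => f z * (z - w)^-1) =
    rect (Re w - D) (Re w + D) (Im w - D) (Im w + D) (fun z => f z * (z - w)^-1).
  apply: rect_shrink; [exact: Da|lra|exact: Db|exact: Dc|lra|exact: Dd|].
  move=> x y hx hy nin; apply: derivable_cauchy; last exact: hol.
  by apply/eqP => E; apply: nin; rewrite -E /= in D0 *; split; lra.
have i1 : a <= Re w - D <= b by apply/andP; split; lra.
have i2 : a <= Re w + D <= b by apply/andP; split; lra.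
have i3 : c <= Im w - D <= d by apply/andP; split; lra.
have i4 : c <= Im w + D <= d by apply/andP; split; lra.
pose g z : R[i]^o := (f z - f w) * (z - w)^-1.
have bd x y : Re w - D <= x <= Re w + D -> Im w - D <= y <= Im w + D ->
    (D <= `|x - Re w|) || (D <= `|y - Im w|) ->
    [/\ Complex x y != w, derivable f (Complex x y) 1 &
        modulus (g (Complex x y)) <= e / 64 / D].
  move=> /andP[x1 x2] /andP[y1 y2] hD.
  have mz : D <= modulus (Complex x y - w).
    case/orP: hD => /le_trans; apply; [exact: modulus_ge_Re|exact: modulus_ge_Im].
  have mz2 : modulus (Complex x y - w) < r.
    rewrite (le_lt_trans (modulus_le_ReIm _))//.
    have h1 : `|x - Re w| <= D by rewrite ler_norml; apply/andP; split; lra.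
    have h2 : `|y - Im w| <= D by rewrite ler_norml; apply/andP; split; lra.
    rewrite [X in X - w]lock wE -lock /=; lra.
  have fz : derivable f (Complex x y) 1.
    by apply: hol; apply/andP; split; lra.
  have mz0 : 0 < modulus (Complex x y - w) by rewrite (lt_le_trans D0).
  split=> //.
    by apply: contraTneq mz0 => ->; rewrite subrr modulus0 ltxx.
  rewrite /g modulusM modulusV; apply: ler_pM; rewrite ?modulus_ge0 ?invr_ge0 ?modulus_ge0//.
    exact/ltW/rP.
  by rewrite lef_pV2.
have dg z : z != w -> derivable f z 1 -> derivable g z 1.
  move=> zw dz.
  have dk : derivable (f - cst (f w)) z 1 := derivableB dz (derivable_cst _ _ _).
  exact: (derivable_cauchy zw dk).
have aD1 : `|Re w - D - Re w| = D by rewrite addrAC subrr add0r normrN gtr0_norm.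
have aD2 : `|Re w + D - Re w| = D by rewrite addrAC subrr add0r gtr0_norm.
have aD3 : `|Im w - D - Im w| = D by rewrite addrAC subrr add0r normrN gtr0_norm.
have aD4 : `|Im w + D - Im w| = D by rewrite addrAC subrr add0r gtr0_norm.
have B1 t (tt : Re w - D <= t <= Re w + D) := bd t (Im w - D) tt (jl _).
have B2 t (tt : Re w - D <= t <= Re w + D) := bd t (Im w + D) tt (jr _).
have B3 t (tt : Im w - D <= t <= Im w + D) := bd (Re w - D) t (jl _) tt.
have B4 t (tt : Im w - D <= t <= Im w + D) := bd (Re w + D) t (jr _) tt.
rewrite aD1 in B3; rewrite aD2 in B4; rewrite aD3 in B1; rewrite aD4 in B2.
rewrite !lexx in B1 B2 B3 B4.
have cont h : (forall z, z != w -> derivable f z 1 -> derivable h z 1) ->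
    rect_continuous (Re w - D) (Re w + D) (Im w - D) (Im w + D) h.
  move=> hh; split=> t tt; apply: derivable_continuous.
  - by have [? ? _] := B1 t tt (oT _); exact: hh.
  - by have [? ? _] := B2 t tt (oT _); exact: hh.
  - by have [? ? _] := B3 t tt isT; exact: hh.
  - by have [? ? _] := B4 t tt isT; exact: hh.
have ci : rect_continuous (Re w - D) (Re w + D) (Im w - D) (Im w + D)
    (fun z => (z - w)^-1).
  by apply: cont => z zw _; exact: derivable_subV.
have ciw : rect_continuous (Re w - D) (Re w + D) (Im w - D) (Im w + D)
    (fun z => f w * (z - w)^-1).
  apply: cont => z zw _.
  exact: (@derivable_cauchy R (cst (f w)) w z zw (derivable_cst _ _ _)).
have cg := cont _ dg.
rewrite ff (_ : rect _ _ _ _ _ - _ = rect (Re w - D) (Re w + D) (Im w - D) (Im w + D) g).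
  have := @modulus_rect _ _ _ _ _ g (e / 64 / D) (ND _) (ND _) cg.
  have -> : 4 * (e / 64 / D) * (Re w + D - (Re w - D) + (Im w + D - (Im w - D))) = e / 4.
    by field; rewrite gt_eqF.
  move=> /(_ _ _ _ _)/le_trans; apply; last by lra.
  - by move=> t tt; have [] := B1 t tt (oT _).
  - by move=> t tt; have [] := B2 t tt (oT _).
  - by move=> t tt; have [] := B3 t tt isT.
  - by move=> t tt; have [] := B4 t tt isT.
rewrite -(@rect_index R (Re w - D) (Re w + D) (Im w - D) (Im w + D) w); last 2 first.
- by apply/andP; split; lra.
- by apply/andP; split; lra.
apply/eqP; rewrite subr_eq mulrC -(rectZ (f w) ci) -(rectD cg ciw); apply/eqP.
by apply: eq_rect_fun => t _; rewrite /g; ring.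
Qed.

End CauchyFormula.

(** * Cauchy's estimates and Taylor polynomials *)

Section Estimates.
Variable R : realType.

Implicit Types (a b c d e t x y : R) (f g h : R[i]^o -> R[i]^o) (w z : R[i]^o).
Local Notation Re := (@complex.Re R).
Local Notation Im := (@complex.Im R).

Lemma derivable_divX f k z : z != 0 -> derivable f z 1 ->
  derivable (fun z => f z * z^-1 ^+ k) z 1.
Proof. exact: derivable_divXK. Qed.

(** Squares rather than discs, because they are the domains on which Cauchy's formula
    is available. *)
Definition square (z0 : R[i]^o) T : set R[i]^o :=
  [set z | `|Re z - Re z0| <= T /\ `|Im z - Im z0| <= T].

Lemma squareE (z0 : R[i]^o) T x y : square z0 T (Complex x y) <->
  (Re z0 - T <= x <= Re z0 + T /\ Im z0 - T <= y <= Im z0 + T).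
Proof. by rewrite /square /= !ler_distl. Qed.

Lemma holo_square f z0 T : (forall z, square z0 T z -> derivable f z 1) ->
  holo_on (Re z0 - T) (Re z0 + T) (Im z0 - T) (Im z0 + T) f.
Proof. by move=> H x y hx hy; apply: H; apply/squareE. Qed.

Lemma square_modulus z0 T z : modulus (z - z0) <= T -> square z0 T z.
Proof.
move=> h; case: z z0 h => x y [x0 y0] h; split.
  by rewrite (le_trans (Re_le_modulus (Complex x y - Complex x0 y0))).
by rewrite (le_trans (Im_le_modulus (Complex x y - Complex x0 y0))).
Qed.

Lemma modulus_square z0 T z : square z0 T z -> modulus (z - z0) <= 2 * T.
Proof.
case: z z0 => x y [x0 y0] [h1 h2]; rewrite (le_trans (modulus_le_ReIm _))//.
by move: h1 h2 => /= h1 h2; lra.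
Qed.

Lemma square_compact z0 T : compact (square z0 T).
Proof.
have := compact_setX (@segment_compact R (Re z0 - T) (Re z0 + T))
                     (@segment_compact R (Im z0 - T) (Im z0 + T)).
pose F (p : R * R) : R[i]^o := Complex p.1 p.2.
have cF : continuous F.
  move=> p A /nbhs_modulusP[e e0 sub]; apply/nbhs_ballP.
  exists (e / 2) => /=; first by rewrite divr_gt0.
  move=> q [/= h1 h2]; apply: sub.
  rewrite (le_lt_trans (modulus_le_ReIm _))//.
  by move: h1 h2; rewrite /ball/= /F /= (distrC q.1) (distrC q.2); lra.
move=> /(continuous_compact (continuous_subspaceT cF)).
congr compact; apply/seteqP; split.
  by move=> _ [[x y] [/= +] + <-]; rewrite !in_itv/= => hx hy; apply/squareE.
by case=> x y /squareE[hx hy]; exists (x, y) => //=; rewrite !in_itv/= hx hy.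
Qed.

Lemma square_bounded f z0 T : (forall z, square z0 T z -> {for z, continuous f}) ->
  exists2 B, 0 <= B & forall z, square z0 T z -> modulus (f z) <= B.
Proof.
move=> cf.
have cm : {within square z0 T, continuous (fun z => modulus (f z))}.
  apply: continuous_in_subspaceT => z; rewrite inE => hz.
  apply: (@continuous_comp R[i]^o R[i]^o); first exact: cf.
  exact: continuous_modulus.
have := continuous_compact cm (@square_compact z0 T).
move=> /(@compact_bounded R R^o)[M [_ MP]].
exists (`|M| + 1); first by rewrite addr_ge0.
move=> z hz.
have Mlt : M < `|M| + 1 by rewrite (le_lt_trans (ler_norm _))// ltrDl.
have inA : [set modulus (f z) | z in square z0 T] (modulus (f z)) by exists z.
exact: le_trans (ler_norm _) (MP _ Mlt _ inA).
Qed.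

Definition cauchy_const : R := 32 / modulus (winding_const R).

Lemma winding_gt0 : 0 < modulus (winding_const R).
Proof. by rewrite modulus_gt0 winding_const_neq0. Qed.

Lemma cauchy_const_gt0 : 0 < cauchy_const.
Proof. by rewrite divr_gt0 ?winding_gt0. Qed.

Lemma boundary_square z0 T t : 0 < T ->
  [/\ Re z0 - T <= t <= Re z0 + T ->
      square z0 T (Complex t (Im z0 - T)) /\ T <= modulus (Complex t (Im z0 - T) - z0),
      Re z0 - T <= t <= Re z0 + T ->
      square z0 T (Complex t (Im z0 + T)) /\ T <= modulus (Complex t (Im z0 + T) - z0),
      Im z0 - T <= t <= Im z0 + T ->
      square z0 T (Complex (Re z0 - T) t) /\ T <= modulus (Complex (Re z0 - T) t - z0) &
      Im z0 - T <= t <= Im z0 + T ->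
      square z0 T (Complex (Re z0 + T) t) /\ T <= modulus (Complex (Re z0 + T) t - z0)].
Proof.
move=> T0.
have E1 (u : R) : `|u - T - u| = T by rewrite addrAC subrr add0r normrN gtr0_norm.
have E2 (u : R) : `|u + T - u| = T by rewrite addrAC subrr add0r gtr0_norm.
have jl (u : R) : u - T <= u - T <= u + T by apply/andP; split; lra.
have jr (u : R) : u - T <= u + T <= u + T by apply/andP; split; lra.
split=> tt; split; try by apply/squareE.
- by rewrite -{1}(E1 (Im z0)) modulus_ge_Im.
- by rewrite -{1}(E2 (Im z0)) modulus_ge_Im.
- by rewrite -{1}(E1 (Re z0)) modulus_ge_Re.
- by rewrite -{1}(E2 (Re z0)) modulus_ge_Re.
Qed.

Lemma square_rect_continuous g z0 T : 0 < T ->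
  (forall z, square z0 T z -> T <= modulus (z - z0) -> derivable g z 1) ->
  rect_continuous (Re z0 - T) (Re z0 + T) (Im z0 - T) (Im z0 + T) g.
Proof.
move=> T0 H.
split=> t tt; apply: derivable_continuous; have [h1 h2 h3 h4] := @boundary_square z0 T t T0.
- by have [? ?] := h1 tt; exact: H.
- by have [? ?] := h2 tt; exact: H.
- by have [? ?] := h3 tt; exact: H.
- by have [? ?] := h4 tt; exact: H.
Qed.

Lemma eq_square_integral g h z0 T : 0 < T ->
  (forall z, square z0 T z -> T <= modulus (z - z0) -> g z = h z) ->
  rect (Re z0 - T) (Re z0 + T) (Im z0 - T) (Im z0 + T) g =
  rect (Re z0 - T) (Re z0 + T) (Im z0 - T) (Im z0 + T) h.
Proof.
move=> T0 H.
apply: eq_rect_fun => t tt; have [h1 h2 h3 h4] := @boundary_square z0 T t T0.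
- by have [? ?] := h1 tt; exact: H.
- by have [? ?] := h2 tt; exact: H.
- by have [? ?] := h3 tt; exact: H.
- by have [? ?] := h4 tt; exact: H.
Qed.

Lemma modulus_square_integral g z0 T B : 0 < T ->
  (forall z, square z0 T z -> T <= modulus (z - z0) -> derivable g z 1) ->
  (forall z, square z0 T z -> T <= modulus (z - z0) -> modulus (g z) <= B) ->
  modulus (rect (Re z0 - T) (Re z0 + T) (Im z0 - T) (Im z0 + T) g) <= 16 * B * T.
Proof.
move=> T0 dg H.
have N (u : R) : u - T <= u + T by lra.
have := @modulus_rect _ _ _ _ _ g B (N _) (N _) (square_rect_continuous T0 dg).
have -> : 4 * B * (Re z0 + T - (Re z0 - T) + (Im z0 + T - (Im z0 - T))) = 16 * B * T by ring.
apply=> t tt; have [h1 h2 h3 h4] := @boundary_square z0 T t T0.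
- by have [? ?] := h1 tt; exact: H.
- by have [? ?] := h2 tt; exact: H.
- by have [? ?] := h3 tt; exact: H.
- by have [? ?] := h4 tt; exact: H.
Qed.

Lemma cauchy_square f z0 T w : (forall z, square z0 T z -> derivable f z 1) ->
  modulus (w - z0) < T ->
  rect (Re z0 - T) (Re z0 + T) (Im z0 - T) (Im z0 + T) (fun z => f z * (z - w)^-1)
    = winding_const R * f w.
Proof.
move=> hf wT; apply: cauchy_formula; last exact: holo_square.
- rewrite -ltr_distl (le_lt_trans _ wT)//; case: w z0 {wT hf} => ? ? [? ?].
  exact: (Re_le_modulus (Complex _ _)).
- rewrite -ltr_distl (le_lt_trans _ wT)//; case: w z0 {wT hf} => ? ? [? ?].
  exact: (Im_le_modulus (Complex _ _)).
Qed.

(** Subtract Cauchy's formulas for [w] and [z0]: the difference of the two kernels is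
    (w - z0) / ((z - w) (z - z0)). *)
Lemma cauchy_lipschitz f z0 T B w : 0 < T ->
  (forall z, square z0 T z -> derivable f z 1) ->
  (forall z, square z0 T z -> modulus (f z) <= B) ->
  modulus (w - z0) <= T / 2 ->
  modulus (f w - f z0) <= cauchy_const * B * modulus (w - z0) / T.
Proof.
move=> T0 hf fB wT.
have wT' : modulus (w - z0) < T by lra.
have zT' : modulus (z0 - z0) < T by rewrite subrr modulus0.
have E1 := cauchy_square hf wT'; have E2 := cauchy_square hf zT'.
pose g z : R[i]^o := f z * ((w - z0) * (z - w)^-1 * (z - z0)^-1).
pose g1 z : R[i]^o := f z * (z - w)^-1.
pose g2 z : R[i]^o := f z * (z - z0)^-1.
have bnd z : square z0 T z -> T <= modulus (z - z0) ->
    [/\ z != w, z != z0, g z = g1 z - g2 z & modulus (g z) <= B * (modulus (w - z0) / (T / 2) / T)].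
  move=> hz hT.
  have zw : T / 2 <= modulus (z - w).
    have := modulus_triangle z w z0; move: hT wT.
    lra.
  have mzw0 : 0 < modulus (z - w) by lra.
  have mz0 : 0 < modulus (z - z0) by lra.
  have nw : z - w != 0 by rewrite -modulus_gt0.
  have n0 : z - z0 != 0 by rewrite -modulus_gt0.
  split.
  - by rewrite -subr_eq0.
  - by rewrite -subr_eq0.
  - by rewrite /g /g1 /g2; field; rewrite nw n0.
  - rewrite /g !modulusM !modulusV; apply: ler_pM; rewrite ?modulus_ge0//.
    + by rewrite !mulr_ge0 ?invr_ge0 ?modulus_ge0.
    + exact: fB.
    + apply: ler_pM; rewrite ?mulr_ge0 ?invr_ge0 ?modulus_ge0//.
        by rewrite ler_wpM2l ?modulus_ge0// lef_pV2 ?posrE//; lra.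
      by rewrite lef_pV2 ?posrE.
have dg1 z : square z0 T z -> T <= modulus (z - z0) -> derivable g1 z 1.
  by move=> hz hT; have [zw _ _ _] := bnd z hz hT; exact: (derivable_cauchy zw (hf z hz)).
have dg2 z : square z0 T z -> T <= modulus (z - z0) -> derivable g2 z 1.
  by move=> hz hT; have [_ zw _ _] := bnd z hz hT; exact: (derivable_cauchy zw (hf z hz)).
have dg z : square z0 T z -> T <= modulus (z - z0) -> derivable g z 1.
  move=> hz hT; have [zw zz _ _] := bnd z hz hT.
  have -> : g = (fun y : R[i]^o => (w - z0) * (g1 y * (y - z0)^-1)).
    by apply/funext => y; rewrite /g /g1; ring.
  apply: (@derivableZ _ _ _ (fun y : R[i]^o => g1 y * (y - z0)^-1) (w - z0)).
  exact: (derivable_cauchy zz (dg1 z hz hT)).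
have c2 := square_rect_continuous T0 dg2; have cg := square_rect_continuous T0 dg.
have E : winding_const R * (f w - f z0) =
    rect (Re z0 - T) (Re z0 + T) (Im z0 - T) (Im z0 + T) g.
  rewrite mulrBr -E1 -E2; apply/eqP; rewrite subr_eq -(rectD cg c2); apply/eqP.
  apply: eq_square_integral => // z hz hT.
  by have [_ _ -> _] := bnd z hz hT; rewrite subrK.
rewrite -(ler_pM2l winding_gt0) -modulusM E.
rewrite (le_trans (modulus_square_integral T0 dg (fun z hz hT => let: And4 _ _ _ h := bnd z hz hT in h)))//.
have := winding_gt0; rewrite /cauchy_const; move: (modulus (winding_const R)) (modulus (w - z0)).
move=> W D W0; rewrite le_eqVlt; apply/orP; left; apply/eqP; field.
by rewrite !gt_eqF.
Qed.

End Estimates.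

Section Taylor.
Variable R : realType.

Implicit Types (a b c d e t x y : R) (f g h : R[i]^o -> R[i]^o) (w z : R[i]^o).
Local Notation Re := (@complex.Re R).
Local Notation Im := (@complex.Im R).

(** Defined on one square, but the value is the same on every larger one
    ([taylor_coefE]), which is what makes the coefficients decay faster than any
    geometric sequence. *)
Definition taylor_coef f k : R[i] :=
  (winding_const R)^-1 * rect (-1) 1 (-1) 1 (fun z => f z * z^-1 ^+ k.+1).

Lemma taylor_coefE f k T : entire f -> 1 <= T ->
  taylor_coef f k = (winding_const R)^-1 *
   rect (Re 0 - T) (Re 0 + T) (Im 0 - T) (Im 0 + T) (fun z => f z * z^-1 ^+ k.+1).
Proof.
move=> ef T1; rewrite /taylor_coef.
rewrite [in RHS](@rect_shrink R _ _ _ _ (-1) 1 (-1) 1)//=; try lra.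
move=> x y _ _ nin; apply: derivable_divX; last exact: ef.
by apply/eqP => -[E E']; apply: nin; rewrite E E'; split; lra.
Qed.

(** Expand the Cauchy kernel by
    1 / (z - w) = sum_(k < N) w ^ k / z ^ k.+1 + (w / z) ^ N / (z - w). *)
Lemma taylor_remainder f T B N w : entire f -> 1 <= T ->
  (forall z, square 0 T z -> modulus (f z) <= B) -> modulus w <= T / 2 ->
  modulus (f w - \sum_(k < N) taylor_coef f k * w ^+ k)
     <= cauchy_const R * B * (modulus w / T) ^+ N.
Proof.
move=> ef T1 fB wT; have T0 : 0 < T by lra.
pose h n z : R[i]^o := (f z * z^-1 ^+ n) * (z - w)^-1.
pose j n z : R[i]^o := f z * z^-1 ^+ n.+1.
pose I n := rect (Re (0:R[i]^o) - T) (Re (0:R[i]^o) + T) (Im (0:R[i]^o) - T) (Im (0:R[i]^o) + T) (h n).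
have nz z : T <= modulus (z - 0) -> [/\ z != 0, z - w != 0, T <= modulus z & T / 2 <= modulus (z - w)].
  rewrite subr0 => hT; have mz : 0 < modulus z by lra.
  have zw : T / 2 <= modulus (z - w).
    have := modulus_sub_le z w; move: hT wT.
    lra.
  by split=> //; rewrite -modulus_gt0//; lra.
have dj n z : square 0 T z -> T <= modulus (z - 0) -> derivable (j n) z 1.
  by move=> _ /nz[z0 _ _ _]; exact: (@derivable_divX R f n.+1 z z0 (ef z)).
have dh n z : square 0 T z -> T <= modulus (z - 0) -> derivable (h n) z 1.
  move=> _ /nz[z0 zw _ _]; apply: (@derivable_cauchy R (fun z => f z * z^-1 ^+ n) w z).
    by rewrite -subr_eq0.
  exact: (@derivable_divX R f n z z0 (ef z)).
have c0 : winding_const R != 0 by exact: winding_const_neq0.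
have E0 : I 0%N = winding_const R * f w.
  have w0T : modulus (w - 0) < T by rewrite subr0; lra.
  rewrite -(cauchy_square (fun z _ => ef z) w0T).
  by apply: eq_square_integral => // z _ _; rewrite /h expr0 mulr1.
have ES n : I n = w * I n.+1 + winding_const R * taylor_coef f n.
  rewrite (taylor_coefE _ ef T1) mulrA divff// mul1r.
  have ch := square_rect_continuous T0 (dh n.+1).
  have cwh : rect_continuous (Re (0:R[i]^o) - T) (Re (0:R[i]^o) + T) (Im (0:R[i]^o) - T) (Im (0:R[i]^o) + T)
      (fun z => w * h n.+1 z).
    apply: square_rect_continuous => // z hz hT.
    exact: (@derivableZ _ _ _ (h n.+1) w _ _ (dh n.+1 z hz hT)).
  rewrite -(rectZ w ch) -(rectD cwh (square_rect_continuous T0 (dj n))).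
  apply: eq_square_integral => // z _ /nz[z0 zw _ _].
  by rewrite /h /j exprS; field; rewrite zw z0.
have ER n : f w - \sum_(k < n) taylor_coef f k * w ^+ k = w ^+ n * ((winding_const R)^-1 * I n).
  elim: n => [|n IH].
    by rewrite big_ord0 subr0 expr0 mul1r E0 mulrA mulVf// mul1r.
  rewrite big_ord_recr /= opprD addrA IH ES exprSr; field.
  by rewrite c0.
rewrite ER !modulusM modulusX modulusV expr_div_n.
have hb z : square 0 T z -> T <= modulus (z - 0) -> modulus (h N z) <= B / T ^+ N / (T / 2).
  move=> hz /nz[z0 zw z1 z2]; rewrite /h !modulusM modulusX !modulusV.
  have B0 : 0 <= B by rewrite (le_trans _ (fB z hz))// modulus_ge0.
  apply: ler_pM; rewrite ?mulr_ge0 ?invr_ge0 ?exprn_ge0 ?invr_ge0 ?modulus_ge0//.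
    apply: ler_pM; rewrite ?exprn_ge0 ?invr_ge0 ?modulus_ge0//; first exact: fB.
    rewrite -exprVn; apply: lerXn2r; rewrite ?nnegrE ?invr_ge0 ?modulus_ge0 ?(ltW T0)//.
    by rewrite lef_pV2// posrE; lra.
  by rewrite lef_pV2// posrE; lra.
rewrite (_ : cauchy_const R * B * (modulus w ^+ N / T ^+ N) = modulus w ^+ N *
    ((modulus (winding_const R))^-1 * (16 * (B / T ^+ N / (T / 2)) * T))).
  rewrite ler_wpM2l ?exprn_ge0 ?modulus_ge0// ler_wpM2l ?invr_ge0 ?modulus_ge0//.
  exact: modulus_square_integral T0 (dh N) hb.
rewrite /cauchy_const; field.
by rewrite expf_neq0 ?gt_eqF ?winding_gt0.
Qed.

End Taylor.

(** * The maximum principle *)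

Section MaxModulus.
Variable R : realType.
Implicit Types (r B T : R) (f g h : R[i]^o -> R[i]^o) (z w u v : R[i]) (Q : {poly R[i]}).

Lemma sqrt_circle v : modulus v = 1 -> exists2 u, u ^+ 2 = v & modulus u = 1.
Proof.
move=> v1; exists (sqrtc v); first exact: sqr_sqrtc.
apply/eqP; rewrite -(@pexpr_eq1 _ _ 2)// ?modulus_ge0//.
by rewrite -modulusX sqr_sqrtc v1.
Qed.

(** Induction on the degree.  For |u| = 1 the even part at u ^ 2 is the mean of Q(u) and
    Q(-u), and likewise for the odd part, so both have the same bound on the circle, with
    half the degree. *)
Lemma coef_le_unit_circle Q B k : (forall w, modulus w = 1 -> modulus Q.[w] <= B) ->
  modulus Q`_k <= B.
Proof.
have [n] := ubnP (size Q); elim: n Q k => // n IH Q k szQ HB.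
have B0 : 0 <= B by rewrite (le_trans (modulus_ge0 Q.[1]))// HB ?modulus1.
have [szQ1|szQ2] := leqP (size Q) 1.
  have QE := size1_polyC szQ1; case: k => [|k]; last first.
    by rewrite nth_default ?modulus0// (leq_trans szQ1).
  by have := HB 1; rewrite modulus1 QE hornerC coefC/= => ->.
have ev u : Q.[u] = (even_poly Q).[u ^+ 2] + (odd_poly Q).[u ^+ 2] * u.
  by rewrite -{1}(poly_even_odd Q) !(hornerE, horner_comp).
have half (x y : R[i]) : modulus x <= B -> modulus y <= B -> modulus ((x + y) / 2) <= B.
  move=> hx hy; rewrite modulusM modulusV.
  have -> : modulus (2 : R[i]) = 2.
    by rewrite -(rmorph_nat (real_complex R) 2) modulus_real ger0_norm.
  rewrite ler_pdivrMr// (le_trans (modulusD _ _))//; lra.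
have n2 : (2 : R[i]) != 0 by rewrite pnatr_eq0.
rewrite -[k in Q`_k]odd_double_half; case: (odd k) => /=.
  rewrite add1n -coef_odd_poly; apply: IH.
    rewrite (leq_ltn_trans (size_odd_poly _))//.
    move: szQ szQ2; have := odd_double_half (size Q); rewrite -addnn.
    by case: odd => /=; lia.
  move=> v /sqrt_circle[u <- u1].
  have u0 : u != 0 by rewrite -modulus_gt0 u1.
  have -> : (odd_poly Q).[u ^+ 2] = (Q.[u] + - Q.[- u]) / 2 / u.
    by rewrite !ev sqrrN; field; rewrite ?n2 u0.
  rewrite modulusM modulusV u1 invr1 mulr1; apply: half; first exact: HB.
  by rewrite modulusN; apply: HB; rewrite modulusN.
rewrite add0n -coef_even_poly; apply: IH.
  rewrite (leq_ltn_trans (size_even_poly _))//.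
  rewrite uphalf_half; move: szQ szQ2; have := odd_double_half (size Q).
  by rewrite -addnn; case: odd => /=; lia.
move=> v /sqrt_circle[u <- u1].
have -> : (even_poly Q).[u ^+ 2] = (Q.[u] + Q.[- u]) / 2.
  by rewrite !ev sqrrN; field.
by apply: half; apply: HB; rewrite ?modulusN.
Qed.

Lemma coef_le_circle Q r B k : 0 < r -> (forall w, modulus w = r -> modulus Q.[w] <= B) ->
  modulus Q`_k * r ^+ k <= B.
Proof.
move=> r0 HB; pose Q' : {poly R[i]} := \poly_(i < size Q) (Q`_i * r%:C%C ^+ i).
have -> : modulus Q`_k * r ^+ k = modulus Q'`_k.
  rewrite coef_poly; case: ltnP => [_|ks].
    by rewrite modulusM modulusX modulus_real ger0_norm// ltW.
  by rewrite nth_default// modulus0 mul0r.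
apply: coef_le_unit_circle => w w1.
have -> : Q'.[w] = Q.[r%:C%C * w].
  rewrite horner_poly horner_coef; apply: eq_bigr => i _.
  by rewrite exprMn mulrA.
by apply: HB; rewrite modulusM modulus_real w1 mulr1 ger0_norm// ltW.
Qed.

Lemma center_le_circle Q r B : 0 < r -> (forall w, modulus w = r -> modulus Q.[w] <= B) ->
  modulus Q.[0] <= B.
Proof.
by move=> r0 /(coef_le_circle 0 r0); rewrite expr0 mulr1 horner_coef0.
Qed.

Definition taylor_poly f N : {poly R[i]} := \poly_(k < N) taylor_coef f k.

Lemma taylor_polyE f N w : (taylor_poly f N).[w] = \sum_(k < N) taylor_coef f k * w ^+ k.
Proof. by rewrite horner_poly. Qed.

Lemma entire_continuous f z : entire f -> {for z, continuous f}.
Proof. by move=> ef; exact: derivable_continuous. Qed.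

Lemma taylor_approx f r e : entire f -> 0 < e ->
  exists N0, forall N, (N0 <= N)%N -> forall w, modulus w <= r ->
    modulus (f w - (taylor_poly f N).[w]) <= e.
Proof.
move=> ef e0; pose T := Num.max 1 (2 * r).
have T1 : 1 <= T by rewrite le_max lexx.
have rT : r <= T / 2 by rewrite ler_pdivlMr// mulrC le_max lexx orbT.
have [B B0 fB] := @square_bounded R f 0 T (fun z _ => @entire_continuous f z ef).
have C0 := cauchy_const_gt0 R.
have [N0 hN0] : exists N, (cauchy_const R * B) / e < N%:R.
  by exists (Num.truncn (cauchy_const R * B / e)).+1; exact: truncnS_gt.
exists N0 => N N0N w wr; rewrite taylor_polyE.
rewrite (le_trans (taylor_remainder N ef T1 fB (le_trans wr rT)))//.
have T0 : 0 < T by rewrite (lt_le_trans _ T1).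
apply: (@le_trans _ _ (cauchy_const R * B * (1 / 2) ^+ N)).
  apply: ler_wpM2l; first exact: mulr_ge0 (ltW C0) B0.
  apply: lerXn2r; rewrite ?nnegrE ?divr_ge0 ?modulus_ge0 ?(ltW T0)//.
  by rewrite ler_pdivrMr// mulrAC mul1r ler_pdivlMr// -ler_pdivlMr// (le_trans wr).
rewrite expr_div_n expr1n mulrA mulr1 ler_pdivrMr ?exprn_gt0// (mulrC e) -ler_pdivrMr//.
rewrite ltW// (lt_le_trans hN0)// -natrX ler_nat (leq_trans N0N)// ltnW//.
by rewrite ltn_expl.
Qed.

Lemma taylor_coef_circle f r B k : entire f -> 0 < r ->
  (forall z, modulus z = r -> modulus (f z) <= B) -> modulus (taylor_coef f k) * r ^+ k <= B.
Proof.
move=> ef r0 HB; apply/ler_addgt0Pr => e e0.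
have [N0 hN] := taylor_approx r ef e0.
pose N := maxn N0 k.+1.
have -> : taylor_coef f k = (taylor_poly f N)`_k.
  by rewrite coef_poly ifT// leq_max ltnSn orbT.
apply: coef_le_circle => // w wr.
have := hN N (leq_maxl _ _) w; rewrite wr lexx => /(_ isT) H.
rewrite -[X in modulus X](subrK (f w)) (le_trans (modulusD _ _))// addrC lerD ?HB//.
by rewrite modulusB.
Qed.

Lemma geometric_le (x : R) n : 0 <= x -> x < 1 -> \sum_(k < n) x ^+ k <= (1 - x)^-1.
Proof.
move=> x0 x1; have p : 0 < 1 - x by rewrite subr_gt0.
rewrite -[leRHS]mul1r ler_pdivlMr// mulrC.
have -> : (1 - x) * \sum_(k < n) x ^+ k = 1 - x ^+ n.
  have := subrXX 1 x n; rewrite expr1n => ->; congr (_ * _).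
  by apply: eq_bigr => i _; rewrite expr1n mul1r.
by rewrite gerBl exprn_ge0.
Qed.

Lemma disc_le_geometric f r B z : entire f -> 0 < r ->
  (forall z, modulus z = r -> modulus (f z) <= B) -> modulus z < r ->
  modulus (f z) <= B * (1 - modulus z / r)^-1.
Proof.
move=> ef r0 HB zr.
have B0 : 0 <= B.
  have mr : modulus (r%:C%C : R[i]) = r by rewrite modulus_real ger0_norm// ltW.
  by rewrite (le_trans (modulus_ge0 (f r%:C%C)))// HB.
apply/ler_addgt0Pr => e e0.
have [N hN] := taylor_approx r ef e0.
have := hN N (leqnn _) z (ltW zr) => H.
rewrite -[X in modulus X](subrK (taylor_poly f N).[z]) (le_trans (modulusD _ _))// addrC lerD//.
rewrite taylor_polyE (le_trans (modulus_sum _ _ _))//.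
apply: (@le_trans _ _ (\sum_(k < N) B * (modulus z / r) ^+ k)).
  apply: ler_sum => k _; rewrite modulusM modulusX expr_div_n mulrA ler_pdivlMr ?exprn_gt0//.
  by rewrite mulrAC ler_wpM2r ?exprn_ge0 ?modulus_ge0// (taylor_coef_circle _ ef r0 HB).
rewrite -mulr_sumr ler_wpM2l// geometric_le ?divr_ge0 ?modulus_ge0 ?(ltW r0)//.
by rewrite ltr_pdivrMr// mul1r.
Qed.

Lemma entireX f n : entire f -> entire (fun z => f z ^+ n).
Proof. by move=> ef z; exact: (@derivable_exprK R[i] f n z (ef z)). Qed.

Lemma expr_bounded_le1 (x C : R) : 0 <= x -> (forall n, x ^+ n <= C) -> x <= 1.
Proof.
move=> x0 H; rewrite leNgt; apply/negP => x1.
have p : 0 < x - 1 by rewrite subr_gt0.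
have [n hn] : exists n, C / (x - 1) < n%:R.
  by exists (Num.truncn (C / (x - 1))).+1; exact: truncnS_gt.
have := H n; apply/negP; rewrite -ltNge.
rewrite ltr_pdivrMr// in hn; rewrite (lt_le_trans hn)//.
elim: n {hn} => [|n IH]; first by rewrite mul0r expr0.
rewrite exprS (_ : x * _ = (x - 1) * x ^+ n + x ^+ n); last by ring.
rewrite (_ : n.+1%:R * _ = (x - 1) + n%:R * (x - 1)); last by rewrite -natr1; ring.
rewrite lerD//.
by rewrite ler_peMr ?(ltW p)// exprn_ege1// ltW.
Qed.

(** The geometric bound for [f ^ n] has a constant that does not depend on [n]; taking
    n-th roots makes it disappear. *)
Lemma disc_le_circle f r B z : entire f -> 0 < r ->
  (forall z, modulus z = r -> modulus (f z) <= B) -> modulus z <= r ->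
  modulus (f z) <= B.
Proof.
move=> ef r0 HB; rewrite le_eqVlt => /predU1P[|zr]; first exact: HB.
have B0 : 0 <= B.
  have mr : modulus (r%:C%C : R[i]) = r by rewrite modulus_real ger0_norm// ltW.
  by rewrite (le_trans (modulus_ge0 (f r%:C%C)))// HB.
have [B00|Bn0] := eqVneq B 0.
  by have := disc_le_geometric ef r0 HB zr; rewrite B00 mul0r.
have Bp : 0 < B by rewrite lt_def Bn0.
suff : modulus (f z) / B <= 1 by rewrite ler_pdivrMr// mul1r.
apply: (@expr_bounded_le1 _ (1 - modulus z / r)^-1); first by rewrite divr_ge0 ?modulus_ge0.
move=> n; rewrite expr_div_n ler_pdivrMr ?exprn_gt0// -modulusX [leRHS]mulrC.
apply: (@disc_le_geometric (fun z => f z ^+ n) r (B ^+ n) z (@entireX f n ef) r0 _ zr).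
by move=> y yr; rewrite modulusX; apply: lerXn2r; rewrite ?nnegrE ?modulus_ge0// HB.
Qed.

Lemma le_max_modulus f z : entire f -> modulus (f z) <= max_modulus f (modulus z).
Proof.
move=> ef; apply: ub_le_sup; last by exists z.
have [B _ HB] := @square_bounded R f 0 (modulus z) (fun z _ => @entire_continuous f z ef).
exists B => _ [y yz <-]; apply: HB.
by apply: square_modulus; rewrite subr0 /= yz.
Qed.

Lemma disc_le_max_modulus f r z : entire f -> 0 < r -> modulus z <= r ->
  modulus (f z) <= max_modulus f r.
Proof.
move=> ef r0; apply: disc_le_circle => // y <-; exact: le_max_modulus.
Qed.

Lemma max_modulus_le f r B : 0 <= r -> (forall z, modulus z = r -> modulus (f z) <= B) ->
  max_modulus f r <= B.
Proof.
move=> r0 HB; apply: ge_sup; last by move=> _ [z zr <-]; exact: HB.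
exists (modulus (f r%:C%C)), r%:C%C => //=.
by rewrite -[LHS]/(modulus (r%:C%C : R[i])) modulus_real ger0_norm.
Qed.

End MaxModulus.

(** * A maximum principle in the slit plane *)

Section SlitLemma.
Variable R : realType.
Implicit Types (r s t B T rho a b C : R) (z w u v : R[i]) (P Q : {poly R[i]}).

Lemma pow_small (x e : R) : 0 <= x -> x < 1 -> 0 < e ->
  exists N0, forall N, (N0 <= N)%N -> x ^+ N <= e.
Proof.
move=> x0 x1 e0.
have nx : `|x| < 1 by rewrite ger0_norm.
have := cvg_expr nx => /cvgrPdist_le/(_ e e0)[N0 _ H].
by exists N0 => N NN; have := H N NN; rewrite sub0r normrN ger0_norm// exprn_ge0.
Qed.

Lemma prod_pow_small (xs : seq R) (e : R) : 0 < e ->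
  (forall x, x \in xs -> 0 <= x < 1) ->
  exists N0, forall N, (N0 <= N)%N -> \prod_(x <- xs) (1 + x ^+ N) <= 1 + e.
Proof.
elim: xs e => [|x xs IH] e e0 H.
  by exists 0%N => N _; rewrite big_nil lerDl ltW.
pose e' := Num.min 1 (e / 3).
have e'0 : 0 < e' by rewrite lt_min ltr01 divr_gt0.
have e'1 : e' <= 1 by rewrite ge_min lexx.
have e'3 : e' <= e / 3 by rewrite ge_min lexx orbT.
have /andP[x0 x1] : 0 <= x < 1 by rewrite H ?mem_head.
have H' y : y \in xs -> 0 <= y < 1 by move=> hy; apply: H; rewrite inE hy orbT.
have [N1 H1] := IH _ e'0 H'.
have [N2 H2] := pow_small x0 x1 e'0.
exists (maxn N1 N2) => N; rewrite geq_max big_cons => /andP[/H1 h1 /H2 h2].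
apply: (@le_trans _ _ ((1 + e') * (1 + e'))).
  apply: ler_pM => //; rewrite ?lerD2l ?addr_ge0 ?exprn_ge0//.
  rewrite big_seq; apply: prodr_ge0 => y /H'/andP[y0 _].
  by rewrite addr_ge0// exprn_ge0.
nra.
Qed.

(** Multiplying [P] by truncations of the geometric series of the factors
    1 / (1 + x w) gives polynomials whose maximum on the circle tends to at most 1 and
    whose value at the centre is that of [P]. *)
Lemma comparison_at_center (P : {poly R[i]}) (bet : seq R) :
  (forall x, x \in bet -> `|x| < 1) ->
  (forall w, modulus w = 1 ->
    modulus P.[w] <= modulus (\prod_(x <- bet) (1 + x%:C%C * w))) ->
  modulus P.[0] <= 1.
Proof.
move=> hb HP.
apply/ler_addgt0Pr => e e0.
have hx x : x \in map (fun x : R => `|x|) bet -> 0 <= x < 1.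
  by move=> /mapP[y yb ->]; rewrite normr_ge0 hb.
have [N0 HN] := prod_pow_small e0 hx.
have {HN} := HN N0.+1 (leqnSn _); set N := N0.+1; rewrite big_map => HN.
(* E is the truncated inverse of prod (1 + x w). *)
pose E : {poly R[i]} := \prod_(x <- bet) \sum_(k < N) ((- x%:C%C) *: 'X) ^+ k.
have Eh w : E.[w] = \prod_(x <- bet) \sum_(k < N) (- x%:C%C * w) ^+ k.
  rewrite horner_prod; apply: eq_bigr => x _; rewrite horner_sum.
  by apply: eq_bigr => k _; rewrite horner_exp hornerZ hornerX.
have E0 : E.[0] = 1.
  rewrite Eh big1// => x _; rewrite /N big_ord_recl expr0 big1 ?addr0// => k _.
  by rewrite mulr0 expr0n.
have -> : P.[0] = (P * E).[0] by rewrite hornerM E0 mulr1.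
apply: (@center_le_circle R _ 1) => // w w1.
rewrite hornerM modulusM (le_trans (ler_wpM2r (modulus_ge0 _) (HP w w1)))//.
rewrite -modulusM Eh -big_split/= modulus_prod (le_trans _ HN)//.
apply: ler_prod => x _; rewrite modulus_ge0/=.
have -> : (1 + x%:C%C * w) * (\sum_(k < N) (- x%:C%C * w) ^+ k) = 1 - (- x%:C%C * w) ^+ N.
  have := subrXX 1 (- x%:C%C * w) N; rewrite expr1n => ->; congr (_ * _).
    by rewrite mulNr opprK.
  by apply: eq_bigr => i _; rewrite expr1n mul1r.
rewrite (le_trans (modulusD _ _))// modulus1 modulusN modulusX modulusM modulusN modulus_real.
by rewrite w1 mulr1.
Qed.

Lemma prod_mul_const (A : Type) (xs : seq A) (F : A -> R) c :
  \prod_(x <- xs) (F x * c) = \prod_(x <- xs) F x * c ^+ size xs.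
Proof.
elim: xs => [|x xs IH]; first by rewrite !big_nil mulr1.
by rewrite !big_cons IH /= exprS; ring.
Qed.

(** On the unit circle conj w = 1 / w, so that conjugation changes the sign of the
    quotient. *)
Lemma cayley_circle w : modulus w = 1 -> 1 + w != 0 ->
  exists t : R, (1 - w) / (1 + w) = 'i%C * t%:C%C.
Proof.
case: w => x y w1 w0; exists (- y / (1 + x)).
have xy : x ^+ 2 + y ^+ 2 = 1.
  by have := sqr_sqrtr (addr_ge0 (sqr_ge0 x) (sqr_ge0 y)); rewrite -[Num.sqrt _]/(modulus (Complex x y)) w1 expr1n.
have x0 : 1 + x != 0.
  apply: contraNneq w0 => x1.
  have xE : x = -1 by apply/eqP; rewrite -subr_eq0 opprK addrC x1.
  have y0 : y = 0.
    by apply/eqP; rewrite -sqrf_eq0; move: xy; rewrite xE sqrrN expr1n => /eqP; rewrite addrC -subr_eq0 addrK.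
  by rewrite xE y0 -[_ + _]/(Complex (1 + -1) (0 + 0)) subrr addr0.
apply: (mulIf w0); rewrite mulfVK//.
have -> : (1 : R[i]) - Complex x y = Complex (1 - x) (- y).
  by rewrite -[LHS]/(Complex (1 - x) (0 - y)) sub0r.
have -> : (1 : R[i]) + Complex x y = Complex (1 + x) y.
  by rewrite -[LHS]/(Complex (1 + x) (0 + y)) add0r.
have tE : - y / (1 + x) * (1 + x) = - y by rewrite mulfVK.
move: (- y / (1 + x)) tE => t tE.
have -> : 'i%C * t%:C%C * Complex (1 + x) y = Complex (- (t * y)) (t * (1 + x)).
  have -> : 'i%C * t%:C%C = Complex 0 t by simpc.
  by rewrite -[LHS]/(Complex (0 * _ - t * y) (0 * y + t * _)) !mul0r sub0r add0r.
rewrite tE; congr Complex; apply: (mulIf x0).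
have -> : - (t * y) * (1 + x) = - (t * (1 + x)) * y by ring.
rewrite tE opprK (_ : y * y = 1 - x ^+ 2); first by ring.
by rewrite -xy; ring.
Qed.

(** A maximum principle in the plane slit along the half-line [rho, oo).  With
    z = rho - zeta ^ 2 the slit plane becomes the half-plane Re zeta > 0 and its boundary
    the points z = rho + t with t = - zeta ^ 2.  The zeros -a of the majorant
    prod (1 + zeta / a) lie in the opposite half-plane, and |1 + zeta / a| ^ 2 is
    1 + t / a ^ 2 on the boundary.  The comparison is made at zeta = kap, where z is
    - rho, after sending the half-plane to the unit disc by
    zeta = kap (1 - w) / (1 + w). *)
Theorem slit_comparison C rho kap (bs ds : seq R) : 0 <= C -> 0 < kap -> kap ^+ 2 = 2 * rho ->
  (2 * size bs < size ds)%N ->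
  (forall a, a \in ds -> 0 < a) ->
  (forall t, 0 <= t ->
     (C * \prod_(b <- bs) `|rho + t - b|) ^+ 2 <= \prod_(a <- ds) (1 + t / a ^+ 2)) ->
  (forall b, b \in bs -> 0 <= b) ->
  C * \prod_(b <- bs) (rho + b) <= \prod_(a <- ds) (1 + kap / a).
Proof.
move=> C0 k0 kE szs dpos H bpos.
have rho0 : 0 < rho by nra.
(* The factor (1 + w) ^ e makes the degrees equal; as e > 0, the numerator vanishes at
   w = -1, the point sent to infinity. *)
pose e := (size ds - 2 * size bs)%N.
have eP : (0 < e)%N by rewrite subn_gt0.
pose k (a : R) := kap / a.
have kp a : a \in ds -> 0 < k a by move=> ha; rewrite divr_gt0// dpos.
pose K := \prod_(a <- ds) (1 + k a).
have K0 : 0 < K.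
  by rewrite /K big_seq; apply: prodr_gt0 => a ha; rewrite addr_gt0// kp.
pose be (a : R) := (1 - k a) / (1 + k a).
pose P : {poly R[i]} := (C / K)%:C%C *: (\prod_(b <- bs)
   ((rho - b)%:C%C *: (1 + 'X) ^+ 2 - (2 * rho)%:C%C *: (1 - 'X) ^+ 2) * (1 + 'X) ^+ e).
have PE w : P.[w] = (C / K)%:C%C * (\prod_(b <- bs)
   ((rho - b)%:C%C * (1 + w) ^+ 2 - (2 * rho)%:C%C * (1 - w) ^+ 2) * (1 + w) ^+ e).
  rewrite /P hornerZ hornerM horner_prod horner_exp hornerD hornerX hornerC; congr (_ * (_ * _)).
  by apply: eq_bigr => b _; rewrite !hornerE.
have P0 : modulus P.[0] = C * \prod_(b <- bs) (rho + b) / K.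
  rewrite PE addr0 subr0 !expr1n mulr1 modulusM modulus_real ger0_norm ?divr_ge0 ?(ltW K0)//.
  rewrite modulus_prod mulrAC; congr (_ * _ / _); apply: eq_big_seq => b hb.
  rewrite !mulr1 -rmorphB modulus_real -normrN ger0_norm; first by ring.
  by have := bpos b hb; lra.
suff : modulus P.[0] <= 1 by rewrite P0 ler_pdivrMr// mul1r.
apply: (@comparison_at_center _ (map be ds)).
  move=> _ /mapP[a ha ->]; have := kp a ha; rewrite /be => h.
  rewrite normrM normfV (ger0_norm (_ : 0 <= 1 + k a)); last by lra.
  rewrite ltr_pdivrMr; last by lra.
  rewrite mul1r ltr_norml; apply/andP; split; lra.
move=> w w1; rewrite big_map.
have [w10|w10] := eqVneq (1 + w) 0.
  by rewrite PE w10 (_ : 0 ^+ e = 0) ?expr0n ?gtn_eqF// !mulr0 modulus0 modulus_ge0.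
have [th thE] := cayley_circle w1 w10.
have wE : 1 - w = 'i%C * th%:C%C * (1 + w) by rewrite -thE mulfVK.
have i2 : ('i%C : R[i]) ^+ 2 = -1 by exact: sqr_i.
pose t := 2 * rho * th ^+ 2.
have t0 : 0 <= t by apply: mulr_ge0; [lra|exact: sqr_ge0].
have PM : modulus P.[w] = C / K * (\prod_(b <- bs) `|rho + t - b|) * modulus (1 + w) ^+ size ds.
  rewrite PE modulusM modulus_real ger0_norm ?divr_ge0 ?(ltW K0)// -[RHS]mulrA.
  congr (_ * _).
  rewrite modulusM modulus_prod modulusX.
  have szE : size ds = (2 * size bs + e)%N by rewrite /e subnKC// ltnW.
  rewrite szE exprD exprM [RHS]mulrA -prod_mul_const; congr (_ * _); apply: eq_bigr => b _.
  have -> : (rho - b)%:C%C * (1 + w) ^+ 2 - (2 * rho)%:C%C * (1 - w) ^+ 2 =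
      (rho + t - b)%:C%C * (1 + w) ^+ 2.
    by rewrite wE !exprMn i2 /t rmorphB !rmorphD !rmorphM/=; ring.
  by rewrite modulusM modulus_real modulusX.
have QM : modulus (\prod_(a <- ds) (1 + (be a)%:C%C * w)) ^+ 2 =
    (K ^-1 * modulus (1 + w) ^+ size ds) ^+ 2 * \prod_(a <- ds) (1 + t / a ^+ 2).
  rewrite modulus_prod -!prodrXl /K exprMn exprVn -exprM mulnC exprM.
  rewrite -prodrXl -mulrA [X in _ = _ * X]mulrC -prod_mul_const.
  rewrite -[(\prod_(a <- ds) _)^-1]prodfV -big_split/=; apply: eq_big_seq => a ha.
  have ka := kp a ha; have ka1 : 1 + k a != 0 by rewrite gt_eqF//; lra.
  have ka1c : (1 + k a)%:C%C != 0 :> R[i] by rewrite eq_complex /= negb_and ka1.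
  have E : 1 + (be a)%:C%C * w = ((1 + k a)%:C%C)^-1 * ((1 + w) * (1 + 'i%C * (k a * th)%:C%C)).
    have be1 : (1 + k a)%:C%C * (be a)%:C%C = (1 - k a)%:C%C :> R[i].
      by rewrite -rmorphM/= /be mulrCA divff// mulr1.
    apply: (mulfI ka1c); rewrite mulrA divff// mul1r mulrDr mulr1 mulrA be1.
    have -> : (1 + w) * (1 + 'i%C * (k a * th)%:C%C) = (1 + w) + (k a)%:C%C * (1 - w).
      by rewrite wE rmorphM/=; ring.
    by rewrite rmorphB rmorphD rmorph1; ring.
  rewrite E !modulusM modulusV modulus_real (ger0_norm (_ : 0 <= 1 + k a)); last by lra.
  rewrite !exprMn exprVn; congr (_ * _); rewrite mulrC; congr (_ * _).
  have -> : 1 + 'i%C * (k a * th)%:C%C = Complex 1 (k a * th) :> R[i].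
    by simpc.
  rewrite /= sqr_sqrtr ?addr_ge0 ?sqr_ge0// expr1n /k /t -kE; congr (_ + _).
  by rewrite exprMn expr_div_n; ring.
rewrite -(@ler_pXn2r _ 2) ?nnegrE ?modulus_ge0// QM PM.
have -> : C / K * (\prod_(b <- bs) `|rho + t - b|) * modulus (1 + w) ^+ size ds =
   (K^-1 * modulus (1 + w) ^+ size ds) * (C * \prod_(b <- bs) `|rho + t - b|) by ring.
by rewrite [leLHS]exprMn ler_wpM2l ?sqr_ge0// H.
Qed.

End SlitLemma.

Section SlitGrowth.
Variable R : realType.
Implicit Types (r s t u d x S A B T rho a b C sigma : R) (bs : seq R).

Lemma prod_ge0_seq (xs : seq R) (F : R -> R) : (forall x, x \in xs -> 0 <= F x) ->
  0 <= \prod_(x <- xs) F x.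
Proof. by move=> H; rewrite big_seq; apply: prodr_ge0 => x; exact: H. Qed.

Lemma prod_ge1_seq (xs : seq R) (F : R -> R) : (forall x, x \in xs -> 1 <= F x) ->
  1 <= \prod_(x <- xs) F x.
Proof.
elim: xs => [|x xs IH] H; first by rewrite big_nil.
rewrite big_cons mulr_ege1//; first by rewrite H ?mem_head.
by apply: IH => y hy; rewrite H// inE hy orbT.
Qed.

Lemma le_prod_seq (xs : seq R) (F G : R -> R) :
  (forall x, x \in xs -> 0 <= F x <= G x) ->
  \prod_(x <- xs) F x <= \prod_(x <- xs) G x.
Proof. by move=> H; rewrite big_seq [leRHS]big_seq; apply: ler_prod => x; exact: H. Qed.

Lemma prod_max_scale bs t u : 1 <= t -> 0 <= u -> (forall b, b \in bs -> 0 <= b) ->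
  \prod_(b <- bs) Num.max (t * u) b <= t ^+ size bs * \prod_(b <- bs) Num.max u b.
Proof.
move=> t1 u0 hb; rewrite [leRHS]mulrC -(prod_mul_const bs (fun b => Num.max u b) t); apply: le_prod_seq => b /hb b0.
have tu0 : 0 <= t * u by rewrite mulr_ge0//; lra.
rewrite le_max tu0/= ge_max (mulrC _ t); apply/andP; split.
  by rewrite ler_wpM2l ?le_max ?lexx//; lra.
apply: (@le_trans _ _ (1 * Num.max u b)); first by rewrite mul1r le_max lexx orbT.
by rewrite ler_wpM2r// le_max u0.
Qed.

Lemma prod_dist_le_max bs s : 0 <= s -> (forall b, b \in bs -> 0 <= b) ->
  \prod_(b <- bs) `|s - b| <= \prod_(b <- bs) Num.max s b.
Proof.
move=> s0 hb; apply: le_prod_seq => b /hb b0; rewrite normr_ge0/=.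
by rewrite ler_norml lerNl opprB !lerBlDr !ler_wpDr// !le_max lexx ?orbT.
Qed.

Lemma prod_max_mono bs s t : 0 <= s -> s <= t ->
  \prod_(b <- bs) Num.max s b <= \prod_(b <- bs) Num.max t b.
Proof.
move=> s0 st; apply: le_prod_seq => b _.
by rewrite le_max s0/= ge_max !le_max st lexx orbT.
Qed.

(** The last alternative serves the scales above the largest one. *)
Lemma dyadic_scale d t L : 0 < d -> d <= t ->
  exists2 i, (i <= L)%N & d * 4 ^+ i <= t /\ (t <= d * 4 ^+ i.+1 \/ i = L).
Proof.
move=> d0 dt; elim: L => [|L [i iL [h1 h2]]].
  by exists 0%N => //; rewrite expr0 mulr1; split=> //; right.
case: h2 => [h2|iE].
  by exists i; [exact: leqW | split=> //; left].
have [h|h] := lerP t (d * 4 ^+ L.+1).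
  by exists L => //; split; [rewrite -iE|left].
by exists L.+1 => //; split; [exact: ltW|right].
Qed.

Lemma expR_half_le2 : expR (1 / 2) <= (2 : R).
Proof.
have := expR_ge1Dx (- (1 / 2) : R); rewrite expRN => h.
rewrite -[leRHS]invrK -[leLHS]invrK lef_pV2 ?posrE ?invr_gt0 ?expR_gt0//.
by apply: le_trans h; lra.
Qed.

Lemma pow2_ge_expR x n : 4 * x <= n%:R -> 4 * expR (2 * x) <= 2 ^+ (n + 2).
Proof.
move=> h; rewrite addnC exprD.
apply: ler_pM; [by []|exact: expR_ge0|by rewrite -natrX ler_nat|].
apply: (@le_trans _ _ (expR (n%:R * (1 / 2)))); first by rewrite ler_expR; lra.
by rewrite expRM_natl; apply: lerXn2r; rewrite ?nnegrE ?expR_ge0// expR_half_le2.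
Qed.

Lemma powR4_lt2 sigma : sigma < 1 / 2 -> 4 `^ sigma / 2 < 1.
Proof.
move=> sig2; rewrite ltr_pdivrMr// mul1r.
have -> : (2 : R) = 4 `^ (1 / 2).
  by rewrite mul1r powR12_sqrt// (_ : 4 = 2 ^+ 2) ?sqrtr_sqr ?ger0_norm// -natrX.
rewrite /powR pnatr_eq0/= ltr_expR ltr_pM2r// ln_gt0//.
by rewrite ltr1n.
Qed.

Section Weights.
Variables (C rho S sigma : R) (bs : seq R).
Hypotheses (C0 : 0 <= C) (rho0 : 0 < rho) (rhoS : 2 * rho <= S) (S1 : 1 <= S).
Hypotheses (sig0 : 0 < sigma) (sig2 : sigma < 1 / 2).
Hypothesis bs0 : forall b, b \in bs -> 0 <= b.

Let D := size bs.
Let d := S - rho.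
Let d0 : 0 < d. Proof. by rewrite subr_gt0; move: rho0 rhoS => h1 h2; lra. Qed.
(* Up to the point 4 S 4 ^ i the growth hypothesis allows 2 exp (X i).  As soon as t is
   at least a i ^ 2 = (S - rho) 4 ^ i, each of the n i factors 1 + t / a i ^ 2 is at
   least 2, and 2 ^ n i >= 4 exp (2 X i).  The final 2 D + 1 factors of ds L serve the
   scales beyond the last one. *)
Let X i := (8 * S * 4 ^+ i) `^ sigma.
Let n i := ((Num.truncn (4 * X i)).+1 + 2)%N.
Let a i := Num.sqrt d * 2 ^+ i.
Let kap := Num.sqrt (2 * rho).

Let X0 i : 0 <= X i. Proof. exact: powR_ge0. Qed.

Let a2 i : a i ^+ 2 = d * 4 ^+ i.
Proof.
rewrite /a exprMn sqr_sqrtr ?(ltW d0)//; congr (_ * _).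
by rewrite -exprM mulnC exprM (_ : 2 ^+ 2 = 4)// -natrX.
Qed.

Let a0 i : 0 < a i.
Proof. by rewrite /a mulr_gt0 ?sqrtr_gt0 ?exprn_gt0. Qed.

Let ds L := flatten [seq nseq (n i) (a i) | i <- iota 0 L.+1] ++ nseq (2 * D).+1 (a L).

Let prod_ds L (F : R -> R) : \prod_(x <- ds L) F x =
  (\prod_(0 <= i < L.+1) F (a i) ^+ n i) * F (a L) ^+ (2 * D).+1.
Proof.
rewrite /ds big_cat big_flatten big_map big_nseq iter_mulr_1; congr (_ * _).
by apply: eq_bigr => i _; rewrite big_nseq iter_mulr_1.
Qed.

Let n_ge i : 4 * expR (2 * X i) <= 2 ^+ n i.
Proof. by apply: pow2_ge_expR; apply/ltW/truncnS_gt. Qed.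

Let n_le i : (n i)%:R <= 7 * X i.
Proof.
have X1 : 1 <= X i.
  apply: (@le_trans _ _ (1 `^ sigma)); first by rewrite powR1.
  have p4 : 1 <= (4 : R) ^+ i by rewrite exprn_ege1//; lra.
  have q4 : 1 <= 8 * S * 4 ^+ i by move: S1 => h; nra.
  by apply: ge0_ler_powR; rewrite ?nnegrE ?(ltW sig0)//; lra.
rewrite /n natrD -natr1; have : (Num.truncn (4 * X i))%:R <= 4 * X i.
  by rewrite truncn_le// mulr_ge0.
lra.
Qed.

Hypothesis growth : forall s, S <= s ->
  C * \prod_(b <- bs) Num.max s b <= 2 * expR ((2 * s) `^ sigma).

(** On the slit the product over [ds L] exceeds 1 everywhere and, at the scale 4 ^ i,
    exceeds what the growth hypothesis allows.  At the last scale the extra 2 D + 1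
    factors take over: [D] is the degree, and the product of the [Num.max s b] grows at
    most like s ^ D. *)
Lemma slit_majorant L A t : 1 <= A ->
  (forall s, rho <= s -> s <= S -> C * \prod_(b <- bs) `|s - b| <= A) -> 0 <= t ->
  (C / A * \prod_(b <- bs) `|rho + t - b|) ^+ 2 <= \prod_(x <- ds L) (1 + t / x ^+ 2).
Proof.
move=> A1 HA t0.
have rho0' := rho0; have rhoS' := rhoS; have S1' := S1; have d0' := d0.
have sig0' := sig0; have sig2' := sig2.
have dsp x : x \in ds L -> 0 < x.
  rewrite mem_cat => /orP[/flatten_mapP[i _]|]; rewrite mem_nseq => /andP[_ /eqP->]; exact: a0.
have ge1 x : 0 < x -> 1 <= 1 + t / x ^+ 2.
  by move=> x0; rewrite lerDl divr_ge0// exprn_ge0// ltW.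
have Ap : 0 < A by lra.
have P0 : 0 <= C * \prod_(b <- bs) `|rho + t - b|.
  by rewrite mulr_ge0//; apply: prod_ge0_seq => b _; exact: normr_ge0.
rewrite mulrAC.
have [td|dt] := lerP t d.
  apply: (@le_trans _ _ 1); last by apply: prod_ge1_seq => x /dsp; exact: ge1.
  rewrite expr_le1 ?divr_ge0 ?(ltW Ap)// ler_pdivrMr// mul1r HA ?lerDl//.
  by move: td; rewrite /d; lra.
have [i iL [h1 h2]] := dyadic_scale L d0 (ltW dt).
pose tau := t / (d * 4 ^+ i).
have p4 : 1 <= (4 : R) ^+ i by rewrite exprn_ege1//; lra.
have d4 : 0 < d * 4 ^+ i by rewrite mulr_gt0//; lra.
have tau1 : 1 <= tau by rewrite ler_pdivlMr// mul1r.
have tE : t = tau * (d * 4 ^+ i) by rewrite /tau mulfVK ?gt_eqF.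
pose u := S * 4 ^+ i.
have Su : S <= u by rewrite /u ler_peMr//; lra.
have su : rho + t <= tau * u.
  rewrite tE /u /d; have : rho <= tau * (rho * 4 ^+ i).
    by rewrite mulrCA ler_peMr ?(ltW rho0)// mulr_ege1.
  nra.
have le1 : C * \prod_(b <- bs) `|rho + t - b| <= C * \prod_(b <- bs) Num.max (tau * u) b.
  rewrite ler_wpM2l// (le_trans (prod_dist_le_max _ bs0))//; first by lra.
  by apply: prod_max_mono => //; lra.
have XE : X i = (8 * u) `^ sigma by rewrite /X /u mulrA.
have le2 : C * \prod_(b <- bs) Num.max (tau * u) b <=
    tau ^+ (if i == L then D else 0%N) * (2 * expR (X i)).
  have mono y z : 0 <= y -> y <= z -> y `^ sigma <= z `^ sigma.
    by move=> y0 yz; apply: ge0_ler_powR; rewrite ?nnegrE//; lra.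
  case: eqP => iE.
    rewrite (le_trans (ler_wpM2l C0 (prod_max_scale tau1 _ bs0)))//; first by lra.
    rewrite mulrCA ler_wpM2l ?exprn_ge0//; first by lra.
    rewrite (le_trans (growth Su))// ler_wpM2l// ler_expR XE.
    by apply: mono; lra.
  rewrite expr0 mul1r; case: h2 => // h2.
  have tau4 : tau <= 4 by rewrite ler_pdivrMr// mulrCA -exprS.
  apply: (@le_trans _ _ (C * \prod_(b <- bs) Num.max (4 * u) b)).
    by rewrite ler_wpM2l// prod_max_mono//; nra.
  rewrite (le_trans (growth _))//; first by nra.
  rewrite ler_wpM2l// ler_expR XE; apply: mono; lra.
have le3 : (C * \prod_(b <- bs) `|rho + t - b|) / A <=
    tau ^+ (if i == L then D else 0%N) * (2 * expR (X i)).
  rewrite ler_pdivrMr// (le_trans (le_trans le1 le2))// ler_peMr//.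
  by rewrite !mulr_ge0 ?expR_ge0 ?exprn_ge0//; lra.
apply: (@le_trans _ _ ((tau ^+ (if i == L then D else 0%N) * (2 * expR (X i))) ^+ 2)).
  by apply: lerXn2r; rewrite ?nnegrE ?divr_ge0 ?(ltW Ap)// (le_trans _ le3)// divr_ge0// ltW.
set k := if i == L then D else 0%N.
have -> : (tau ^+ k * (2 * expR (X i))) ^+ 2 = (4 * expR (2 * X i)) * tau ^+ (2 * k).
  rewrite (_ : 2 * X i = X i + X i); last by ring.
  by rewrite expRD (mulnC 2 k) exprM; ring.
have lam1 : 1 <= 1 + tau by lra.
have aE : 1 + t / a i ^+ 2 = 1 + tau by rewrite a2.
rewrite prod_ds.
apply: (@le_trans _ _ ((1 + tau) ^+ n i * (1 + t / a L ^+ 2) ^+ (2 * D).+1)); last first.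
  rewrite ler_wpM2r ?exprn_ge0//; first by rewrite (le_trans ler01)// ge1.
  rewrite (big_rem i) ?mem_index_iota//=  aE ler_peMr ?exprn_ge0//; first by lra.
  elim/big_ind: _ => //; first by move=> x y; exact: mulr_ege1.
  by move=> j _; rewrite exprn_ege1// ge1.
have tau0 : 0 <= tau by lra.
have e0 : 0 <= 4 * expR (2 * X i) by rewrite mulr_ge0// expR_ge0.
have le22 : (2 : R) <= 1 + tau by lra.
have le02 : (0 : R) <= 1 + tau by lra.
have tt : tau <= 1 + tau by lra.
apply: ler_pM; [exact: e0|exact: exprn_ge0| |].
  by apply: le_trans (n_ge i) _; apply: lerXn2r; rewrite ?nnegrE.
rewrite /k; case: eqP => iE.
  rewrite -iE aE; apply: (@le_trans _ _ ((1 + tau) ^+ (2 * D))).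
    by apply: lerXn2r; rewrite ?nnegrE.
  exact: ler_weXn2l.
rewrite muln0 expr0; apply: exprn_ege1; exact: ge1.
Qed.

Let theta := 4 `^ sigma / 2.

Let theta_lt1 : theta < 1 := powR4_lt2 sig2.

Let X_theta i : X i / 2 ^+ i = (8 * S) `^ sigma * theta ^+ i.
Proof.
have S0 : 0 <= 8 * S by move: S1 => h; lra.
rewrite /X powRM ?exprn_ge0// /theta expr_div_n mulrA; congr (_ * _ / _).
by rewrite -powR_mulrn// powRAC powR_mulrn// powR_ge0.
Qed.

Let kap_d : kap / Num.sqrt d <= 2 * Num.sqrt (rho / S).
Proof.
have rho0' := rho0; have rhoS' := rhoS; have d0' := d0.
have S0 : 0 < S by lra.
rewrite ler_pdivrMr ?sqrtr_gt0// -mulrA -sqrtrM ?divr_ge0 ?(ltW rho0) ?(ltW S0)//.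
have -> : (2 : R) = Num.sqrt 4 by rewrite (_ : 4 = 2 ^+ 2) ?sqrtr_sqr ?ger0_norm// -natrX.
rewrite -sqrtrM// ler_wsqrtr// (_ : 4 * _ = (4 * rho * d) / S); last by ring.
rewrite ler_pdivlMr//.
have dS : S <= 2 * d by rewrite /d; lra.
nra.
Qed.

(** The majorant at - rho is at most the exponential of a sum of terms of order
    X i / a i, which form a geometric series of ratio 4 ^ sigma / 2 < 1. *)
Lemma slit_growth A : 1 <= A ->
  (forall s, rho <= s -> s <= S -> C * \prod_(b <- bs) `|s - b| <= A) ->
  C * \prod_(b <- bs) (rho + b) <=
    A * expR (1 + 14 * (8 * S) `^ sigma * Num.sqrt (rho / S) / (1 - theta)).
Proof.
move=> A1 HA.
have Ap : 0 < A by rewrite (lt_le_trans ltr01).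
have sd0 : 0 < Num.sqrt d by rewrite sqrtr_gt0.
have k0 : 0 < kap by rewrite sqrtr_gt0 mulr_gt0.
have k2 : kap ^+ 2 = 2 * rho by rewrite sqr_sqrtr// mulr_ge0// ltW.
(* The last scale is so large that the extra factors contribute at most e. *)
have [L HL] : exists L, (2 * D).+1%:R * (kap / a L) <= 1.
  pose y := (2 * D).+1%:R * kap / Num.sqrt d.
  have [L hL] : exists L, y < L%:R by exists (Num.truncn y).+1; exact: truncnS_gt.
  exists L; rewrite mulrA ler_pdivrMr// mul1r /a (mulrC (Num.sqrt d)) -ler_pdivrMr// -/y.
  rewrite ltW// (lt_le_trans hL)// -natrX ler_nat ltnW//.
  by rewrite ltn_expl.
have cmp : C / A * \prod_(b <- bs) (rho + b) <= \prod_(x <- ds L) (1 + kap / x).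
  apply: slit_comparison => //; first by rewrite divr_ge0// ltW.
  - by rewrite /ds size_cat size_nseq; exact: leq_addl.
  - move=> x; rewrite mem_cat => /orP[/flatten_mapP[i _]|];
    rewrite mem_nseq => /andP[_ /eqP->]; exact: a0.
  - by move=> t; exact: slit_majorant.
have -> : C * \prod_(b <- bs) (rho + b) = A * (C / A * \prod_(b <- bs) (rho + b)).
  by rewrite mulrAC [X in _ = A * X]mulrC mulrA divff ?mul1r ?gt_eqF.
rewrite ler_wpM2l ?(ltW Ap)// (le_trans cmp)// prod_ds.
have ee i : 0 <= kap / a i by rewrite divr_ge0 ?(ltW k0) ?(ltW (a0 i)).
have e1 i : 0 <= 1 + kap / a i by rewrite addr_ge0.
have ex i k : (1 + kap / a i) ^+ k <= expR (k%:R * (kap / a i)).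
  rewrite expRM_natl; apply: lerXn2r; rewrite ?nnegrE ?e1 ?expR_ge0//.
  exact: expR_ge1Dx.
rewrite [1 + _ in leRHS]addrC expRD; apply: ler_pM; rewrite ?exprn_ge0//.
  by apply: prodr_ge0 => i _; rewrite exprn_ge0.
  apply: (@le_trans _ _ (\prod_(0 <= i < L.+1) expR ((n i)%:R * (kap / a i)))).
    by apply: ler_prod => i _; rewrite ex exprn_ge0.
  rewrite -expR_sum ler_expR big_mkord.
  pose q := 14 * (8 * S) `^ sigma * Num.sqrt (rho / S).
  have q0 : 0 <= q by rewrite !mulr_ge0 ?powR_ge0 ?sqrtr_ge0.
  apply: (@le_trans _ _ (\sum_(i < L.+1) q * theta ^+ i)); last first.
    rewrite -mulr_sumr ler_wpM2l// geometric_le// /theta.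
    by rewrite divr_ge0 ?powR_ge0.
  apply: ler_sum => i _.
  apply: (@le_trans _ _ (7 * X i * (kap / a i))); first by rewrite ler_wpM2r.
  have -> : 7 * X i * (kap / a i) = 7 * ((kap / Num.sqrt d) * (X i / 2 ^+ i)).
    by rewrite /a invfM; ring.
  rewrite X_theta (_ : q * _ = 7 * (2 * Num.sqrt (rho / S) * ((8 * S) `^ sigma * theta ^+ i))); last first.
    by rewrite /q; ring.
  rewrite ler_wpM2l// ler_wpM2r// mulr_ge0 ?powR_ge0// exprn_ge0// /theta.
  by rewrite divr_ge0 ?powR_ge0.
by rewrite (le_trans (ex _ _))// ler_expR.
Qed.

End Weights.
End SlitGrowth.

(** * The minimum modulus of functions of order less than 1/2 *)

Section OrderLessThanHalf.
Variable R : realType.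
Implicit Types (r s t u d x S A B T rho a b C sigma m : R) (f : R[i]^o -> R[i]^o).
Implicit Types (z w c : R[i]) (zs : seq R[i]).

Lemma modulus_conj z : modulus (z^*)%C = modulus z.
Proof. by case: z => x y /=; rewrite sqrrN. Qed.

Lemma mulc_conj z : z * (z^*)%C = ((modulus z) ^+ 2)%:C%C.
Proof.
case: z => x y; rewrite -[LHS]/(Complex (x * x - y * - y) (x * - y + y * x)) /=.
rewrite sqr_sqrtr ?addr_ge0 ?sqr_ge0//; congr Complex; ring.
Qed.

(** Reflecting the zeros inside the circle does not change the modulus on it, and the
    value at the centre of the reflected polynomial is the left-hand side. *)
Lemma prod_max_le_circle c zs s B : 0 < s ->
  (forall w, modulus w = s -> modulus (c * \prod_(z <- zs) (w - z)) <= B) ->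
  modulus c * \prod_(z <- zs) Num.max s (modulus z) <= B.
Proof.
move=> s0 HB.
(* The reflected factor has modulus |w - z| on the circle |w| = s. *)
pose F z : {poly R[i]} := if modulus z < s then s%:C%C%:P - ((z^*)%C / s%:C%C) *: 'X
  else 'X - z%:P.
pose Q : {poly R[i]} := c *: \prod_(z <- zs) F z.
have sC : s%:C%C != 0 :> R[i] by rewrite eq_complex /= negb_and gt_eqF.
have Q0 : modulus Q.[0] = modulus c * \prod_(z <- zs) Num.max s (modulus z).
  rewrite hornerZ modulusM horner_prod modulus_prod; congr (_ * _).
  apply: eq_bigr => z _; rewrite /F; case: ltP => zs'.
    by rewrite hornerD hornerN hornerZ hornerX hornerC mulr0 subr0 modulus_real gtr0_norm// .
  by rewrite hornerXsubC sub0r modulusN.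
rewrite -Q0; apply: (@center_le_circle R Q s) => // w ws.
rewrite (le_trans _ (HB w ws))// hornerZ !modulusM horner_prod !modulus_prod.
rewrite le_eqVlt; apply/orP; left; apply/eqP; congr (_ * _).
apply: eq_bigr => z _; rewrite /F; case: ltP => zs'; last by rewrite hornerXsubC.
rewrite hornerD hornerN hornerZ hornerX hornerC.
have -> : s%:C%C - (z^*)%C / s%:C%C * w = w / s%:C%C * ((w - z)^*)%C.
  have ww : w * (w^*)%C = s%:C%C ^+ 2 by rewrite mulc_conj ws rmorphXn.
  have -> : ((w - z)^*)%C = (w^*)%C - (z^*)%C by rewrite rmorphB.
  rewrite mulrBr (_ : w / s%:C%C * (w^*)%C = w * (w^*)%C / s%:C%C); last by ring.
  by rewrite ww expr2 mulfK//; ring.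
rewrite modulusM modulus_conj modulusM modulusV ws modulus_real gtr0_norm//.
by rewrite divff ?gt_eqF// mul1r.
Qed.

Lemma poly_factor (P : {poly R[i]}) : exists zs, forall w,
  P.[w] = lead_coef P * \prod_(z <- zs) (w - z).
Proof.
have [zs ->] := closed_field_poly_normal P; exists zs => w.
rewrite hornerZ horner_prod lead_coefZ lead_coef_prod_XsubC mulr1; congr (_ * _).
by apply: eq_bigr => z _; rewrite hornerXsubC.
Qed.

Section MinimumModulus.
Variables (f : R[i]^o -> R[i]^o) (sigma m r1 : R).
Hypotheses (ef : entire f) (sig0 : 0 < sigma) (sig2 : sigma < 1 / 2).
Hypothesis order_le : forall r, r1 <= r -> max_modulus f r <= expR (r `^ sigma).
Hypothesis m_large : 1 <= m * (1 - 2 * sigma).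
Hypothesis m1 : 1 < m.

Let K := expR (1 + 14 * 8 `^ sigma / (1 - 4 `^ sigma / 2)).

(** The choice of [m] makes the loss in [slit_growth] bounded. *)
Lemma exponent_le rho : 1 <= rho ->
  (8 * rho `^ m) `^ sigma * Num.sqrt (rho / rho `^ m) <= 8 `^ sigma.
Proof.
move=> rho1; have rho0 : 0 < rho by lra.
have S0 : 0 < rho `^ m by rewrite powR_gt0.
rewrite powRM ?(ltW S0)// -mulrA ler_piMr ?powR_ge0//.
have y0 : 0 < (rho `^ m) `^ sigma by rewrite powR_gt0.
rewrite mulrC -ler_pdivlMr// mul1r -[leRHS]gtr0_norm ?invr_gt0// -sqrtr_sqr ler_wsqrtr//.
rewrite exprVn ler_pdivrMr// mulrC ler_pdivlMr ?exprn_gt0//.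
rewrite -powR_mulrn ?(ltW y0)// -!powRrM -{1}(powRr1 (ltW rho0)) -powRD; last first.
  by rewrite (gt_eqF rho0) implybT.
apply: ler_powR => //.
have mm := m_large; lra.
Qed.

Lemma taylor_poly_circle N s w : 0 < s -> modulus w = s ->
  modulus (taylor_poly f N).[w] <= 2 * max_modulus f (2 * s).
Proof.
move=> s0 ws; have s20 : 0 < 2 * s by rewrite mulr_gt0.
have M0 : 0 <= max_modulus f (2 * s).
  by rewrite (le_trans (modulus_ge0 (f w)))// disc_le_max_modulus// ws; lra.
rewrite taylor_polyE (le_trans (modulus_sum _ _ _))//.
apply: (@le_trans _ _ (\sum_(k < N) max_modulus f (2 * s) * (1 / 2) ^+ k)).
  apply: ler_sum => k _; rewrite modulusM modulusX ws.
  have -> : s ^+ k = (2 * s) ^+ k * (1 / 2) ^+ k.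
    by rewrite -exprMn (_ : 2 * s * (1 / 2) = s)//; field.
  rewrite mulrA ler_wpM2r ?exprn_ge0 ?divr_ge0//.
  apply: (taylor_coef_circle _ ef s20) => z zs.
  by rewrite -zs; exact: le_max_modulus.
rewrite -mulr_sumr mulrC ler_wpM2r//.
have := @geometric_le R (1 / 2) N; rewrite (_ : (1 - 1 / 2)^-1 = 2); last by field.
apply; lra.
Qed.

(** Moving the zeros of a Taylor polynomial to the positive axis decreases the minimum
    modulus and increases the maximum modulus on every circle.  If the statement failed,
    [slit_growth] would bound M(rho) by a fixed fraction of itself. *)
Lemma min_modulus_at rho : 1 <= rho -> r1 <= 2 * rho -> 2 * rho <= rho `^ m ->
  16 * K ^+ 2 <= max_modulus f rho ->
  exists2 s, rho <= s <= rho `^ m &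
    forall z, modulus z = s -> max_modulus f rho <= modulus (f z) ^+ 2.
Proof.
move=> rho1 r1rho rhoS KM; have rho0 : 0 < rho by lra.
have K1 : 1 <= K.
  rewrite /K -[leLHS]expR0 ler_expR addr_ge0// divr_ge0 ?mulr_ge0 ?powR_ge0//.
  by rewrite subr_ge0 ltW// powR4_lt2.
set S := rho `^ m in rhoS *; set M := max_modulus f rho in KM *.
have [N HN] := taylor_approx S ef ltr01.
have {HN} HN := HN N (leqnn _).
have [zs zsE] := poly_factor (taylor_poly f N).
pose c := lead_coef (taylor_poly f N).
pose bs := map (fun z => modulus z) zs.
have bs0 b : b \in bs -> 0 <= b by move=> /mapP[z _ ->]; exact: modulus_ge0.
have S1 : 1 <= S by lra.
have growth s : S <= s ->
    modulus c * \prod_(b <- bs) Num.max s b <= 2 * expR ((2 * s) `^ sigma).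
  move=> Ss; rewrite big_map; apply: prod_max_le_circle => [|w ws]; first by lra.
  rewrite -zsE (le_trans (taylor_poly_circle _ _ ws))//; first by lra.
  by rewrite ler_wpM2l// order_le//; lra.
(* The value A is such that K A + 1 < M: then |p| cannot be bounded by A on
   [rho, S]. *)
pose A := (M - 1) / (2 * K).
have K0 : 0 < K by lra.
have A1 : 1 <= A by rewrite ler_pdivlMr ?mulr_gt0// mul1r; nra.
have MP : M <= modulus c * \prod_(b <- bs) (rho + b) + 1.
  apply: max_modulus_le; first exact: ltW.
  move=> z zr; rewrite -[X in modulus X](subrK (taylor_poly f N).[z]).
  rewrite (le_trans (modulusD _ _))// addrC lerD//; last by apply: HN; rewrite zr; lra.
  rewrite zsE modulusM ler_wpM2l ?modulus_ge0// big_map modulus_prod.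
  apply: ler_prod => y _; rewrite modulus_ge0/= -zr (le_trans (modulusD _ _))//.
  by rewrite modulusN.
have [all|] := pselect (forall s, rho <= s -> s <= S ->
    modulus c * \prod_(b <- bs) `|s - b| <= A).
  have := slit_growth (modulus_ge0 c) rho0 rhoS S1 sig0 sig2 bs0 growth A1 all.
  have eK : expR (1 + 14 * (8 * S) `^ sigma * Num.sqrt (rho / S) / (1 - 4 `^ sigma / 2)) <= K.
    rewrite ler_expR lerD2l ler_wpM2r ?invr_ge0 ?subr_ge0 ?(ltW (powR4_lt2 sig2))//.
    by rewrite -mulrA ler_wpM2l// exponent_le.
  move=> /le_trans/(_ (ler_wpM2l (le_trans ler01 A1) eK)) H.
  have AK : A * K = (M - 1) / 2 by rewrite /A; field; rewrite gt_eqF.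
  exfalso; move: (le_trans MP (lerD H (lexx 1))); rewrite AK.
  have K21 : 1 <= K ^+ 2 by rewrite exprn_ege1.
  lra.
move=> /existsNP[s /not_implyP[rs /not_implyP[sS /negP]]]; rewrite -ltNge => As.
exists s; first by rewrite rs sS.
move=> z zr.
have fz : A - 1 <= modulus (f z).
  have h1 : modulus c * \prod_(b <- bs) `|s - b| <= modulus (taylor_poly f N).[z].
    rewrite zsE modulusM ler_wpM2l ?modulus_ge0// big_map modulus_prod.
    by apply: ler_prod => y _; rewrite normr_ge0/= -zr dist_modulus_le.
  have h2 : modulus ((taylor_poly f N).[z] - f z) <= 1.
    by rewrite modulusB; apply: HN; rewrite zr.
  rewrite lerBlDr (le_trans (ltW (lt_le_trans As h1)))// -lerBlDl.
  exact: le_trans (modulus_sub_le _ _) h2.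
have MK : M / (4 * K) <= A - 1.
  rewrite /A -subr_ge0.
  have -> : (M - 1) / (2 * K) - 1 - M / (4 * K) = (M - 2 - 4 * K) / (4 * K).
    by field; rewrite gt_eqF.
  rewrite divr_ge0 ?mulr_ge0 ?(ltW K0)//; nra.
apply: (@le_trans _ _ ((M / (4 * K)) ^+ 2)); last first.
  apply: lerXn2r; rewrite ?nnegrE ?modulus_ge0 ?(le_trans MK)//.
  by rewrite divr_ge0 ?mulr_ge0 ?(ltW K0)//; nra.
rewrite expr_div_n ler_pdivlMr ?exprn_gt0 ?mulr_gt0//.
have M0 : 0 <= M by nra.
by rewrite [leRHS]expr2 ler_wpM2l// exprMn (_ : 4 ^+ 2 = 16)// -natrX.
Qed.

Hypothesis unbounded : forall B, exists r0, forall r, r0 <= r -> B <= max_modulus f r.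

(** The bound 1/2 on the order is sharp: the function cos (sqrt z) has order 1/2 and is
    bounded on the positive half-line. *)
Theorem min_modulus : exists rho0, forall rho, rho0 <= rho ->
  exists2 s, rho <= s <= rho `^ m &
    forall z, modulus z = s -> max_modulus f rho <= modulus (f z) ^+ 2.
Proof.
have [r2 Hr2] := unbounded (16 * K ^+ 2).
exists (Num.max (Num.max 1 `|r1|) (Num.max r2 (2 `^ (m - 1)^-1))) => rho.
rewrite !ge_max => /andP[/andP[rho1 rhor1] /andP[rhor2 rho2]].
apply: min_modulus_at => //; last exact: Hr2.
  by rewrite (le_trans (ler_norm _))//; lra.
have m10 : 0 < m - 1 by rewrite subr_gt0.
have rho0 : 0 < rho by lra.
have -> : rho `^ m = rho `^ (m - 1) * rho.
  by rewrite -{3}(powRr1 (ltW rho0)) -powRD ?subrK// (gt_eqF rho0) implybT.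
rewrite ler_wpM2r ?(ltW rho0)//.
have -> : (2 : R) = (2 `^ (m - 1)^-1) `^ (m - 1).
  by rewrite -powRrM mulVf ?gt_eqF// powRr1.
by apply: ge0_ler_powR; rewrite ?nnegrE ?powR_ge0 ?(ltW m10) ?(ltW rho0).
Qed.

End MinimumModulus.
End OrderLessThanHalf.

(** * Harnack's inequality for zero-free functions *)

Section Roots.
Variable R : realType.
Implicit Types (f g h : R[i]^o -> R[i]^o) (w z u v : R[i]^o) (T B : R).
Local Notation Re := (@complex.Re R).

Lemma Re_sqrtc_ge0 w : 0 <= Re (sqrtc w).
Proof. by case: w => a b /=; exact: sqrtr_ge0. Qed.

Lemma Re_sqrtc_gt0 w : 0 < Re w -> 0 < Re (sqrtc w).
Proof.
case: w => a b /= a0; rewrite sqrtr_gt0 divr_gt0//.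
by rewrite (lt_le_trans a0)// lerDr sqrtr_ge0.
Qed.

Lemma Re_le_mod w : Re w <= modulus w.
Proof. exact: le_trans (ler_norm _) (Re_le_modulus w). Qed.

(** With a and b the roots of w + h and w, the difference of the difference quotient
    and 1 / (2 b) is - h / (2 b (a + b) ^ 2), and |a + b| is bounded from below because
    both roots have nonnegative real part. *)
Lemma derivable_sqrtc w : 0 < Re w -> derivable (@sqrtc R : R[i]^o -> R[i]^o) w 1.
Proof.
move=> w0; set b : R[i] := sqrtc w; pose c := Re b.
have c0 : 0 < c by exact: Re_sqrtc_gt0.
have b0 : b != 0 by rewrite -modulus_gt0 (lt_le_trans c0)// Re_le_mod.
have n2 : (2 : R[i]) != 0 by rewrite pnatr_eq0.
apply/derivable_modulusP; exists (2 * b)^-1 => e e0.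
(* The error is |h| ^ 2 / (2 |b| |a + b| ^ 2), at most |h| ^ 2 / (2 c ^ 3). *)
exists (2 * c ^+ 3 * e); first by rewrite !mulr_gt0// exprn_gt0.
move=> h hr; set a : R[i] := sqrtc (w + h).
have ab : c <= modulus (a + b).
  rewrite (le_trans _ (Re_le_mod _))//.
  have -> : Re (a + b) = Re a + Re b by case: (a) (b) => ? ? [].
  by rewrite lerDr Re_sqrtc_ge0.
have ab0 : a + b != 0 by rewrite -modulus_gt0 (lt_le_trans c0).
have hE : h = (a - b) * (a + b).
  by rewrite -subr_sqr !sqr_sqrtc addrC addKr.
have E : a - b - (2 * b)^-1 * h = - (h ^+ 2 * (2 * b * (a + b) ^+ 2)^-1).
  by rewrite hE; field; rewrite b0 ab0.
rewrite E modulusN modulusM modulusX modulusV (modulusM (2 * b)) (modulusM 2) modulusX.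
have -> : modulus (2 : R[i]) = 2.
  by rewrite -(rmorph_nat (real_complex R) 2) modulus_real ger0_norm.
have m0 : 0 < 2 * modulus b * modulus (a + b) ^+ 2.
  by rewrite !mulr_gt0 ?exprn_gt0 ?modulus_gt0.
rewrite ler_pdivrMr// expr2 mulrAC ler_wpM2r ?modulus_ge0//.
rewrite (le_trans (ltW hr))// mulrC ler_wpM2l ?(ltW e0)//.
rewrite exprS mulrA; apply: ler_pM; rewrite ?exprn_ge0 ?(ltW c0)//.
- by rewrite mulr_ge0 ?(ltW c0).
- by rewrite ler_wpM2l// Re_le_mod.
- by apply: lerXn2r; rewrite ?nnegrE ?modulus_ge0 ?(ltW c0).
Qed.

(** The principal [2 ^ k]-th root. *)
Definition root2 k (w : R[i]) : R[i] := iter k (@sqrtc R) w.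

Lemma root2K k w : root2 k w ^+ (2 ^ k) = w.
Proof.
by elim: k w => [|k IH] w //; rewrite expnS exprM /root2 iterS sqr_sqrtc IH.
Qed.

Lemma Re_root2 k w : 0 < Re w -> 0 < Re (root2 k w).
Proof. by move=> w0; elim: k => //= k; exact: Re_sqrtc_gt0. Qed.

Lemma derivable_root2 k w : 0 < Re w -> derivable (root2 k : R[i]^o -> R[i]^o) w 1.
Proof.
move=> w0; elim: k => [|k IH]; first exact: derivable_id.
have := derivable_sqrtc (Re_root2 k w0).
exact: (@derivable_compK R[i] (root2 k) (@sqrtc R) w IH).
Qed.

Lemma telescope_ratio (a : nat -> R[i]) N : (forall j, (j <= N)%N -> a j != 0) ->
  a 0%N * \prod_(j < N) (a j.+1 / a j) = a N.
Proof.
elim: N => [|N IH] H; first by rewrite big_ord0 mulr1.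
rewrite big_ord_recr/= mulrA IH => [|j jN]; last by rewrite H// leqW.
by rewrite mulrCA mulfV ?mulr1// H.
Qed.

(** Take the product of the principal roots of the ratios of [g] at consecutive points of
    a fine subdivision of the segment from [z0] to [z]; the ratios are close to 1 and
    their product telescopes. *)
Lemma exists_root k g z0 T : 0 < T -> entire g ->
  (forall z, square z0 T z -> 1 < modulus (g z)) ->
  exists S : R[i]^o -> R[i]^o, forall z, square z0 T z ->
    derivable S z 1 /\ S z ^+ (2 ^ k) = g z.
Proof.
move=> T0 eg g1.
have [B B0 gB] := @square_bounded R g z0 (2 * T) (fun z _ => @entire_continuous R g z eg).
have C0 := cauchy_const_gt0 R.
(* With N > y, consecutive points are within T / 2 and the values of g at them differ
   by at most 1/2. *)
pose y := Num.max 4 (4 * (cauchy_const R * B)).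
have [N hN] : exists N, y < N%:R by exists (Num.truncn y).+1; exact: truncnS_gt.
have N4 : 4 <= N%:R :> R by rewrite (le_trans _ (ltW hN))// le_max lexx.
have NB : 4 * (cauchy_const R * B) <= N%:R by rewrite (le_trans _ (ltW hN))// le_max lexx orbT.
have N0 : 0 < N%:R :> R by lra.
have NC0 : (N%:R : R[i]) != 0 by rewrite pnatr_eq0 -lt0n -(ltr0n R).
pose p (j : nat) (z : R[i]^o) : R[i]^o := z0 + (j%:R / N%:R) * (z - z0).
have psq j z : (j <= N)%N -> square z0 T z -> square z0 T (p j z).
  move=> jN; case: z z0 {g1 gB} @p => x t [x0 t0] p.
  have jN1 : `|j%:R / N%:R : R| <= 1.
    by rewrite ger0_norm ?divr_ge0// ler_pdivrMr// mul1r ler_nat.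
  have -> : p j (Complex x t) = Complex (x0 + j%:R / N%:R * (x - x0)) (t0 + j%:R / N%:R * (t - t0)).
    rewrite /p -!(rmorph_nat (real_complex R)) -fmorph_div.
    rewrite -[Complex x t - _]/(Complex (x - x0) (t - t0)).
    rewrite -[LHS]/(Complex (x0 + (_ * _ - 0 * _)) (t0 + (_ * _ + 0 * _))).
    by rewrite !mul0r subr0 addr0.
  by case=> /= h1 h2; split; rewrite /= addrAC subrr add0r normrM;
    (apply: le_trans (ler_wpM2r (normr_ge0 _) jN1) _; rewrite mul1r).
have pnz j z : (j <= N)%N -> square z0 T z -> g (p j z) != 0.
  by move=> jN hz; rewrite -modulus_gt0 (lt_trans ltr01)// g1//; exact: psq.
have ratio j z : (j < N)%N -> square z0 T z -> 0 < Re (g (p j.+1 z) / g (p j z)).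
  move=> jN hz.
  have h1 := psq _ _ (ltnW jN) hz.
  have dist : modulus (p j.+1 z - p j z) <= 2 * T / N%:R.
    have -> : p j.+1 z - p j z = (z - z0) / N%:R.
      by rewrite /p -natr1; field.
    rewrite modulusM modulusV -(rmorph_nat (real_complex R)) modulus_real ger0_norm//.
    by rewrite ler_wpM2r ?invr_ge0 ?(ltW N0)// modulus_square.
  have sub u : square (p j z) T u -> square z0 (2 * T) u.
    move: h1; case: (p j z) u => a b [c d] [/= a1 a2] [/= b1 b2]; split => /=.
      by rewrite (le_trans (ler_distD a _ _))//; lra.
    by rewrite (le_trans (ler_distD b _ _))//; lra.
  have dT : 2 * T / N%:R <= T / 2.
    by rewrite ler_pdivrMr//; nra.
  have := @cauchy_lipschitz R g (p j z) T B (p j.+1 z) T0 (fun u _ => eg u)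
    (fun u hu => gB u (sub u hu)) (le_trans dist dT).
  move=> lip.
  have lip2 : modulus (g (p j.+1 z) - g (p j z)) <= 1 / 2.
    rewrite (le_trans lip)// ler_pdivrMr//.
    apply: (@le_trans _ _ (cauchy_const R * B * (2 * T / N%:R))).
      by apply: ler_wpM2l => //; exact: mulr_ge0 (ltW C0) B0.
    rewrite mulrA ler_pdivrMr//; nra.
  have gj : 1 < modulus (g (p j z)) := g1 _ h1.
  have gj0 : g (p j z) != 0 by exact: pnz (ltnW jN) hz.
  have : modulus (g (p j.+1 z) / g (p j z) - 1) <= 1 / 2.
    have -> : g (p j.+1 z) / g (p j z) - 1 = (g (p j.+1 z) - g (p j z)) / g (p j z).
      by rewrite mulrBl divff.
    rewrite modulusM modulusV ler_pdivrMr; last by lra.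
    by rewrite (le_trans lip2)//; lra.
  move: (g (p j.+1 z) / g (p j z)) => [a b] h.
  have := le_trans (Re_le_modulus _) h.
  by rewrite -[Complex a b - 1]/(Complex (a - 1) (b - 0)) /= ler_norml => /andP[? _]; lra.
exists (fun z => root2 k (g z0) * \prod_(j < N) root2 k (g (p j.+1 z) / g (p j z))).
move=> z hz; split; last first.
  rewrite exprMn root2K -prodrXl.
  under eq_bigr do rewrite root2K.
  have -> : g z0 = g (p 0%N z) by rewrite /p mul0r mul0r addr0.
  rewrite (@telescope_ratio (fun j => g (p j z))) => [|j jN]; last exact: pnz.
  by rewrite /p divff// mul1r addrC subrK.
apply: (@derivable_cstMK R[i] (fun z => \prod_(j < N) root2 k (g (p j.+1 z) / g (p j z)))).
apply: (@derivable_prodK R[i] _ _ (fun (j : 'I_N) z => root2 k (g (p j.+1 z) / g (p j z)))) => j.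
have dp i : derivable (fun z => g (p i z)) z 1.
  apply: (@derivable_compK R[i] (p i) g); last exact: eg.
  exact: (@derivable_affineK R[i]).
apply: (@derivable_compK R[i] (fun z => g (p j.+1 z) / g (p j z)) (root2 k)).
  apply: (@derivable_divK R[i] (fun z => g (p j.+1 z)) (fun z => g (p j z))) => //.
  by apply: pnz => //; exact: ltnW.
by apply: derivable_root2; exact: ratio.
Qed.

End Roots.

Section Harnack.
Variable R : realType.
Implicit Types (f g h : R[i]^o -> R[i]^o) (w z u v x y : R[i]^o) (T B : R).

Definition harnack_radius : R := Num.min (1 / 2) (1 / (8 * cauchy_const R)).

Lemma harnack_radius_gt0 : 0 < harnack_radius.
Proof.
have C0 := cauchy_const_gt0 R.
by rewrite lt_min !divr_gt0// mulr_gt0.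
Qed.

Lemma double_exp_bracket (G : R) : 2 <= G ->
  exists k, 2 ^+ (2 ^ k) <= G /\ G < 4 ^+ (2 ^ k).
Proof.
move=> G2.
have ex : exists k, G < 4 ^+ (2 ^ k).
  have [n hn] : exists n, G < n%:R by exists (Num.truncn G).+1; exact: truncnS_gt.
  exists n; rewrite (lt_le_trans hn)// -natrX ler_nat.
  by rewrite ltnW// (leq_trans (ltn_expl n (isT : 1 < 2)%N))// ltnW// ltn_expl.
case: (ex_minnP ex) => k hk mink; exists k; split=> //.
case: k hk mink => [|k] hk mink; first by rewrite expn0 expr1.
rewrite leNgt; apply/negP => h.
suff /mink : G < 4 ^+ (2 ^ k) by rewrite ltnn.
by rewrite (_ : 4 = 2 ^+ 2) -?exprM -?expnS// -natrX.
Qed.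

(** Choose [k] such that the [2 ^ k]-th root of |g(z0)| lies between 2 and 4.  The
    reciprocal of the [2 ^ k]-th root of [g] is bounded by 1 and at least 1/4 at [z0], so
    by Cauchy's estimate it is at least 1/8 nearby. *)
Lemma harnack_center g z0 T w : 0 < T -> entire g ->
  (forall z, square z0 T z -> 2 <= modulus (g z)) ->
  modulus (w - z0) <= harnack_radius * T ->
  modulus (g w) <= modulus (g z0) ^+ 3.
Proof.
move=> T0 eg g2 wT.
have C0 := cauchy_const_gt0 R.
have sz0 : square z0 T z0 by apply: square_modulus; rewrite subrr modulus0 ltW.
have [k [k1 k2]] := double_exp_bracket (g2 _ sz0).
have g1 z : square z0 T z -> 1 < modulus (g z) by move=> /g2; lra.
have [S SP] := exists_root k T0 eg g1.
set q := (2 ^ k)%N in k1 k2 SP.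
have q0 : (0 < q)%N by rewrite expn_gt0.
have Sq z : square z0 T z -> modulus (S z) ^+ q = modulus (g z).
  by move=> /SP[_ <-]; rewrite modulusX.
have S1 z : square z0 T z -> 1 <= modulus (S z).
  move=> hz; rewrite leNgt; apply/negP => h.
  have := g1 z hz; rewrite -Sq//; apply/negP; rewrite -leNgt.
  by rewrite exprn_ile1 ?modulus_ge0// ltW.
have S4 : modulus (S z0) < 4.
  rewrite ltNge; apply/negP => h; move: k2; apply/negP; rewrite -leNgt -Sq//.
  by apply: lerXn2r; rewrite ?nnegrE ?modulus_ge0.
pose phi z : R[i]^o := (S z)^-1.
have dphi z : square z0 T z -> derivable phi z 1.
  move=> hz; apply: (@derivable_VK R[i] S); last by have [] := SP z hz.
  by rewrite -modulus_gt0 (lt_le_trans ltr01)// S1.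
have phi1 z : square z0 T z -> modulus (phi z) <= 1.
  by move=> hz; rewrite modulusV invf_le1 ?S1// (lt_le_trans ltr01)// S1.
have r2 : harnack_radius <= 1 / 2 by rewrite ge_min lexx.
have rC : harnack_radius <= 1 / (8 * cauchy_const R) by rewrite ge_min lexx orbT.
have wT2 : modulus (w - z0) <= T / 2 by rewrite (le_trans wT)//; nra.
have hw : square z0 T w by apply: square_modulus; lra.
have lip : modulus (phi w - phi z0) <= 1 / 8.
  rewrite (le_trans (cauchy_lipschitz T0 dphi phi1 wT2))// mulr1 ler_pdivrMr//.
  rewrite (le_trans (ler_wpM2l (ltW C0) wT))// mulrA ler_wpM2r ?(ltW T0)//.
  by rewrite mulrC -ler_pdivlMr// (le_trans rC)// invfM mulrA.
have p0 : 1 / 4 <= modulus (phi z0).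
  rewrite modulusV mul1r lef_pV2 ?posrE ?(ltW S4)//.
  by rewrite (lt_le_trans ltr01)// S1.
have pw : 1 / 8 <= modulus (phi w).
  have := modulus_sub_le (phi z0) (phi w); rewrite (modulusB (phi z0)).
  lra.
have S8 : modulus (S w) <= 8.
  rewrite -[modulus (S w)]invrK -modulusV -[8]invrK lef_pV2 ?posrE//.
    by rewrite -div1r.
  by rewrite (lt_le_trans _ pw).
rewrite -Sq//; apply: (@le_trans _ _ (8 ^+ q)).
  by apply: lerXn2r; rewrite ?nnegrE ?modulus_ge0.
have -> : 8 ^+ q = (2 ^+ q) ^+ 3 :> R.
  by rewrite -exprM mulnC exprM (_ : 2 ^+ 3 = 8)// -natrX.
by apply: lerXn2r; rewrite ?nnegrE ?exprn_ge0 ?modulus_ge0.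
Qed.

Lemma square_sub z0 x T T' : modulus (x - z0) <= T' -> square x T `<=` square z0 (T + T').
Proof.
move=> h z; have := square_modulus h; case: x z0 z {h} => a b [c d] [p q].
move=> [/= a1 a2] [/= b1 b2]; split => /=.
  by rewrite (le_trans (ler_distD a _ _))//; lra.
by rewrite (le_trans (ler_distD b _ _))//; lra.
Qed.

(** Harnack's inequality for ln|g|, in multiplicative form. *)
Lemma harnack g z0 T x y : 0 < T -> entire g ->
  (forall z, square z0 T z -> 2 <= modulus (g z)) ->
  modulus (x - z0) <= harnack_radius * T / 2 ->
  modulus (y - z0) <= harnack_radius * T / 2 ->
  modulus (g y) <= modulus (g x) ^+ 9.
Proof.
move=> T0 eg g2 hx hy.
have h0 := harnack_radius_gt0.
have r2 : harnack_radius <= 1 / 2 by rewrite ge_min lexx.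
have h1 : modulus (g y) <= modulus (g z0) ^+ 3.
  by apply: (harnack_center T0 eg g2); rewrite (le_trans hy)//; nra.
have T20 : 0 < T / 2 by lra.
have h2 : modulus (g z0) <= modulus (g x) ^+ 3.
  apply: (harnack_center T20 eg) => [z hz|].
    apply: g2; have := @square_sub z0 x (T / 2) (T / 2) _ _ hz.
    have -> : T / 2 + T / 2 = T by field.
    by apply; rewrite (le_trans hx)//; nra.
  by rewrite modulusB (le_trans hx)//; nra.
rewrite (le_trans h1)// (_ : 9 = 3 * 3)%N// exprM.
by apply: lerXn2r; rewrite ?nnegrE ?exprn_ge0 ?modulus_ge0.
Qed.

End Harnack.

(** * Growth of the maximum modulus *)

Section Growth.
Variable R : realType.
Implicit Types (f : R[i]^o -> R[i]^o) (x y r s t m p q sigma A B : R) (n : nat).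

Lemma iter_expR_le n x y : x <= y -> iter n expR x <= iter n expR y.
Proof. by move=> xy; elim: n => //= n IH; rewrite ler_expR. Qed.

Lemma le_iter_expR n x : x <= iter n expR x.
Proof.
elim: n => //= n IH; rewrite (le_trans IH)// (le_trans _ (expR_ge1Dx _))//.
by rewrite lerDr.
Qed.

Lemma iter_ln_expR n x : iter n (@ln R) (iter n expR x) = x.
Proof. by elim: n => // n IH; rewrite iterSr [iter n.+1 expR x]iterS expRK. Qed.

Lemma iter_expR_onto n b r : iter n expR b <= r -> exists2 s, b <= s & r = iter n expR s.
Proof.
elim: n r => [|n IH] r /=; first by exists r.
move=> br; have r0 : 0 < r by rewrite (lt_le_trans _ br)// expR_gt0.
have [|s bs sE] := IH (ln r).
  by rewrite -ler_expR lnK ?posrE.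
by exists s => //; rewrite -sE lnK ?posrE.
Qed.

Lemma iter_expR_add1 n x : 0 <= x -> iter n expR x + 1 <= iter n expR (x + 1).
Proof.
move=> x0; elim: n => //= n IH.
have y0 : 0 <= iter n expR x by rewrite (le_trans x0)// le_iter_expR.
move: (iter n expR x) (iter n expR (x + 1)) y0 IH => y z y0 IH.
apply: (@le_trans _ _ (expR (y + 1))); last by rewrite ler_expR.
rewrite expRD; have := expR_ge1Dx y; have := expR_ge1Dx (1 : R); nra.
Qed.

Lemma mul_iter_expR n m x : 1 <= m -> 1 <= x ->
  m * iter n expR x <= iter n expR (m * x).
Proof.
move=> m1 x1; elim: n => //= n IH.
have y1 : 1 <= iter n expR x by rewrite (le_trans x1)// le_iter_expR.
move: (iter n expR x) (iter n expR (m * x)) y1 IH => y z y1 IH.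
apply: (@le_trans _ _ (expR (m * y))); last by rewrite ler_expR.
have -> : m * y = (m - 1) * y + y by ring.
rewrite expRD ler_wpM2r ?expR_ge0//.
have := expR_ge1Dx ((m - 1) * y); nra.
Qed.

(** Used with y = ln s, to compare s ^ q with ln s. *)
Lemma affine_le_expR A B q : 0 < q -> exists Y, forall y, Y <= y -> A + B * y <= expR (q * y).
Proof.
move=> q0; pose D := `|A| + `|B|.
have D0 : 0 <= D by rewrite addr_ge0.
exists (Num.max 1 (4 * D / q ^+ 2)) => y; rewrite ge_max => /andP[y1 yD].
have q2 : 0 < q ^+ 2 by rewrite exprn_gt0.
have h1 : A + B * y <= D * y.
  have := ler_norm A; have := ler_norm B; have := normr_ge0 A; have := normr_ge0 B.
  by rewrite /D; move: `|A| `|B| => a b; nra.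
have h2 : D * y <= (q * y / 2) ^+ 2.
  move: yD; rewrite ler_pdivrMr// => yD.
  have -> : (q * y / 2) ^+ 2 = (y * q ^+ 2 / 4) * y by field.
  by rewrite ler_wpM2r//; lra.
rewrite (le_trans h1)// (le_trans h2)//.
have -> : expR (q * y) = expR (q * y / 2) ^+ 2.
  by rewrite expr2 -expRD; congr expR; field.
have z0 : 0 <= q * y / 2 by rewrite divr_ge0// mulr_ge0//; lra.
apply: lerXn2r; rewrite ?nnegrE ?expR_ge0//.
by rewrite (le_trans _ (expR_ge1Dx _))// lerDr.
Qed.

Lemma order_bound f : (order_of_growth f < (1 / 2)%:E)%E ->
  exists sigma, [/\ 0 < sigma, sigma < 1 / 2 &
    \forall r \near +oo, ln (ln (max_modulus f r)) / ln r <= sigma].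
Proof.
rewrite /order_of_growth /limf_esup => /ereal_inf_lt[_ [V [A [_ VA]] <-]] Vlt.
have [sg [sg0 sg2 sgV]] : exists sg, [/\ 0 < sg, sg < 1 / 2 &
    (ereal_sup [set (ln (ln (max_modulus f r)) / ln r)%:E | r in V] <= sg%:E)%E].
  move: Vlt; case: (ereal_sup _) => [s| |]//.
    rewrite lte_fin => s2; exists (Num.max s (1 / 4)).
    by rewrite lee_fin le_max lexx lt_max gt_max s2; split=> //; lra.
  by move=> _; exists (1 / 4); split; rewrite ?leNye//; lra.
exists sg; split=> //; exists A; split; first exact: num_real.
move=> r Ar; rewrite -lee_fin (le_trans _ sgV)//.
by apply: ereal_sup_ubound; exists r => //; exact: VA.
Qed.

Section Bounds.
Variables (f : R[i]^o -> R[i]^o) (n : nat) (q : R).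
Hypothesis q0 : 0 < q.
Hypothesis hM : \forall r \near +oo,
  iter n.+1 expR ((iter n (@ln R) r) `^ q) <= max_modulus f r.

Lemma max_modulus_ge_iter : exists r1, forall s, r1 <= s ->
  iter n expR (expR (s `^ q)) <= max_modulus f (iter n expR s).
Proof.
have [A [_ HA]] := hM; exists (`|A| + 1) => s As.
have := HA (iter n expR s); rewrite iter_ln_expR -iterSr; apply.
rewrite (lt_le_trans _ (le_iter_expR n s))// (lt_le_trans _ As)//.
by rewrite (le_lt_trans (ler_norm _))// ltrDl.
Qed.

Lemma max_modulus_gt_id : exists r1, forall r, r1 <= r -> r + 1 <= max_modulus f r.
Proof.
have [s1 H1] := max_modulus_ge_iter; have [Y HY] := affine_le_expR 0 2 q0.
pose b := Num.max s1 (Num.max 2 (expR Y)).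
exists (iter n expR b) => r /iter_expR_onto[s bs ->].
move: bs; rewrite !ge_max => /andP[s1s /andP[s2 sY]].
have sp : 0 < s by lra.
have := H1 s s1s; apply: le_trans.
rewrite (le_trans (iter_expR_add1 n (ltW sp)))// iter_expR_le//.
have := HY (ln s); rewrite -ler_expR lnK ?posrE// => /(_ sY).
rewrite add0r /powR gt_eqF// => h.
apply: (@le_trans _ _ (expR (2 * ln s))); last by rewrite ler_expR.
rewrite mulrDl mul1r expRD lnK ?posrE//; nra.
Qed.

Lemma max_modulus_le_powR : (order_of_growth f < (1 / 2)%:E)%E ->
  exists sigma, [/\ 0 < sigma, sigma < 1 / 2 &
    exists r1, forall r, r1 <= r -> ln (max_modulus f r) <= r `^ sigma].
Proof.
move=> /order_bound[sg [sg0 sg2 [A [_ HA]]]]; have [r1 H1] := max_modulus_gt_id.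
exists sg; split=> //; exists (Num.max 2 (Num.max r1 (`|A| + 1))) => r.
rewrite !ge_max => /andP[r2 /andP[r1r rA]].
have Ar : A < r by rewrite (lt_le_trans _ rA)// (le_lt_trans (ler_norm _))// ltrDl.
have rM := H1 r r1r.
have lr : 0 < ln r by rewrite ln_gt0//; lra.
have lM : 0 < ln (max_modulus f r) by rewrite ln_gt0//; lra.
have := HA r Ar; rewrite ler_pdivrMr// => h.
by rewrite /powR gt_eqF; [rewrite -[leLHS]lnK ?posrE// ler_expR | lra].
Qed.

End Bounds.

(** Both sides are written as exp^n of something; the heart is
    ln m + sigma p y <= y ^ (p q) for y = ln r large. *)
Theorem psi_max_modulus f n q p : (order_of_growth f < (1 / 2)%:E)%E -> (1 <= n)%N ->
  0 < q < 1 ->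
  (\forall r \near +oo, iter n.+1 expR ((iter n (@ln R) r) `^ q) <= max_modulus f r) ->
  1 < p * q ->
  forall m, 1 < m -> exists r0, 0 < r0 /\
      forall r, r0 < r ->
        [/\ r <= psi n p r, r0 < max_modulus f r &
            (psi n p (max_modulus f r)) `^ m <= max_modulus f (psi n p r)].
Proof.
case: n => // n hrho _ /andP[q0 q1] hM pq m m1.
have p0 : 0 < p by rewrite -(pmulr_lgt0 _ q0); lra.
have p1 : 1 < p by rewrite (lt_trans pq)// gtr_pMr.
have [r1 H1] := max_modulus_gt_id q0 hM.
have [r2 H2] := max_modulus_ge_iter hM.
have [sg [sg0 sg2 [r3 H3]]] := max_modulus_le_powR q0 hM hrho.
pose dl := p * q - 1.
have dl0 : 0 < dl by rewrite subr_gt0.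
have lm : 0 < ln m by rewrite ln_gt0.
pose A := ln m + sg * p.
have A0 : 0 < A by rewrite addr_gt0// mulr_gt0.
pose Y := Num.max 1 (Num.max r2 (A `^ dl^-1)).
exists (Num.max (expR Y) (Num.max 2 (Num.max r1 r3))); split.
  by rewrite lt_max expR_gt0.
set r0 := Num.max _ _; move=> r r0r; move: (r0r).
rewrite !gt_max => /andP[rY /andP[r20 /andP[r1r r3r]]].
have rp : 0 < r by lra.
pose y := ln r.
have yY : Y <= y by rewrite -ler_expR lnK ?posrE// ltW.
move: yY; rewrite !ge_max => /andP[y1 /andP[yr2 yA]].
have y0 : 0 < y by lra.
have rE : r = expR y by rewrite lnK ?posrE.
have rM := H1 r (ltW r1r).
have yp : y <= y `^ p by rewrite -{1}(powRr1 (ltW y0)) ler_powR// ltW.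
split.
- rewrite /psi -/y iterS rE ler_expR (le_trans yp)//; exact: le_iter_expR.
- by lra.
have Mp : 0 < max_modulus f r by lra.
have lM1 : 1 <= ln (max_modulus f r).
  rewrite -ler_expR lnK ?posrE//; have : expR 1 <= r by rewrite rE ler_expR.
  lra.
have lMs := H3 r (ltW r3r).
have X1 : 1 <= (ln (max_modulus f r)) `^ p.
  apply: (@le_trans _ _ (1 `^ p)); first by rewrite powR1.
  by rewrite ge0_ler_powR ?nnegrE ?(ltW p0)//; lra.
have Xle : (ln (max_modulus f r)) `^ p <= r `^ (sg * p).
  rewrite powRrM ge0_ler_powR ?nnegrE ?powR_ge0// ?(ltW p0)//; lra.
rewrite {1}/psi iterS -expRM mulrC.
apply: (@le_trans _ _ (iter n.+1 expR (m * r `^ (sg * p)))).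
  rewrite iterS ler_expR (le_trans (mul_iter_expR _ (ltW m1) X1))//.
  by rewrite iter_expR_le// ler_wpM2l//; lra.
rewrite /psi -/y; apply: (le_trans _ (H2 _ (le_trans yr2 yp))).
apply: iter_expR_le.
have -> : m * r `^ (sg * p) = expR (ln m + sg * p * y).
  by rewrite expRD lnK ?posrE ?(lt_trans _ m1)// /powR gt_eqF.
rewrite ler_expR -powRrM.
have -> : p * q = 1 + dl by rewrite /dl; ring.
rewrite powRD; last by rewrite (gt_eqF y0) implybT.
rewrite powRr1 ?(ltW y0)//.
have Ay : A <= y `^ dl.
  have -> : A = (A `^ dl^-1) `^ dl by rewrite -powRrM mulVf ?gt_eqF// powRr1// ltW.
  by rewrite ge0_ler_powR ?nnegrE ?powR_ge0// ?(ltW y0)// ltW.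
apply: (@le_trans _ _ (y * A)); last by rewrite ler_wpM2l// ltW.
rewrite /A; nra.
Qed.

End Growth.

(** * Iterates on the Fatou set *)

Section Dynamics.
Variable R : realType.
Variable f : R[i]^o -> R[i]^o.
Hypothesis ef : entire f.
Implicit Types (z w x y : R[i]^o) (K U V : set R[i]^o) (n k : nat) (M T d e : R).

Lemma entire_iter n : entire (iter n f).
Proof.
elim: n => [|n IH] z; first exact: derivable_id.
by apply: (@derivable_compK R[i] (iter n f) f); [exact: IH|exact: ef].
Qed.

Lemma uniform_near K (u : nat -> R[i]^o -> R[i]^o) g : {uniform K, u @ \oo --> g} ->
  \forall j \near \oo, forall x, K x -> modulus (g x - u j x) < 1.
Proof.
move=> h.
have : nbhs (g : {uniform` K -> R[i]^o})
    [set v : R[i]^o -> R[i]^o | forall x, K x -> modulus (g x - v x) < 1].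
  apply/uniform_nbhs; exists [set xy : R[i]^o * R[i]^o | ball xy.1 1 xy.2].
  split; first exact: (entourage_ball R[i]^o 1%:pos).
  move=> v hv x Kx; have := hv x Kx.
  by rewrite -ball_normE/= normE -[1]/((1:R)%:C%C) ltcR.
exact: h.
Qed.

(** Otherwise there would be a sequence of iterates each taking a value bounded by M' on
    the square and having suprema tending to infinity.  No subsequence converges, to a
    finite limit or to infinity. *)
Lemma fatou_dichotomy z : fatou_set f z -> exists2 T, 0 < T &
  forall M', exists M, forall n, (1 <= n)%N ->
    (exists2 x, square z T x & modulus (iter n f x) <= M') ->
    forall y, square z T y -> modulus (iter n f y) <= M.
Proof.
move=> [U [oU cU Uz nU]].
have [d d0 dU] := (iffLR (open_modulusP _) oU) z Uz.
pose T := d / 4; have T0 : 0 < T by rewrite divr_gt0.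
have sqU : square z T `<=` U.
  by move=> x /modulus_square h; apply: dU; rewrite (le_lt_trans h)// /T; lra.
exists T => // M'; apply: contrapT => /forallNP noM.
have bad (j : nat) : exists n : nat, [/\ (1 <= n)%N,
    exists2 x, square z T x & modulus (iter n f x) <= M' &
    exists2 y, square z T y & j%:R < modulus (iter n f y)].
  have := noM j%:R; move=> /existsNP[n /not_implyP[n1 /not_implyP[hx]]].
  move=> /existsNP[y /not_implyP[hy /negP]]; rewrite -ltNge => hj.
  by exists n; split=> //; exists y.
have [nn nnP] := choice bad.
have Fu j : [set iter n f | n in [set n | (1 <= n)%N]] (iter (nn j) f).
  by exists (nn j) => //; have [] := nnP j.
have [s [hs lim]] := nU (fun j => iter (nn j) f) Fu.
have sj j : (j <= s j)%N.
  by elim: j => // j IH; rewrite (leq_ltn_trans IH)// hs.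
have cK := @square_compact R z T.
case: lim => [[g /(_ _ cK sqU)/uniform_near[J _ HJ]]|/(_ _ cK sqU M')[J _ HJ]].
  have [B B0 HB] := @square_bounded R (iter (nn (s J)) f) z T
    (fun x _ => @entire_continuous R _ x (@entire_iter (nn (s J)))).
  pose j := maxn J (Num.truncn (B + 2)).+1.
  have [_ _ [y hy]] := nnP (s j); apply/negP; rewrite -leNgt.
  have h1 := HJ J (leqnn _) y hy; have h2 := HJ j (leq_maxl _ _) y hy.
  have h3 := HB y hy.
  have jB : B + 2 <= (s j)%:R.
    rewrite ltW// (lt_le_trans (truncnS_gt _))// ler_nat (leq_trans _ (sj j))//.
    exact: leq_maxr.
  rewrite (le_trans _ jB)//.
  have g1 := modulus_sub_le (g y) (iter (nn (s J)) f y).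
  have g2 := modulus_sub_le (iter (nn (s j)) f y) (g y); rewrite modulusB in g2.
  have a1 := le_trans g1 (ltW h1); have a2 := le_trans g2 (ltW h2).
  lra.
have [_ [x hx]] := nnP (s J); rewrite leNgt => + _; apply/negP; rewrite negbK.
exact: HJ J (leqnn _) x hx.
Qed.

(** The exponent [C] is uniform in the number [n] of iterations: this is the form in which
    Harnack's inequality passes from discs to chains of discs. *)
Definition comparable_on K := exists M C, [/\ 1 <= M, (0 < C)%N &
  forall n, (1 <= n)%N -> forall x y, K x -> K y ->
    M < modulus (iter n f y) -> modulus (iter n f y) <= modulus (iter n f x) ^+ C].

(** Compare both points with a common point [w] of the two sets. *)
Lemma comparableU K1 K2 w : K1 w -> K2 w -> comparable_on K1 -> comparable_on K2 ->
  comparable_on (K1 `|` K2).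
Proof.
move=> w1 w2 [M1 [C1 [M11 C10 H1]]] [M2 [C2 [M21 C20 H2]]].
have up (a b : R) C : 0 <= b -> 1 < a -> a <= b ^+ C -> (C <= C1 * C2)%N -> a <= b ^+ (C1 * C2).
  move=> b0 a1 ab CC; have b1 : 1 <= b.
    rewrite leNgt; apply/negP => bl; have := lt_le_trans a1 ab.
    by rewrite ltNge exprn_ile1// ltW.
  by rewrite (le_trans ab)// ler_weXn2l.
have cross (Ka Kb : set R[i]^o) (Ma Mb : R) Ca Cb n x y : Ka w -> Kb w -> 1 <= Ma -> 1 <= Mb ->
    (forall x y, Ka x -> Ka y -> Ma < modulus (iter n f y) ->
       modulus (iter n f y) <= modulus (iter n f x) ^+ Ca) ->
    (forall x y, Kb x -> Kb y -> Mb < modulus (iter n f y) ->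
       modulus (iter n f y) <= modulus (iter n f x) ^+ Cb) ->
    Ka y -> Kb x -> Ma < modulus (iter n f y) -> Mb ^+ Ca < modulus (iter n f y) ->
    modulus (iter n f y) <= modulus (iter n f x) ^+ (Ca * Cb).
  move=> wa wb Ma1 Mb1 Ha Hb ya xb h1 h2.
  have hw := Ha w y wa ya h1.
  have Mw : Mb < modulus (iter n f w).
    rewrite ltNge; apply/negP => hle; have := lt_le_trans h2 hw.
    rewrite ltNge; apply/negP; rewrite negbK.
    by apply: lerXn2r; rewrite ?nnegrE ?modulus_ge0//; lra.
  rewrite mulnC exprM (le_trans hw)//.
  apply: lerXn2r; rewrite ?nnegrE ?exprn_ge0 ?modulus_ge0//.
  exact: Hb.
exists (Num.max (Num.max M1 M2) (Num.max (M2 ^+ C1) (M1 ^+ C2))), (C1 * C2)%N.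
split; [by rewrite !le_max M11|by rewrite muln_gt0 C10|].
move=> n n1 x y hx hy; rewrite !gt_max => /andP[/andP[h1 h2] /andP[h3 h4]].
have y1 : 1 < modulus (iter n f y) by lra.
case: hx => hx; case: hy => hy.
- apply: (up _ _ C1) => //; first exact: modulus_ge0.
    exact: H1.
  by rewrite leq_pmulr.
- rewrite mulnC; apply: (cross K2 K1 M2 M1) => //; [exact: H2|exact: H1].
- apply: (cross K1 K2 M1 M2) => //; [exact: H1|exact: H2].
- apply: (up _ _ C2) => //; first exact: modulus_ge0.
    exact: H2.
  by rewrite leq_pmull.
Qed.

Definition disc z d : set R[i]^o := [set x | modulus (x - z) < d].

(** If the iterate is large at one point of a small disc then, by [fatou_dichotomy], it
    is at least 2 in modulus on a larger square, and Harnack's inequality applies. *)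
Lemma fatou_comparable z : fatou_set f z -> exists2 d, 0 < d & comparable_on (disc z d).
Proof.
move=> /fatou_dichotomy[T T0 HT]; have r0 := harnack_radius_gt0 R.
exists (harnack_radius R * T / 2); first by rewrite divr_gt0 ?mulr_gt0.
have [M HM] := HT 2.
exists (Num.max 1 M), 9%N; split=> //; first by rewrite le_max lexx.
move=> n n1 x y hx hy; rewrite gt_max => /andP[_ hM].
have r2 : harnack_radius R <= 1 / 2 by rewrite ge_min lexx.
have sq w : modulus (w - z) < harnack_radius R * T / 2 -> square z T w.
  by move=> h; apply: square_modulus; rewrite (le_trans (ltW h))//; nra.
apply: (harnack T0 (@entire_iter n)); [|exact: ltW hx|exact: ltW hy].
move=> w hw; rewrite leNgt; apply/negP => h2.
move: hM; rewrite ltNge; apply/negP; rewrite negbK.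
apply: (HM n n1 _ y (sq y hy)); exists w; [exact: hw|exact: ltW].
Qed.

Lemma disc_connected z d : 0 < d -> connected (disc z d).
Proof.
move=> d0.
pose seg x (t : R) : R[i]^o := z + t%:C%C * (x - z).
have cseg x : continuous (seg x).
  move=> t A /nbhs_modulusP[e e0 sub].
  have m0 : 0 < modulus (x - z) + 1 by rewrite ltr_wpDl ?modulus_ge0.
  exists (e / (modulus (x - z) + 1)) => /=; first by rewrite divr_gt0.
  move=> u /= tu; apply: sub.
  have -> : seg x u - seg x t = (u - t)%:C%C * (x - z).
    by rewrite /seg rmorphB; ring.
  rewrite modulusM modulus_real distrC.
  rewrite (@le_lt_trans _ _ (`|t - u| * (modulus (x - z) + 1)))//.
    by rewrite ler_wpM2l// lerDl.
  by rewrite -ltr_pdivlMr.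
have -> : disc z d = \bigcup_(x in disc z d) (seg x @` `[0, 1]).
  apply/seteqP; split.
    move=> x hx; exists x => //; exists 1; first by rewrite /= in_itv/= lexx ler01.
    by rewrite /seg mul1r addrC subrK.
  move=> _ [x hx [t + <-]]; rewrite /= in_itv/= => /andP[t0 t1].
  rewrite /disc /= /seg addrAC subrr add0r modulusM modulus_real ger0_norm//.
  by rewrite (le_lt_trans _ hx)// ler_piMl ?modulus_ge0.
apply: bigcup_connected.
  exists z => x hx; exists 0; first by rewrite /= in_itv/= lexx ler01.
  by rewrite /seg mul0r addr0.
move=> x _; apply: connected_continuous_connected; last exact: continuous_subspaceT.
by apply/connected_intervalP; exact: interval_is_interval.
Qed.

Definition linked z w := exists K, [/\ connected K, comparable_on K, K z & K w].

Lemma linked_disc z w d : 0 < d -> comparable_on (disc w d) -> linked z w ->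
  forall x, disc w d x -> linked z x.
Proof.
move=> d0 cd [K [cK compK Kz Kw]] x hx.
have dw : disc w d w by rewrite /disc /= subrr modulus0.
exists (K `|` disc w d); split; [|exact: comparableU Kw dw compK cd|by left|by right].
by apply: connectedU => //; [exists w|exact: disc_connected].
Qed.

Lemma linked_disc_sym z w x d : 0 < d -> comparable_on (disc w d) -> linked z x ->
  disc w d x -> linked z w.
Proof.
move=> d0 cd [K [cK compK Kz Kx]] hx.
have dw : disc w d w by rewrite /disc /= subrr modulus0.
exists (K `|` disc w d); split; [|exact: comparableU Kx hx compK cd|by left|by right].
by apply: connectedU => //; [exists x|exact: disc_connected].
Qed.

Lemma open_disc z d : open (disc z d).
Proof.
apply/open_modulusP => x hx; exists (d - modulus (x - z)); first by rewrite subr_gt0.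
move=> y hy; rewrite /disc /= (le_lt_trans (modulus_triangle y x z))//.
by rewrite -ltrBrDr.
Qed.

(** The points linked to [z0] form a relatively open and closed subset of the component,
    because every point of the Fatou set has a disc on which the iterates are comparable. *)
Lemma component_linked z0 w : fatou_set f z0 ->
  connected_component (fatou_set f) z0 w -> linked z0 w.
Proof.
move=> Fz0; set C := connected_component _ _.
have CF : C `<=` fatou_set f by exact: connected_component_sub.
have Cz0 : C z0 by exact: connected_component_refl.
have [dd ddP] : exists dd : R[i]^o -> R, forall z, fatou_set f z ->
    0 < dd z /\ comparable_on (disc z (dd z)).
  have ex z : exists d, fatou_set f z -> 0 < d /\ comparable_on (disc z d).
    have [Fz|nFz] := pselect (fatou_set f z); last by exists 0.
    by have [d d0 cd] := fatou_comparable Fz; exists d.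
  by have [dd hd] := choice ex; exists dd.
pose V := C `&` [set z | linked z0 z].
have self z : C z -> disc z (dd z) z.
  by move=> /CF/ddP[d0 _]; rewrite /disc /= subrr modulus0.
suff VC : V = C by move=> Cw; have : V w by [rewrite VC]; case.
apply: (@component_connected _ (fatou_set f) z0).
- exists z0; split=> //; exists (disc z0 (dd z0)).
  have [d0 cd] := ddP _ Fz0.
  by split; [exact: disc_connected|exact: cd|exact: self|exact: self].
- exists (\bigcup_(z in V) disc z (dd z)).
    by apply: bigcup_open => z _; exact: open_disc.
  apply/seteqP; split.
    by move=> z Vz; split; [case: Vz|exists z => //; case: Vz => /self].
  move=> x [Cx [z [Cz lz] xz]]; split=> //.
  have [d0 cd] := ddP _ (CF _ Cz); exact: (linked_disc d0 cd lz).
- exists (~` \bigcup_(z in C `&` [set z | ~ linked z0 z]) disc z (dd z)).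
    by apply: open_closedC; apply: bigcup_open => z _; exact: open_disc.
  apply/seteqP; split.
    move=> x [Cx lx]; split=> // -[z [Cz nl] xz]; apply: nl.
    by have [d0 cd] := ddP _ (CF _ Cz); exact: (linked_disc_sym d0 cd lx xz).
  move=> x [Cx nx]; split=> //; apply: contrapT => nl; apply: nx.
  by exists x => //; exact: self.
Qed.

End Dynamics.

(** * Unbounded components *)

Section UnboundedComponents.
Variable R : realType.
Implicit Types (r s p q m : R) (z w x y : R[i]^o) (n k C : nat).

(** With y = ln r this says that C y < y ^ p for large y, as p > 1. *)
Lemma psi_superpolynomial n p C : (1 <= n)%N -> 1 < p ->
  exists r0, forall r, r0 <= r -> r ^+ C < psi n p r.
Proof.
case: n => // n _ p1; have p10 : 0 < p - 1 by rewrite subr_gt0.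
pose Y : R := Num.max 1 (C.+1%:R `^ (p - 1)^-1).
exists (expR Y) => r rY.
have r0 : 0 < r by rewrite (lt_le_trans (expR_gt0 Y)).
have : Y <= ln r by rewrite -ler_expR lnK ?posrE.
rewrite /psi; move: (ln r) (lnK r0) => y <-; rewrite ge_max => /andP[y1 yC].
have y0 : 0 < y by lra.
rewrite -expRM_natl iterSr; apply: lt_le_trans (le_iter_expR _ _); rewrite ltr_expR.
have -> : y `^ p = y * y `^ (p - 1).
  by rewrite mulr_powRB1 ?(ltW y0)//; lra.
rewrite mulrC ltr_pM2l//; apply: (@lt_le_trans _ _ C.+1%:R); first by rewrite ltr_nat.
have -> : C.+1%:R = (C.+1%:R `^ (p - 1)^-1) `^ (p - 1) :> R.
  by rewrite -powRrM mulVf ?gt_eqF// powRr1.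
by rewrite ge0_ler_powR ?nnegrE ?powR_ge0 ?(ltW p10) ?(ltW y0).
Qed.

Section Components.
Variables (f : R[i]^o -> R[i]^o) (phi : R -> R) (m r0 : R).
Local Notation M := (max_modulus f).
Hypotheses (ef : entire f) (m1 : 1 < m) (r00 : 1 <= r0).
Hypothesis M_gt : forall r, r0 <= r -> r + 1 <= M r.
Hypothesis phi_ge : forall r, r0 <= r -> r <= phi r.
Hypothesis phi_M : forall r, r0 <= r -> (phi (M r)) `^ (2 * m) <= M (phi r).
Hypothesis min_mod : forall r, r0 <= r -> exists2 s, r <= s <= r `^ m &
  forall z, modulus z = s -> M r <= modulus (f z) ^+ 2.
Hypothesis phi_super : forall C, exists r1, forall r, r1 <= r -> r ^+ C < phi r.

Let rad (a : R) k := iter k M a.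

Let rad_ge a k : r0 <= a -> a + k%:R <= rad a k.
Proof.
move=> ra; elim: k => [|k IH]; first by rewrite addr0.
rewrite -natr1 addrA (le_trans (lerD IH (lexx 1)))// /rad iterS M_gt//.
by rewrite (le_trans _ IH)// ler_wpDr.
Qed.

(** The image under the k-th iterate is connected and reaches from psi(R_k) to
    psi(R_k) ^ m, so it meets the circle provided by the minimum modulus theorem. *)
Lemma stretch (K : set R[i]^o) (a : R) : connected K -> r0 <= a ->
  (exists2 x, K x & modulus x <= a) -> (exists2 y, K y & phi a `^ m <= modulus y) ->
  forall k, (exists2 x, K x & modulus (iter k f x) <= rad a k) /\
            (exists2 y, K y & phi (rad a k) `^ m <= modulus (iter k f y)).
Proof.
move=> cK ra hx hy; elim=> [|k [[x Kx xr] [y Ky yr]]]; first by [].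
have rk : r0 <= rad a k by rewrite (le_trans _ (rad_ge k ra))// ler_wpDr.
have rk0 : 0 < rad a k by rewrite (lt_le_trans ltr01)// (le_trans r00).
split.
  by exists x => //; rewrite /rad !iterS; apply: disc_le_max_modulus.
have ph := phi_ge rk; have ph0 : r0 <= phi (rad a k) := le_trans rk ph.
have [s /andP[s1 s2] smin] := min_mod ph0.
have itv : is_interval ((fun z => modulus (iter k f z)) @` K).
  apply/connected_intervalP/connected_continuous_connected => //.
  apply: continuous_subspaceT => z.
  apply: (@continuous_comp R[i]^o R[i]^o).
    exact: (entire_continuous (@entire_iter R f ef k)).
  exact: continuous_modulus.
have [w Kw ws] : ((fun z => modulus (iter k f z)) @` K) s.
  apply: (itv (modulus (iter k f x)) (modulus (iter k f y))).
  - by exists x.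
  - by exists y.
  - by rewrite (le_trans xr (le_trans ph s1)) (le_trans s2 yr).
exists w => //; rewrite iterS.
have h := le_trans (phi_M rk) (smin _ ws).
have h2 : phi (rad a k.+1) `^ (2 * m) = (phi (rad a k.+1) `^ m) ^+ 2.
  by rewrite mulrC powRrM powR_mulrn// powR_ge0.
rewrite -(@ler_pXn2r _ 2) ?nnegrE ?modulus_ge0 ?powR_ge0//.
by rewrite -h2 /rad iterS.
Qed.

(** An unbounded component would contain a connected set as in [stretch] on which the
    iterates are comparable; but phi outgrows powers. *)
Lemma component_bounded : no_unbounded_component (fatou_set f).
Proof.
move=> z0 Fz0; apply: contrapT => unb.
have big B : exists2 w, connected_component (fatou_set f) z0 w & B <= modulus w.
  apply: contrapT => nB; apply: unb.
  exists B%:C%C; split; first by apply/complex_realP; exists B.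
  move=> u Bu w Cw /=; rewrite (le_trans _ (ltW Bu))// normE lecR.
  by rewrite leNgt; apply/negP => /ltW h; apply: nB; exists w.
pose a := Num.max r0 (modulus z0).
have ra : r0 <= a by rewrite le_max lexx.
have [w Cw wB] := big (phi a `^ m).
have [K [cK [Mc [C [M1 C0 HK]]] Kz Kw]] := component_linked ef Fz0 Cw.
have za : modulus z0 <= a by rewrite le_max lexx orbT.
have st := stretch cK ra (ex_intro2 _ _ z0 Kz za) (ex_intro2 _ _ w Kw wB).
have [r1 Hr1] := phi_super C.
pose k := (Num.truncn (Num.max Mc r1)).+1.
have kM : Num.max Mc r1 < k%:R by exact: truncnS_gt.
have a1 : 1 <= a := le_trans r00 ra.
have rk : k%:R <= rad a k by have := rad_ge k ra; lra.
have [kMc kr1] : Mc < rad a k /\ r1 <= rad a k.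
  by move: (lt_le_trans kM rk); rewrite gt_max => /andP[-> /ltW].
have r0k : r0 <= rad a k by rewrite (le_trans ra)// (le_trans _ (rad_ge k ra))// lerDl.
have [[x Kx xr] [y Ky yr]] := st k.
have ph := phi_ge r0k; have r1k := le_trans r00 r0k.
have phm : phi (rad a k) <= modulus (iter k f y).
  by rewrite (le_trans _ yr)// le1r_powR ?(ltW m1)//; lra.
have My : Mc < modulus (iter k f y) by lra.
have := HK k isT x y Kx Ky My; apply/negP; rewrite -ltNge.
apply: lt_le_trans phm; apply: le_lt_trans (Hr1 _ kr1).
by apply: lerXn2r; rewrite ?nnegrE ?modulus_ge0//; lra.
Qed.

End Components.
End UnboundedComponents.

Theorem theorem6 (R : realType) (f : R[i]^o -> R[i]^o) (n : nat) (q p : R)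
  (hf : transcendental_entire f)
  (hrho : (order_of_growth f < (1 / 2)%:E)%E)
  (hn : (1 <= n)%N)
  (hq : 0 < q < 1)
  (hM : \forall r \near +oo,
          iter n.+1 expR ((iter n (@ln R) r) `^ q) <= max_modulus f r)
  (hp : 1 < p * q) :
  (forall m : R, 1 < m ->
    exists r0 : R, 0 < r0 /\
      forall r : R, r0 < r ->
        [/\ r <= psi n p r,
            r0 < max_modulus f r &
            (psi n p (max_modulus f r)) `^ m <= max_modulus f (psi n p r)]) /\
  no_unbounded_component (fatou_set f).
Proof.
have part1 := psi_max_modulus hrho hn hq hM hp; split=> //.
have ef : entire f by case: hf.
have /andP[q0 q1] := hq.
have p1 : 1 < p.
  have p0 : 0 < p by rewrite -(pmulr_lgt0 _ q0); lra.
  by rewrite (lt_trans hp)// gtr_pMr.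
have [r1 H1] := max_modulus_gt_id q0 hM.
have [sg [sg0 sg2 [r3 H3]]] := max_modulus_le_powR q0 hM hrho.
(* The least exponent allowed by the minimum modulus theorem. *)
pose m := (1 - 2 * sg)^-1.
have sgp : 0 < 1 - 2 * sg by lra.
have m1 : 1 < m by rewrite -[ltLHS]invr1 ltf_pV2 ?posrE//; lra.
have mE : 1 <= m * (1 - 2 * sg) by rewrite mulVf// gt_eqF.
have m2 : 1 < 2 * m by lra.
have [r0 [r00 H0]] := part1 (2 * m) m2.
have M_le r : Num.max r3 r1 <= r -> max_modulus f r <= expR (r `^ sg).
  rewrite ge_max => /andP[rr3 rr1].
  have [M0|M0] := ltP 0 (max_modulus f r); last by rewrite (le_trans M0)// expR_ge0.
  by rewrite -[leLHS]lnK ?posrE// ler_expR H3.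
have unb B : exists r', forall r, r' <= r -> B <= max_modulus f r.
  exists (Num.max r1 B) => r; rewrite ge_max => /andP[/H1 h ?]; lra.
have [rho0 Hrho] := min_modulus ef sg0 sg2 M_le mE m1 unb.
pose b := Num.max (Num.max 1 r1) (Num.max (r0 + 1) rho0).
have hb r : b <= r -> [/\ 1 <= r, r1 <= r, r0 < r & rho0 <= r].
  by rewrite !ge_max => /andP[/andP[? ?] /andP[? ?]]; split=> //; lra.
have b1 : 1 <= b by rewrite !le_max lexx.
apply: (@component_bounded R f (psi n p) m b ef m1 b1).
- by move=> r /hb[_ /H1].
- by move=> r /hb[_ _ /H0[]].
- by move=> r /hb[_ _ /H0[]].
- by move=> r /hb[_ _ _ /Hrho].
- by move=> C; exact: psi_superpolynomial.
Qed.
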